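(* Consider the $K$-user Gaussian interference channel with confidential messages and one external eavesdropper (IC-CM-EE). Write $Y_0:=Z$ and $\mathcal K_{0,-i}=\{0,1,\dots,K\}\setminus\{i\}$. Let $V_1,\dots,V_K$ be mutually independent random variables taking values in finite sets, and for each $i$ let $X_i$ be generated from $V_i$ through a conditional distribution $p(x_i\mid v_i)$ (so that $V_i\to X_i\to(Y_0,Y_1,\dots,Y_K)$ is a Markov chain, with the $(V_i,X_i)$ pairs mutually independent across $i$), with $E[X_i^2]\le P$. Then every rate tuple $(R_1,\dots,R_K)$ with $$0\le R_i< I(V_i;Y_i)-\max_{j\in\mathcal K_{0,-i}} I(V_i;Y_j\mid V_{-i}^K),\qquad i=1,\dots,K,$$ is achievable under the IC-CM-EE secrecy requirement, where $V_{-i}^K=\{V_j\}_{j\ne i}$.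
   Context: The $K$-user Gaussian interference channel: $Y_i=\sum_{j=1}^K h_{ji}X_j+N_i$ ($i=1,\dots,K$), $Z=\sum_{j=1}^K g_jX_j+N_Z$, fixed nonzero real gains, mutually independent zero-mean unit-variance Gaussian noises i.i.d. over time, power constraint $E[X_i^2]\le P$. Transmitter $i$ encodes a uniform message $W_i$ of rate $R_i=\frac1n\log|\mathcal W_i|$ stochastically into $\mathbf X_i=X_i^n$; receiver $i$ decodes $\hat W_i$ from $\mathbf Y_i=Y_i^n$; $\mathbf Z=Z^n$; $W_{-i}^K=\{W_j\}_{j\neq i}$. A rate tuple is achievable under IC-CM-EE if for every $\epsilon>0$ there exist codes with $\max_j\Pr[W_j\ne\hat W_j]\le\epsilon$, $H(W_1,\dots,W_K\mid\mathbf Z)\ge H(W_1,\dots,W_K)-n\epsilon$, and $H(W_{-i}^K\mid\mathbf Y_i)\ge H(W_{-i}^K)-n\epsilon$ for all $i$. *)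

(* Defs.v *)
From HB Require Import structures.
From mathcomp Require Import all_boot all_order all_algebra.
From mathcomp Require Import all_classical all_reals all_analysis.
Set Implicit Arguments.
Unset Strict Implicit.
Unset Printing Implicit Defensive.
Import Order.TTheory GRing.Theory Num.Theory.
Local Open Scope ring_scope.

Section ICCMEE.
Variable R : realType.

Definition gauss_pdf (u : R) : R := expR (- (u ^+ 2 / 2)) / Num.sqrt (pi *+ 2).

Fixpoint iint d (T : measurableType d) (I : eqType)
  (nu : I -> {measure set T -> \bar R}) (s : seq I)
  (F : (I -> T) -> \bar R) (x : I -> T) : \bar R :=
  match s with
  | [::] => F x
  | j :: s' => (\int[nu j]_t iint nu s' F (fun k => if k == j then t else x k))%E
  end.

Definition int_Rn (n : nat) (F : ('I_n -> R) -> \bar R) : \bar R :=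
  iint (fun _ : 'I_n => (@lebesgue_measure R : {measure set _ -> \bar R}))
       (enum 'I_n) F (fun _ => 0).

Definition condH_disc (U A B : finType) (p : U -> R) (a : U -> A) (b : U -> B) : R :=
  \sum_(x : A) \sum_(z : B)
    let q := \sum_(u | (a u == x) && (b u == z)) p u in
    let qb := \sum_(u | b u == z) p u in
    - (q * ln (q / qb)).

(* Conditional entropy H(a(U) | Y, b(U)), where U is finite with pmf p and
   Y has conditional density g u given U = u w.r.t. the integral integ. *)
Definition condH_cont (U A B : finType) (Y : Type) (p : U -> R)
  (a : U -> A) (b : U -> B) (g : U -> Y -> R)
  (integ : (Y -> \bar R) -> \bar R) : \bar R :=
  (\sum_(x : A) \sum_(z : B)
    integ (fun y =>
      let q := (\sum_(u | (a u == x) && (b u == z)) p u * g u y)%R in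
      let qb := (\sum_(u | b u == z) p u * g u y)%R in
      ((- (q * ln (q / qb)))%R)%:E))%E.

Definition minfo (U A B : finType) (Y : Type) (p : U -> R)
  (a : U -> A) (b : U -> B) (g : U -> Y -> R)
  (integ : (Y -> \bar R) -> \bar R) : \bar R :=
  ((condH_disc p a b)%:E - condH_cont p a b g integ)%E.

(* Channel outputs are indexed by option 'I_K: None is the eavesdropper
   output Z = Y_0, Some i is the output Y_i of receiver i.  Gain of
   transmitter j at output o: *)
Definition gain (K : nat) (h : 'I_K -> 'I_K -> R) (g : 'I_K -> R)
  (o : option 'I_K) (j : 'I_K) : R :=
  if o is Some i then h j i else g j.

Definition pV_joint (K : nat) (V : 'I_K -> finType) (pV : forall j, V j -> R)
  (v : {dffun forall j : 'I_K, V j}) : R := \prod_(j < K) pV j (v j).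

(* conditional density of the output Y_o given (V_1,...,V_K) = v, where
   X_j ~ mu j (v j) independently and Y_o = sum_j gain o j X_j + N_o *)
Definition out_density (K : nat) (V : 'I_K -> finType) (h : 'I_K -> 'I_K -> R)
  (g : 'I_K -> R) (mu : forall j, V j -> probability R R) (o : option 'I_K)
  (v : {dffun forall j : 'I_K, V j}) (y : R) : R :=
  fine (iint (fun j => (mu j (v j) : {measure set R -> \bar R})) (enum 'I_K)
    (fun x => (gauss_pdf (y - \sum_(j < K) gain h g o j * x j))%:E)
    (fun _ => 0)).

Definition int_R (F : R -> \bar R) : \bar R :=
  (\int[@lebesgue_measure R]_y F y)%E.

Definition proj_i (K : nat) (V : 'I_K -> finType) (i : 'I_K) (v : {dffun forall j : 'I_K, V j}) : V i := v i.
Definition proj_mi (K : nat) (V : 'I_K -> finType) (i : 'I_K) (v : {dffun forall j : 'I_K, V j})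
  : {dffun forall j : 'I_K, option (V j)} :=
  [ffun j => if j == i then None else Some (v j)].

Definition MI_single (K : nat) (V : 'I_K -> finType) (h : 'I_K -> 'I_K -> R)
  (g : 'I_K -> R) (pV : forall j, V j -> R) (mu : forall j, V j -> probability R R)
  (i : 'I_K) (o : option 'I_K) : \bar R :=
  minfo (pV_joint pV) (proj_i i) (fun _ => tt) (out_density h g mu o) int_R.

Definition MI_cond (K : nat) (V : 'I_K -> finType) (h : 'I_K -> 'I_K -> R)
  (g : 'I_K -> R) (pV : forall j, V j -> R) (mu : forall j, V j -> probability R R)
  (i : 'I_K) (o : option 'I_K) : \bar R :=
  minfo (pV_joint pV) (proj_i i) (proj_mi i) (out_density h g mu o) int_R.

Record code (K : nat) (n : nat) (M : 'I_K -> nat) := Code {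
  enc : forall j : 'I_K, 'I_(M j) -> probability (n.-tuple R) R;
  dec : forall j : 'I_K, n.-tuple R -> 'I_(M j) }.
Arguments code : clear implicits.
Arguments enc [K n M] c j _.

Definition msg (K : nat) (M : 'I_K -> nat) := {dffun forall j : 'I_K, 'I_(M j)}.

Definition p_msg (K : nat) (M : 'I_K -> nat) (w : msg M) : R :=
  \prod_(j < K) (M j)%:R^-1.

Definition blk_density (K n : nat) (M : 'I_K -> nat) (h : 'I_K -> 'I_K -> R)
  (g : 'I_K -> R) (C : code K n M) (o : option 'I_K) (w : msg M)
  (y : 'I_n -> R) : R :=
  fine (iint (fun j => (enc C j (w j) : {measure set (n.-tuple R) -> \bar R}))
    (enum 'I_K)
    (fun x => (\prod_(t < n)
       gauss_pdf (y t - \sum_(j < K) gain h g o j * tnth (x j) t))%:E)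
    (fun _ => [tuple (0 : R) | _ < n])).

Definition err_prob (K n : nat) (M : 'I_K -> nat) (h : 'I_K -> 'I_K -> R)
  (g : 'I_K -> R) (C : code K n M) (j : 'I_K) : \bar R :=
  (\sum_(w : msg M) (p_msg w)%:E *
     int_Rn (fun y => (blk_density h g C (Some j) w y *
                       (dec C j [tuple y t | t < n] != w j)%:R)%:E))%E.

Definition msg_all (K : nat) (M : 'I_K -> nat) (w : msg M) : msg M := w.
Definition msg_mi (K : nat) (M : 'I_K -> nat) (i : 'I_K) (w : msg M)
  : {dffun forall j : 'I_K, option 'I_(M j)} :=
  [ffun j => if j == i then None else Some (w j)].

Definition achievable (K : nat) (P : R) (h : 'I_K -> 'I_K -> R)
  (g : 'I_K -> R) (Rt : 'I_K -> R) : Prop :=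
  forall eps : R, 0 < eps ->
  exists (n : nat) (M : 'I_K -> nat) (C : code K n M),
  [/\ (0 < n)%N, (forall j, 0 < M j)%N & (forall j, Rt j <= ln (M j)%:R / n%:R)] /\
  (* average power constraint (1/n) sum_t E[X_{j,t}^2] <= P, the expectation
     being over the uniform message and the encoder randomness *)
  (forall j, (\sum_(w < M j) \int[enc C j w]_x ((\sum_(t < n) tnth x t ^+ 2)%R)%:E
               <= ((M j)%:R * n%:R * P)%:E)%E) /\
  (forall j (w : 'I_(M j)), measurable [set t : n.-tuple R | dec C j t = w]) /\
  (forall j, (err_prob h g C j <= eps%:E)%E) /\
  (condH_cont (@p_msg K M) (@msg_all K M) (fun _ => tt) (blk_density h g C None) (@int_Rn n)
     >= (condH_disc (@p_msg K M) (@msg_all K M) (fun _ => tt) - n%:R * eps)%:E)%E /\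
  (forall i, (condH_cont (@p_msg K M) (msg_mi i) (fun _ => tt) (blk_density h g C (Some i)) (@int_Rn n)
     >= (condH_disc (@p_msg K M) (msg_mi i) (fun _ => tt) - n%:R * eps)%:E)%E).

End ICCMEE.

(* Main.v *)
(* User i draws, for every pair (w, l) of a message and a dummy index, an independent
   codeword with i.i.d. letters of law pV i, and sends it through mu i; l is uniform and
   its rate exceeds max_o I(V_i; Y_o | V_{-i}), while the total rate of (w, l) stays below
   I(V_i; Y_i).

   Secrecy.  By the log-sum inequality the information on the messages leaked to an
   output is at most the sum over i of the information leaked on w_i when the codewords
   of all the other users are revealed.  Soft covering bounds the expectation of each term
   by E ln(1 + e^xi / L), and ln(1 + x) <= x^s / s makes this at most L^(-s) E e^(s xi) / s,
   where xi is the information density of V_i and Y_o given the other users.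

   Reliability.  Receiver i thresholds the information density of its own codewords,
   treating the other users as noise.

   Every exponential moment reduces to a single letter: E e^xi and E e^(-xi) are bounded by
   constants, and e^(s x) <= 1 + s x + 16 s^2 (e^x + e^(-x)), so that the log-moments of
   s xi and -s xi are s I + O(s^2) and - s I + O(s^2).  A small s then gives exponential decay.

   The power constraint has to hold exactly, whereas the codebook only satisfies it up to a
   small excess; a small fraction of idle channel uses absorbs that excess. *)
Require Import Defs.
From HB Require Import structures.
From mathcomp Require Import all_boot all_order all_algebra.
From mathcomp Require Import all_classical all_reals all_analysis.
From mathcomp Require Import measurable_realfun ring lra.
Import Order.TTheory GRing.Theory Num.Theory.
Local Open Scope ring_scope.
Set Implicit Arguments.
Unset Strict Implicit.
Unset Printing Implicit Defensive.

(** * Measurability and iterated integrals *)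

(** Block entropies are iterated Lebesgue integrals over functions, and mutual informations are
    differences in the extended reals, so subtraction and exchange of integrals are the delicate
    operations. The argument keeps to nonnegative measurable integrands, for which Tonelli suffices:
    terms are moved across inequalities instead of being subtracted, the leakage is written as a
    Bregman divergence, and error events and excess power are replaced by exponential majorants.
    Gaussian noise makes every output density strictly positive, so logarithms degenerate only on
    letters of probability zero. A random codebook is a finite weighted sum; its independence is
    expressed by weight-preserving involutions that exchange a coordinate with a fresh copy.
    Revealing the codewords of the other users decouples the users: each one has to hide only its
    own message, which is why [I(V_i; Y_o | V_{-i})] sets the dummy rate of user i alone. Errors,
    leakages and power excess are all bounded in mean, so one averaging over codebooks controls them
    simultaneously. The leakage itself, not divided by the block length, becomes small. *)

Section measurability.
Context {R : realType} {d : measure_display} {T : measurableType d}.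
Implicit Types f g : T -> R.

(** The inverse is [f * expR (- ln (f ^+ 2))]: squaring removes the sign, and the leading factor
    gives the right value where [f] vanishes. *)
Lemma measurable_fun_inv f :
  measurable_fun setT f -> measurable_fun setT (fun x => (f x)^-1).
Proof.
move=> mf.
rewrite (_ : (fun x => _) = (fun x => f x * expR (- ln (f x ^+ 2)))); last first.
  apply/funext => x; have [->|fx0] := eqVneq (f x) 0; first by rewrite invr0 mul0r.
  have fx2 : 0 < f x ^+ 2 by rewrite exprn_even_gt0.
  by rewrite expRN lnK ?posrE// expr2 invfM mulrA divff// mul1r.
apply: measurable_funM => //.
apply: (@measurableT_comp _ _ _ _ _ _ (@expR R)) => //.
apply: (@measurableT_comp _ _ _ _ _ _ (-%R : R -> R)) => //.
by apply: (@measurableT_comp _ _ _ _ _ _ (@ln R)) => //; exact: measurable_funX.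
Qed.

Lemma measurable_fun_div f g : measurable_fun setT f -> measurable_fun setT g ->
  measurable_fun setT (fun x => f x / g x).
Proof. by move=> mf mg; apply: measurable_funM => //; exact: measurable_fun_inv. Qed.

Lemma measurable_fun_ln f : measurable_fun setT f -> measurable_fun setT (fun x => ln (f x)).
Proof. by move=> mf; exact: (@measurableT_comp _ _ _ _ _ _ (@ln R)). Qed.

Lemma measurable_fun_exp f : measurable_fun setT f -> measurable_fun setT (fun x => expR (f x)).
Proof. by move=> mf; exact: (@measurableT_comp _ _ _ _ _ _ (@expR R)). Qed.

Lemma measurable_fun_opp f : measurable_fun setT f -> measurable_fun setT (fun x => - f x).
Proof. by move=> mf; exact: (@measurableT_comp _ _ _ _ _ _ (-%R : R -> R)). Qed.

Lemma measurable_fun_bigsum (I : Type) (s : seq I) (P : pred I) (h : I -> T -> R) :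
  (forall i, measurable_fun setT (h i)) ->
  measurable_fun setT (fun x => \sum_(i <- s | P i) h i x).
Proof.
move=> mh; under eq_fun do rewrite big_mkcond.
by apply: measurable_sum => i; case: (P i).
Qed.

Lemma measurable_fun_bigprod (I : Type) (s : seq I) (P : pred I) (h : I -> T -> R) :
  (forall i, measurable_fun setT (h i)) ->
  measurable_fun setT (fun x => \prod_(i <- s | P i) h i x).
Proof.
move=> mh; elim: s => [|i s IH].
  rewrite (_ : (fun x => _) = cst 1)//.
  by apply/funext => x; rewrite big_nil.
under eq_fun do rewrite big_cons; case: (P i) => //.
exact: measurable_funM.
Qed.

Lemma measurable_fun_nat (b : T -> bool) : measurable_fun setT b ->
  measurable_fun setT (fun x => (b x)%:R : R).
Proof.
move=> mb; rewrite (_ : (fun x => _) = (fun x => if b x then 1 else 0)); last first.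
  by apply/funext => x; case: (b x).
exact: measurable_fun_ifT.
Qed.

End measurability.

Section iterated_lebesgue.
Context {R : realType} (n : nat).
Implicit Types (F G : ('I_n -> R) -> \bar R) (x : 'I_n -> R) (s : seq 'I_n).

Definition upd x j t : 'I_n -> R := fun k => if k == j then t else x k.

(** [int_Rn] integrates functions of ['I_n -> R], while the product sigma-algebra is on tuples;
    measurability is transported along [tnth]. *)
Definition tmeasurable F := measurable_fun setT (fun t : n.-tuple R => F (tnth t)).

Definition ilebesgue s F x : \bar R :=
  iint (fun _ : 'I_n => (@lebesgue_measure R : {measure set _ -> \bar R})) s F x.

Lemma tnth_mktuple_fun x : tnth [tuple x k | k < n] = x.
Proof. by apply/funext => k; rewrite tnth_mktuple. Qed.

(** Joint measurability in the point and in the new coordinate is what Tonelli needs for the partial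
    integral to remain measurable. *)
Lemma tmeasurable_upd2 F j : tmeasurable F ->
  measurable_fun setT (fun p : n.-tuple R * R => F (upd (tnth p.1) j p.2)).
Proof.
move=> mF.
pose g (p : n.-tuple R * R) : n.-tuple R := [tuple upd (tnth p.1) j p.2 k | k < n].
rewrite (_ : (fun p => _) = (fun t : n.-tuple R => F (tnth t)) \o g); last first.
  by apply/funext => p /=; rewrite tnth_mktuple_fun.
apply: (measurableT_comp mF); apply/measurable_fun_tnthP => i.
rewrite (_ : _ \o _ = (fun p : n.-tuple R * R => if i == j then p.2 else tnth p.1 i)); last first.
  by apply/funext => p /=; rewrite tnth_mktuple.
case: eqP => _; first exact: measurable_snd.
by apply: (measurableT_comp (measurable_tnth i)); exact: measurable_fst.
Qed.

Lemma tmeasurable_upd F x j : tmeasurable F ->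
  measurable_fun setT (fun t : R => F (upd x j t)).
Proof.
move=> /(tmeasurable_upd2 j) mF.
rewrite (_ : (fun t => _) = (fun p : n.-tuple R * R => F (upd (tnth p.1) j p.2)) \o
   (fun t : R => ([tuple x k | k < n], t))); last first.
  by apply/funext => t /=; rewrite tnth_mktuple_fun.
by apply: (measurableT_comp mF); exact: measurable_fun_pair.
Qed.

Lemma ilebesgue_cons j s F x :
  ilebesgue (j :: s) F x = (\int[@lebesgue_measure R]_t ilebesgue s F (upd x j t))%E.
Proof. by []. Qed.

Lemma ilebesgue_ge0 s F x : (forall y, 0 <= F y)%E -> (0 <= ilebesgue s F x)%E.
Proof.
move=> F0; elim: s x => [|j s IH] x; first exact: F0.
by rewrite ilebesgue_cons; apply: integral_ge0 => t _; exact: IH.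
Qed.

Lemma ilebesgue_measurable s F : tmeasurable F -> (forall y, 0 <= F y)%E ->
  tmeasurable (ilebesgue s F).
Proof.
move=> mF F0; elim: s => [//|j s IH].
have := @measurable_fun_fubini_tonelli_F _ _ (n.-tuple R) _ _ (@lebesgue_measure R)
  (fun p => ilebesgue s F (upd (tnth p.1) j p.2)) (tmeasurable_upd2 j IH).
by apply => p; exact: ilebesgue_ge0.
Qed.

Lemma ilebesgue_le s F G x : tmeasurable F -> tmeasurable G ->
  (forall y, 0 <= F y)%E -> (forall y, F y <= G y)%E ->
  (ilebesgue s F x <= ilebesgue s G x)%E.
Proof.
move=> mF mG F0 FG; have G0 y : (0 <= G y)%E by exact: le_trans (FG y).
elim: s x => [|j s IH] x; first exact: FG.
rewrite !ilebesgue_cons; apply: ge0_le_integral => //.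
- by move=> t _; exact: ilebesgue_ge0.
- exact: tmeasurable_upd (ilebesgue_measurable _ mF F0).
- exact: tmeasurable_upd (ilebesgue_measurable _ mG G0).
Qed.

Lemma ilebesgueD s F G x : tmeasurable F -> tmeasurable G ->
  (forall y, 0 <= F y)%E -> (forall y, 0 <= G y)%E ->
  (ilebesgue s (fun y => F y + G y) x = ilebesgue s F x + ilebesgue s G x)%E.
Proof.
move=> mF mG F0 G0; elim: s x => [//|j s IH] x.
rewrite !ilebesgue_cons -ge0_integralD//.
- by apply: eq_integral => t _; exact: IH.
- by move=> t _; exact: ilebesgue_ge0.
- exact: tmeasurable_upd (ilebesgue_measurable _ mF F0).
- by move=> t _; exact: ilebesgue_ge0.
- exact: tmeasurable_upd (ilebesgue_measurable _ mG G0).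
Qed.

Lemma ilebesgueZ s F (c : R) x : 0 <= c -> tmeasurable F -> (forall y, 0 <= F y)%E ->
  (ilebesgue s (fun y => c%:E * F y) x = c%:E * ilebesgue s F x)%E.
Proof.
move=> c0 mF F0; elim: s x => [//|j s IH] x.
rewrite !ilebesgue_cons -ge0_integralZl//.
- by apply: eq_integral => t _; exact: IH.
- exact: tmeasurable_upd (ilebesgue_measurable _ mF F0).
- by move=> t _; exact: ilebesgue_ge0.
Qed.

End iterated_lebesgue.

Section Rn_integral.
Context {R : realType} {n : nat}.
Implicit Types (F G : ('I_n -> R) -> R).

Definition rmeasurable F := measurable_fun setT (fun t : n.-tuple R => F (tnth t)).

Definition Rn_int F : \bar R := int_Rn (fun y => (F y)%:E).

Let rmE F : rmeasurable F -> tmeasurable (fun y => (F y)%:E).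
Proof. by move=> mF; apply/measurable_EFinP. Qed.

Lemma Rn_int_ge0 F : (forall y, 0 <= F y) -> (0 <= Rn_int F)%E.
Proof. by move=> F0; apply: ilebesgue_ge0 => y; rewrite lee_fin. Qed.

Lemma eq_Rn_int F G : (forall y, F y = G y) -> Rn_int F = Rn_int G.
Proof. by move=> FG; rewrite (_ : F = G)//; exact/funext. Qed.

Lemma Rn_int_le F G : rmeasurable F -> rmeasurable G -> (forall y, 0 <= F y) ->
  (forall y, F y <= G y) -> (Rn_int F <= Rn_int G)%E.
Proof.
move=> /rmE mF /rmE mG F0 FG; apply: ilebesgue_le => // y; rewrite lee_fin//.
Qed.

Lemma Rn_intD F G : rmeasurable F -> rmeasurable G -> (forall y, 0 <= F y) ->
  (forall y, 0 <= G y) -> (Rn_int (fun y => F y + G y)%R = Rn_int F + Rn_int G)%E.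
Proof.
move=> /rmE mF /rmE mG F0 G0; rewrite -[RHS]ilebesgueD// => y; exact: F0 || exact: G0.
Qed.

Lemma Rn_intZ c F : 0 <= c -> rmeasurable F -> (forall y, 0 <= F y) ->
  (Rn_int (fun y => c * F y)%R = c%:E * Rn_int F)%E.
Proof.
by move=> c0 /rmE mF F0; rewrite -[RHS]ilebesgueZ// => y; exact: F0.
Qed.

Lemma Rn_int0 : Rn_int (fun=> 0) = 0%E.
Proof.
have := @Rn_intZ 0 (fun=> 0) (lexx _) (measurable_cst _) (fun=> lexx _).
by rewrite mul0e => <-; apply: eq_Rn_int => y; rewrite mulr0.
Qed.

Lemma Rn_int_sum (I : Type) (s : seq I) (P : pred I) (F : I -> ('I_n -> R) -> R) :
  (forall i, rmeasurable (F i)) -> (forall i y, 0 <= F i y) ->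
  (Rn_int (fun y => \sum_(i <- s | P i) F i y)%R = \sum_(i <- s | P i) Rn_int (F i))%E.
Proof.
move=> mF F0; elim: s => [|i s IH].
  by rewrite big_nil -[RHS]Rn_int0; apply: eq_Rn_int => y; rewrite big_nil.
rewrite big_cons -IH; case: ifPn => Pi; last first.
  by apply: eq_Rn_int => y; rewrite big_cons (negbTE Pi).
rewrite -Rn_intD//.
- by apply: eq_Rn_int => y; rewrite big_cons Pi.
- exact: measurable_fun_bigsum.
- by move=> y; apply: sumr_ge0.
Qed.

Lemma rmeasurable_coord (f : R -> R) t : measurable_fun setT f ->
  rmeasurable (fun y => f (y t)).
Proof. by move=> mf; apply: (measurableT_comp mf); exact: measurable_tnth. Qed.

Lemma Rn_int_prod (f : 'I_n -> R -> R) (c : 'I_n -> R) :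
  (forall t, measurable_fun setT (f t)) -> (forall t u, 0 <= f t u) ->
  (forall t, \int[@lebesgue_measure R]_u (f t u)%:E = (c t)%:E)%E ->
  Rn_int (fun y => \prod_t f t (y t)) = (\prod_t c t)%:E.
Proof.
move=> mf f0 fc; have c0 t : 0 <= c t.
  by rewrite -lee_fin -fc; apply: integral_ge0 => u _; rewrite lee_fin.
(* Generalization to a partial integration: the coordinates in [s] already show their integral, the
   others still show the integrand at [x]. *)
suff H s (x : 'I_n -> R) : uniq s ->
    ilebesgue s (fun y => (\prod_t f t (y t))%:E) x =
    (\prod_t (if t \in s then c t else f t (x t)))%:E.
  rewrite [LHS]H ?enum_uniq//; congr (_%:E).
  by apply: eq_bigr => t _; rewrite mem_enum.
elim: s x => [|j s IH] x /=; first by [].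
move=> /andP[js us]; rewrite ilebesgue_cons.
under eq_integral => t _.
  rewrite IH// (bigD1 j)//= (negbTE js) /upd eqxx.
  rewrite (eq_bigr (fun k => if k \in s then c k else f k (x k))); last first.
    by move=> k /negbTE ->.
  rewrite mulrC EFinM.
over.
rewrite ge0_integralZl//=; last 3 first.
- by apply/measurable_EFinP; exact: mf.
- by move=> t _; rewrite lee_fin.
- by rewrite lee_fin; apply: prodr_ge0 => k _; case: ifP.
rewrite fc -EFinM mulrC; congr (_%:E).
rewrite [RHS](bigD1 j)//= inE eqxx; congr (_ * _).
by apply: eq_bigr => k kj; rewrite inE (negbTE kj).
Qed.

End Rn_integral.

(** * Random codebooks *)

Section product_weights.
Context {R : realType} {I : finType} {T : I -> finType}.
Variable p : forall i, T i -> R.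
Implicit Types f : {dffun forall i, T i}.

Definition dweight f : R := \prod_i p (f i).

Definition dupd f i (x : T i) : {dffun forall i, T i} := [ffun k => eqtype.dfwith f x k].

Lemma dupd_same f i (x : T i) : dupd f x i = x.
Proof. by rewrite ffunE eqtype.dfwith_in. Qed.

Lemma dupd_neq f i (x : T i) k : i != k -> dupd f x k = f k.
Proof. by move=> ik; rewrite ffunE eqtype.dfwith_out. Qed.

Lemma dupd_id f i : dupd f (f i) = f.
Proof.
by apply/ffunP => k; have [<-|ik] := eqVneq i k; rewrite ?dupd_same ?dupd_neq.
Qed.

Lemma dupd_dupd f i (x y : T i) : dupd (dupd f x) y = dupd f y.
Proof.
by apply/ffunP => k; have [<-|ik] := eqVneq i k; rewrite ?dupd_same ?dupd_neq.
Qed.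

Lemma dweight_dupd f i (x : T i) : dweight (dupd f x) * p (f i) = dweight f * p x.
Proof.
rewrite /dweight (bigD1 i)//= [in RHS](bigD1 i)//= dupd_same.
rewrite (eq_bigr (fun k => p (f k))); last first.
  by move=> k ki; rewrite dupd_neq// eq_sym.
by rewrite mulrAC [RHS]mulrAC; congr (_ * _); rewrite mulrC.
Qed.

(** Exchanging coordinate [i] of [f] with an independent copy [x] is an involution on pairs that
    preserves the joint weight. Independence of the coordinates is used in this form. *)
Lemma resample i (H : {dffun forall i, T i} -> T i -> R) :
  \sum_f \sum_(x : T i) dweight f * p x * H f x =
  \sum_f \sum_(x : T i) dweight f * p x * H (dupd f x) (f i).
Proof.
rewrite !pair_big/=.
pose sw (u : {dffun forall i, T i} * T i) := (dupd u.1 u.2, u.1 i).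
have swK : involutive sw by case=> f x; rewrite /sw/= dupd_dupd dupd_same dupd_id.
rewrite (reindex_inj (inv_inj swK)); apply: eq_bigr => -[f x] _ /=.
by rewrite dweight_dupd.
Qed.

Lemma dweight_ge0 f : (forall i x, 0 <= p (i:=i) x) -> 0 <= dweight f.
Proof. by move=> p0; apply: prodr_ge0. Qed.

Lemma sum_dweight : \sum_f dweight f = \prod_i \sum_(x : T i) p x.
Proof.
pose P i : {ffun T i -> R} := [ffun x => p x].
rewrite (reindex (@dffun_of_fprod _ T)); last exact/onW_bij/dffun_of_fprod_bij.
under eq_bigr => t _ do (rewrite /dweight; under eq_bigr => i _ do rewrite ffunE).
have := @big_fprod R 0 1 *%R +%R I T P.
move=> bigE; rewrite [LHS](_ : _ = \sum_(t : fprod T) \prod_(i in I) P i (t i)); last first.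
  by apply: eq_bigr => t _; apply: eq_bigr => i _; rewrite ffunE.
rewrite bigE.
rewrite -(bigA_distr_big_dep (tagged_with T) (fun i u => untag 0 (P i) u)).
apply: eq_bigr => i _; rewrite -(big_tag (fun (i : I) (x : T i) => P i x)).
by apply: eq_bigr => x _; rewrite ffunE.
Qed.

Lemma sum_dweight1 : (forall i, \sum_(x : T i) p x = 1) -> \sum_f dweight f = 1.
Proof. by move=> p1; rewrite sum_dweight big1. Qed.

Lemma dweight_marginal i (H : T i -> R) : (forall i, \sum_(x : T i) p x = 1) ->
  \sum_f dweight f * H (f i) = \sum_x p x * H x.
Proof.
move=> p1; have rs := @resample i (fun f x => H (f i)).
transitivity (\sum_f \sum_(x : T i) dweight f * p x * H (f i)).
  by apply: eq_bigr => f _; rewrite -mulr_suml -mulr_sumr p1 mulr1.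
rewrite rs exchange_big/=; apply: eq_bigr => x _.
rewrite -[RHS]mul1r -(sum_dweight1 p1) mulr_suml.
by apply: eq_bigr => f _; rewrite dupd_same mulrA.
Qed.

End product_weights.

Section random_codebook.
Context {R : realType} {I : finType} {V : I -> finType} {W : I -> finType} {n : nat}.
Variable p : forall i, V i -> R.
Hypothesis p1 : forall i, \sum_(x : V i) p x = 1.

Definition word i := {ffun 'I_n -> V i}.
Definition words := {ffun 'I_n -> {dffun forall i, V i}}.
Definition codebook := {dffun forall i, {ffun W i -> word i}}.

Definition word_weight i (u : word i) : R := \prod_t p (u t).
Definition words_weight (v : words) : R := \prod_t dweight p (v t).
Definition codebook_weight (c : codebook) : R :=
  dweight (fun i (b : {ffun W i -> word i}) => \prod_k word_weight (b k)) c.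

(** The selected codewords are transposed into one letter tuple per channel use, because the channel
    acts on the letters of all users at the same time. *)
Definition cwords (c : codebook) (k : forall i, W i) : words :=
  [ffun t => [ffun i => c i (k i) t]].

Definition wcoord (v : words) i : word i := [ffun t => v t i].

Definition set_coord (v : words) i (u : word i) : words :=
  [ffun t => dupd (v t) (u t)].

Definition set_codeword (c : codebook) i (k : W i) (u : word i) : codebook :=
  dupd c ([ffun k' => if k' == k then u else c i k'] : {ffun W i -> word i}).

Definition set_cwords (c : codebook) (k : forall i, W i) (v : words) : codebook :=
  [ffun i => [ffun k' => if k' == k i then wcoord v i else c i k']].

Lemma coord_cwords c k i : wcoord (cwords c k) i = c i (k i).
Proof. by apply/ffunP => t; rewrite !ffunE. Qed.

Lemma sum_word_weight i : \sum_(u : word i) word_weight u = 1.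
Proof.
rewrite -(bigA_distr_bigA (fun (t : 'I_n) (x : V i) => p x)).
by rewrite big1.
Qed.

Lemma sum_words_weight_prod (H : 'I_n -> {dffun forall i, V i} -> R) :
  \sum_v words_weight v * \prod_t H t (v t) =
  \prod_t \sum_u dweight p u * H t u.
Proof.
rewrite (bigA_distr_bigA (fun t u => dweight p u * H t u)).
by apply: eq_bigr => v _; rewrite big_split.
Qed.

Lemma sum_word_weight_prod i (H : 'I_n -> V i -> R) :
  \sum_(v : word i) word_weight v * \prod_t H t (v t) =
  \prod_t \sum_u p u * H t u.
Proof.
rewrite (bigA_distr_bigA (fun t u => p u * H t u)).
by apply: eq_bigr => v _; rewrite big_split.
Qed.

Lemma sum_words_weight : \sum_v words_weight v = 1.
Proof.
have := sum_words_weight_prod (fun _ _ => 1).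
rewrite (eq_bigr words_weight); last by move=> v _; rewrite big1// mulr1.
by move=> ->; rewrite big1// => t _; under eq_bigr do rewrite mulr1; exact: sum_dweight1.
Qed.

Lemma sum_codebook_weight : \sum_c codebook_weight c = 1.
Proof.
apply: sum_dweight1 => i.
rewrite -(bigA_distr_bigA (fun (k : W i) (u : word i) => word_weight u)).
by rewrite big1// => k _; exact: sum_word_weight.
Qed.

Lemma words_weightE v : words_weight v = \prod_i word_weight (wcoord v i).
Proof.
rewrite /words_weight /dweight exchange_big/=.
by apply: eq_bigr => i _; apply: eq_bigr => t _; rewrite ffunE.
Qed.

(** One codeword per user is selected, and these are independent with i.i.d. letters: exchanging
    them with a fresh tuple of words preserves the weight. *)
Lemma cwords_marginal (k : forall i, W i) (H : words -> R) :
  \sum_c codebook_weight c * H (cwords c k) = \sum_v words_weight v * H v.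
Proof.
transitivity (\sum_c \sum_v codebook_weight c * words_weight v * H (cwords c k)).
  apply: eq_bigr => c _; rewrite -[LHS]mulr1 -sum_words_weight mulr_sumr.
  by apply: eq_bigr => v _; rewrite mulrAC.
rewrite pair_big/=.
pose sw (u : codebook * words) := (set_cwords u.1 k u.2, cwords u.1 k).
have swK : involutive sw.
  case=> c v; rewrite /sw/=; congr pair.
    apply/ffunP => i; apply/ffunP => k'; rewrite !ffunE; case: eqP => [->|//].
    exact: coord_cwords.
  by apply/ffunP => t; apply/ffunP => i; rewrite !ffunE eqxx ffunE.
rewrite (reindex_inj (inv_inj swK)).
transitivity (\sum_(u : codebook * words) codebook_weight u.1 * words_weight u.2 * H u.2).
  apply: eq_bigr => -[c v] _ /=.
  have -> : cwords (set_cwords c k v) k = v.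
    by apply/ffunP => t; apply/ffunP => i; rewrite !ffunE eqxx ffunE.
  congr (_ * _); rewrite !words_weightE /codebook_weight /dweight -!big_split/=.
  apply: eq_bigr => i _; rewrite coord_cwords ffunE (bigD1 (k i))//=.
  rewrite [in RHS](bigD1 (k i))//= ffunE eqxx mulrAC [RHS]mulrAC [X in X * _]mulrC.
  congr (_ * _); apply: eq_bigr => k' /negbTE kk'.
  by rewrite ffunE kk'.
rewrite -(pair_big xpredT xpredT (fun c v => codebook_weight c * words_weight v * H v))/=.
under eq_bigr => c _ do (under eq_bigr => v _ do rewrite -mulrA).
under eq_bigr => c _ do rewrite -mulr_sumr.
by rewrite -mulr_suml sum_codebook_weight mul1r.
Qed.

(** The hypothesis says that [H] does not read codeword [k] through its codebook argument, so this
    codeword is independent of the rest and can be averaged separately. *)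
Lemma codeword_resample i (k : W i) (H : codebook -> word i -> R) :
  (forall c u u', H (set_codeword c k u) u' = H c u') ->
  \sum_c codebook_weight c * H c (c i k) =
  \sum_c codebook_weight c * \sum_u word_weight u * H c u.
Proof.
move=> Hc.
transitivity (\sum_c \sum_(u : word i) codebook_weight c * word_weight u * H c (c i k)).
  apply: eq_bigr => c _; rewrite -[LHS]mulr1 -(sum_word_weight i) mulr_sumr.
  by apply: eq_bigr => v _; rewrite mulrAC.
rewrite pair_big/=.
pose sw (u : codebook * word i) := (set_codeword u.1 k u.2, u.1 i k).
have swK : involutive sw.
  case=> c v; rewrite /sw/=; congr pair; last by rewrite dupd_same ffunE eqxx.
  apply/ffunP => i'; have [<-|ii'] := eqVneq i i'; last by rewrite !dupd_neq.
  by rewrite dupd_same; apply/ffunP => k'; rewrite ffunE dupd_same ffunE; case: eqP => [->|].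
rewrite (reindex_inj (inv_inj swK)).
transitivity (\sum_(u : codebook * word i) codebook_weight u.1 * word_weight u.2 * H u.1 u.2).
  apply: eq_bigr => -[c v] _ /=; rewrite Hc dupd_same ffunE eqxx; congr (_ * _).
  rewrite /codebook_weight /dweight (bigD1 i)//= [in RHS](bigD1 i)//=.
  rewrite dupd_same [LHS]mulrAC [RHS]mulrAC; congr (_ * _); last first.
    by apply: eq_bigr => i' ii'; rewrite dupd_neq// eq_sym.
  rewrite (bigD1 k)//= [in RHS](bigD1 k)//= ffunE eqxx mulrAC [RHS]mulrAC.
  rewrite [X in X * _]mulrC; congr (_ * _).
  by apply: eq_bigr => k' /negbTE kk'; rewrite ffunE kk'.
rewrite -(pair_big xpredT xpredT (fun c v => codebook_weight c * word_weight v * H c v))/=.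
apply: eq_bigr => c _; rewrite mulr_sumr.
by apply: eq_bigr => u _; rewrite mulrA.
Qed.

End random_codebook.

Arguments word {I} V n i.
Arguments words {I} V n.
Arguments codebook {I} V W n.

(** * Gaussian mixtures and product laws *)

Section mixing.
Context {R : realType}.
Implicit Types (k : R -> R) (a : R) (nu : probability R R).

(** An invariant stable under mixing. The bound keeps the integrals against probabilities finite, so
    that [fine] loses nothing; the mass is required to be 1 under every shift because mixing
    integrates over shifts. *)
Definition bounded_density k : Prop :=
  [/\ measurable_fun setT k, forall u, 0 < k u, exists B, forall u, k u <= B &
      forall a, (\int[@lebesgue_measure R]_y (k (y - a))%:E = 1)%E].

(** The density of [N + a * X] for independent [N] of density [k] and [X] of law [nu]. *)
Definition mix k a nu (u : R) : R := fine (\int[nu]_x (k (u - a * x))%:E).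

Lemma measurable_affine k a u : measurable_fun setT k ->
  measurable_fun setT (fun x => k (u - a * x)).
Proof.
move=> mk; apply: (@measurableT_comp _ _ _ _ _ _ k) => //.
by apply: measurable_funB => //; exact: mulrl_measurable.
Qed.

Lemma integral_const_probability d (T : measurableType d) (Q : probability T R) (r : R) :
  (\int[Q]_x r%:E = r%:E)%E.
Proof.
transitivity (r%:E * Q setT)%E; first exact: integral_cst.
by rewrite probability_setT mule1.
Qed.

Lemma mixE k a nu u : bounded_density k ->
  ((mix k a nu u)%:E = \int[nu]_x (k (u - a * x))%:E)%E.
Proof.
move=> [mk k0 [B kB] _]; rewrite /mix fineK// ge0_fin_numE; last first.
  by apply: integral_ge0 => x _; rewrite lee_fin ltW.
apply: (@le_lt_trans _ _ (\int[nu]_x B%:E)%E); last first.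
  by rewrite integral_const_probability ltry.
apply: ge0_le_integral => //.
- by move=> x _; rewrite lee_fin ltW.
- by apply/measurable_EFinP; exact: measurable_affine.
- by move=> x _; rewrite lee_fin.
Qed.

Lemma measurable_shift_affine k (a b : R) : measurable_fun setT k ->
  measurable_fun setT (fun p : R * R => k (p.1 - b - a * p.2)).
Proof.
move=> mk; apply: (@measurableT_comp _ _ _ _ _ _ k) => //.
apply: measurable_funB; first by apply: measurable_funB => //; exact: measurable_fst.
by apply: measurable_funM => //; exact: measurable_snd.
Qed.

Lemma bounded_density_mix k a nu : bounded_density k -> bounded_density (mix k a nu).
Proof.
move=> dk; have [mk k0 [B kB] k1] := dk; split.
- have := @measurable_fun_fubini_tonelli_F _ _ R R R nu
    (fun p => (k (p.1 - 0 - a * p.2))%:E).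
  rewrite /fubini_F /=.
  have mf : measurable_fun setT (fun p : R * R => (k (p.1 - 0 - a * p.2))%:E).
    by apply/measurable_EFinP; exact: measurable_shift_affine.
  move=> /(_ mf) /(_ (fun p => ltW (k0 _))) H.
  apply/measurable_EFinP; apply: eq_measurable_fun H => u _ /=.
  by rewrite mixE// subr0.
- move=> u; rewrite -lte_fin mixE// lt0e; apply/andP; split; last first.
    by apply: integral_ge0 => x _; rewrite lee_fin ltW.
  apply/negP => /eqP I0.
  have mf : measurable_fun setT (fun x => (k (u - a * x))%:E).
    by apply/measurable_EFinP; exact: measurable_affine.
  (* A vanishing integral would make the integrand zero almost everywhere; it is positive
     everywhere, so a null set would have probability 1. *)
  have := (ae_eq_integral_abs nu measurableT mf).1.
  under eq_integral => x _ do rewrite gee0_abs ?lee_fin ?ltW//.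
  move=> /(_ I0)[N [mN nuN sN]].
  have := probability_setT nu; rewrite (_ : setT = N); last first.
    apply/seteqP; split => // x _; apply: sN => /= /(_ I) -[] /eqP.
    by rewrite gt_eqF.
  by rewrite nuN => /eqP; rewrite eqe eq_sym oner_eq0.
- exists B => u; rewrite -lee_fin mixE// -(integral_const_probability nu).
  apply: ge0_le_integral => //.
  + by move=> x _; rewrite lee_fin ltW.
  + by apply/measurable_EFinP; exact: measurable_affine.
  + by move=> x _; rewrite lee_fin.
- move=> b; under eq_integral => y _ do rewrite mixE//.
  rewrite (@fubini_tonelli _ _ _ _ _ lebesgue_measure nu
    (fun p => (k (p.1 - b - a * p.2))%:E))/=; last 2 first.
  + by apply/measurable_EFinP; exact: measurable_shift_affine.
  + by move=> p; rewrite lee_fin ltW.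
  under eq_integral => x _.
    (* After Tonelli the two shifts combine into one, and every shift of [k] has mass 1. *)
    under eq_integral => y _ do rewrite -addrA -opprD.
    rewrite k1.
  over.
  by rewrite integral_const_probability.
Qed.

Lemma gauss_pdf_normal (a y : R) : gauss_pdf (y - a) = normal_pdf a 1 y.
Proof.
rewrite normal_pdfE ?oner_eq0//= /gauss_pdf /normal_fun /normal_peak.
by rewrite expr1n mul1r mulrC mulNr.
Qed.

Lemma bounded_density_gauss : bounded_density (@gauss_pdf R).
Proof.
have gE (u : R) : gauss_pdf u = normal_pdf 0 1 u.
  by have := gauss_pdf_normal 0 u; rewrite subr0.
split.
- rewrite (_ : @gauss_pdf R = normal_pdf 0 1); first exact: measurable_normal_pdf.
  exact/funext.
- move=> u; rewrite divr_gt0 ?expR_gt0// sqrtr_gt0.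
  by rewrite mulrn_wgt0// pi_gt0.
- by exists (normal_peak 1) => u; rewrite gE normal_pdf_ub ?oner_eq0.
- by move=> a; under eq_integral => y _ do rewrite gauss_pdf_normal; exact: integral_normal_pdf.
Qed.

End mixing.

(** * Existence of product laws and of uniform mixtures *)

Section product_probability.
Context {R : realType}.

(* The defining property of a product law, restricted to product test functions
   with finite integrals: all that the random coding argument uses. *)
Definition is_product_law n (nu : 'I_n -> probability R R)
    (Q : probability (n.-tuple R) R) : Prop :=
  forall (f : 'I_n -> R -> R) (c : 'I_n -> R),
    (forall t, measurable_fun setT (f t)) -> (forall t u, 0 <= f t u) ->
    (forall t, \int[nu t]_u (f t u)%:E = (c t)%:E)%E ->
    (\int[Q]_x (\prod_t f t (tnth x t))%:E = (\prod_t c t)%:E)%E.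

(** Induction on [n]: the law of the first coordinate times the law of the tail is pushed forward
    along cons. *)
Lemma exists_product_law n (nu : 'I_n -> probability R R) :
  exists Q, is_product_law nu Q.
Proof.
elim: n nu => [|n IH] nu.
  exists (@dirac _ _ [tuple] R : probability (0.-tuple R) R) => f c mf f0 fc.
  rewrite big_ord0; under eq_integral => x _ do rewrite big_ord0.
  exact: integral_const_probability.
have [Q QP] := IH (fun t => nu (lift ord0 t)).
pose X (p : R * n.-tuple R) : n.+1.-tuple R := [the n.+1.-tuple R of p.1 :: p.2].
have mX : measurable_fun setT X.
  by apply: measurable_cons; [exact: measurable_fst|exact: measurable_snd].
pose X_mixin := isMeasurableFun.Build _ _ _ _ _ mX.
pose mfX : {mfun _ >-> _} := HB.pack X X_mixin.
pose P := (nu ord0 \x Q)%E : probability _ R.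
exists (distribution P mfX) => f c mf f0 fc.
have c0 t : 0 <= c t.
  by rewrite -lee_fin -fc; apply: integral_ge0 => u _; rewrite lee_fin.
have mprod m (g : 'I_m -> R -> R) : (forall t, measurable_fun setT (g t)) ->
    measurable_fun setT (fun x : m.-tuple R => (\prod_t g t (tnth x t))%:E).
  move=> mg; apply/measurable_EFinP; apply: measurable_fun_bigprod => t.
  by apply: (@measurableT_comp _ _ _ _ _ _ (g t)) => //; exact: measurable_tnth.
rewrite ge0_integral_distribution//=; last 2 first.
- exact: mprod.
- by move=> y; rewrite lee_fin; apply: prodr_ge0.
rewrite fubini_tonelli1/=; last 2 first.
- apply: (@measurableT_comp _ _ _ _ _ _
    (fun x : n.+1.-tuple R => (\prod_t f t (tnth x t))%:E)) => //; exact: mprod.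
- by move=> y; rewrite lee_fin; apply: prodr_ge0.
rewrite /fubini_F /=.
under eq_integral => u _.
  under eq_integral => x _.
    rewrite big_ord_recl (tnth_nth 0)/=.
    under eq_bigr => t _ do rewrite tnthS.
    rewrite EFinM.
  over.
  rewrite ge0_integralZl//=; last 3 first.
  - by apply: (mprod _ (fun t => f (lift ord0 t))).
  - by move=> x _; rewrite lee_fin; apply: prodr_ge0.
  - by rewrite lee_fin.
  rewrite (QP (fun t => f (lift ord0 t)) (fun t => c (lift ord0 t)))// muleC.
over.
rewrite ge0_integralZl//=; last 3 first.
- exact/measurable_EFinP.
- by move=> u _; rewrite lee_fin.
- by rewrite lee_fin; apply: prodr_ge0.
by rewrite fc big_ord_recl -EFinM mulrC.
Qed.

Definition product_law n (nu : 'I_n -> probability R R) : probability (n.-tuple R) R :=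
  projT1 (cid (exists_product_law nu)).

Lemma product_lawP n (nu : 'I_n -> probability R R) : is_product_law nu (product_law nu).
Proof. exact: projT2 (cid (exists_product_law nu)). Qed.

Context {d : measure_display} {T : measurableType d}.

Lemma exists_uniform_mixture L (Q : 'I_L -> probability T R) : (0 < L)%N ->
  exists P : probability T R, forall F : T -> \bar R,
    measurable_fun setT F -> (forall x, 0 <= F x)%E ->
    (\int[P]_x F x = \sum_(l < L) (L%:R^-1)%:E * \int[Q l]_x F x)%E.
Proof.
case: L Q => // L Q _.
have c0 : (0 : R) <= L.+1%:R^-1 by [].
pose m_ (l : nat) : {measure set T -> \bar R} := Q (inord l).
pose mu := mscale (NngNum c0) (msum m_ L.+1).
have mu1 : mu setT = 1%E.
  transitivity ((L.+1%:R^-1)%:E * \sum_(l < L.+1) (1 : R)%:E)%E.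
    by congr (_ * _)%E; apply: eq_bigr => l _; exact: probability_setT.
  rewrite sumEFin -EFinM sumr_const card_ord -mulr_natr mul1r mulVf//.
pose mixin := Measure_isProbability.Build _ _ _ mu mu1.
pose P : probability T R := HB.pack mu mixin.
exists P => F mF F0.
rewrite [LHS](_ : _ = \int[mu]_x F x)%E//.
rewrite ge0_integral_mscale// ge0_integral_measure_sum//= ge0_sume_distrr; last first.
  by move=> l _; apply: integral_ge0.
by apply: eq_bigr => l _; rewrite /m_ inord_val.
Qed.

Definition uniform_mixture L (L0 : (0 < L)%N) (Q : 'I_L -> probability T R) :=
  projT1 (cid (exists_uniform_mixture Q L0)).

Lemma uniform_mixtureP L (L0 : (0 < L)%N) (Q : 'I_L -> probability T R) (F : T -> \bar R) :
  measurable_fun setT F -> (forall x, 0 <= F x)%E ->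
  (\int[uniform_mixture L0 Q]_x F x = \sum_(l < L) (L%:R^-1)%:E * \int[Q l]_x F x)%E.
Proof. exact: projT2 (cid (exists_uniform_mixture Q L0)) F. Qed.

End product_probability.

(** * Output densities of superposed inputs *)

Section superposition.
Context {R : realType} {K : nat}.
Variable a : 'I_K -> R.

(** The density of the Gaussian noise plus the contributions of the users in [s] only, one
    convolution per user. *)
Fixpoint gauss_mix (nu : 'I_K -> probability R R) (s : seq 'I_K) : R -> R :=
  if s is j :: s' then mix (gauss_mix nu s') (a j) (nu j) else @gauss_pdf R.

Lemma bounded_density_gauss_mix nu s : bounded_density (gauss_mix nu s).
Proof.
by elim: s => [|j s IH] /=; [exact: bounded_density_gauss|exact: bounded_density_mix].
Qed.

Lemma eq_gauss_mix nu nu' s : {in s, nu =1 nu'} -> gauss_mix nu s = gauss_mix nu' s.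
Proof.
elim: s => [//|j s IH] e /=; rewrite IH ?e ?mem_head// => i is_.
by apply: e; rewrite inE is_ orbT.
Qed.

(** In the inductions on [s], users outside [s] are frozen and only shift the argument of the
    density; integrating over user [j] moves its term out of this shift. *)
Lemma residual_sum (s : seq 'I_K) j (z : R) (x x' : 'I_K -> R) : j \notin s ->
  x' j = z -> (forall i, i != j -> x' i = x i) ->
  \sum_(i | i \notin s) a i * x' i = \sum_(i | i \notin j :: s) a i * x i + a j * z.
Proof.
move=> js xj xi; rewrite (bigD1 j)//= xj addrC; congr (_ + _).
rewrite (eq_bigl (fun i => i \notin j :: s)); last first.
  by move=> i; rewrite inE negb_or andbC.
by apply: eq_bigr => i; rewrite inE negb_or => /andP[ij _]; rewrite xi.
Qed.

Lemma iint_gauss (nu : 'I_K -> probability R R) s (y : R) (x : 'I_K -> R) : uniq s ->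
  iint (fun j => (nu j : {measure set R -> \bar R})) s
    (fun x => (gauss_pdf (y - \sum_j a j * x j))%:E) x =
  (gauss_mix nu s (y - \sum_(j | j \notin s) a j * x j))%:E.
Proof.
elim: s x => [//|j s IH] x /= /andP[js us].
rewrite mixE; last exact: bounded_density_gauss_mix.
apply: eq_integral => z _; rewrite IH//; congr (gauss_mix _ _ _)%:E.
rewrite (residual_sum (x := x) (z := z) js) ?eqxx//; last by move=> i /negbTE ->.
by rewrite opprD addrA.
Qed.

Variables (n : nat) (L : 'I_K -> nat) (L0 : forall j, (0 < L j)%N).
Variable nu : forall j, 'I_(L j) -> 'I_n -> probability R R.

Let blk_law j := uniform_mixture (L0 j) (fun l => product_law (nu l)).

Lemma iint_block s (y : 'I_n -> R) (x : 'I_K -> n.-tuple R) : uniq s ->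
  iint (fun j => (blk_law j : {measure set (n.-tuple R) -> \bar R})) s
    (fun x => (\prod_t gauss_pdf (y t - \sum_j a j * tnth (x j) t))%:E) x =
  (\sum_(l : {dffun forall j, 'I_(L j)}) (\prod_j (L j)%:R^-1) *
    \prod_t gauss_mix (fun j => nu (l j) t) s
              (y t - \sum_(j | j \notin s) a j * tnth (x j) t))%:E.
Proof.
(* The weights run over the dummy indices of all users from the start. Indices of users outside [s]
   are idle, and in the base case the total weight 1 disappears. *)
pose w := dweight (fun j (_ : 'I_(L j)) => (L j)%:R^-1 : R).
have w1 : \sum_l w l = 1.
  apply: sum_dweight1 => j; rewrite sumr_const card_ord -[_ *+ _]mulr_natr mulVf//.
  by rewrite pnatr_eq0 -lt0n.
elim: s x => [|j s IH] x /=.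
  by move=> _; rewrite -mulr_suml -/(w _) w1 mul1r.
move=> /andP[js us].
pose b t := y t - \sum_(i | i \notin j :: s) a i * tnth (x i) t.
pose k (l : {dffun forall j, 'I_(L j)}) t := gauss_mix (fun j => nu (l j) t) s.
have kP l t : bounded_density (k l t) by exact: bounded_density_gauss_mix.
have k_ge0 l t u : 0 <= k l t u by have [_ /(_ u) /ltW] := kP l t.
under eq_integral => z _.
  rewrite IH//.
  rewrite (eq_bigr (fun l => w l * \prod_t k l t (b t - a j * tnth z t))); last first.
    move=> l _; congr (_ * _); apply: eq_bigr => t _; congr (gauss_mix _ _ _).
    rewrite (residual_sum (x := fun i => tnth (x i) t) (z := tnth z t) js) ?eqxx//.
      by rewrite opprD addrA.
    by move=> i /negbTE ->.
over.
have mk l : measurable_fun setT (fun z : n.-tuple R => \prod_t k l t (b t - a j * tnth z t)).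
  apply: measurable_fun_bigprod => t.
  apply: (@measurableT_comp _ _ _ _ _ _ (fun u => k l t (b t - a j * u))); last exact: measurable_tnth.
  by apply: measurable_affine; have [] := kP l t.
have w0 l : 0 <= w l by apply: dweight_ge0 => i _.
rewrite uniform_mixtureP; last 2 first.
- apply/measurable_EFinP; apply: measurable_fun_bigsum => l.
  by apply: measurable_funM => //; exact: measurable_cst.
- by move=> z; rewrite lee_fin; apply: sumr_ge0 => l _; rewrite mulr_ge0// prodr_ge0.
transitivity (\sum_(m < L j) \sum_l ((w l * (L j)%:R^-1) *
    \prod_t mix (k l t) (a j) (nu m t) (b t))%:E)%E.
  apply: eq_bigr => m _.
  under eq_integral => z _ do rewrite -sumEFin.
  rewrite ge0_integral_sum//=; last 2 first.
  - move=> l; apply/measurable_EFinP; apply: measurable_funM => //; exact: measurable_cst.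
  - by move=> l z _; rewrite lee_fin mulr_ge0// prodr_ge0.
  rewrite ge0_sume_distrr; last first.
    by move=> l _; apply: integral_ge0 => z _; rewrite lee_fin mulr_ge0// prodr_ge0.
  apply: eq_bigr => l _.
  under eq_integral => z _ do rewrite EFinM.
  rewrite ge0_integralZl//=; last 3 first.
  - by apply/measurable_EFinP.
  - by move=> z _; rewrite lee_fin prodr_ge0.
  - by rewrite lee_fin.
  rewrite (@product_lawP _ _ (nu m) (fun t u => k l t (b t - a j * u)) (fun t => mix (k l t) (a j) (nu m t) (b t))).
  - by rewrite -!EFinM mulrA [_ * w l]mulrC.
  - by move=> t; apply: measurable_affine; have [] := kP l t.
  - by [].
  - by move=> t; rewrite mixE.
rewrite (eq_bigr (fun m => (\sum_l w l * (L j)%:R^-1 *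
    \prod_t mix (k l t) (a j) (nu m t) (b t))%:E)); last by move=> m _; rewrite -sumEFin.
rewrite sumEFin; congr (_%:E); rewrite exchange_big/=.
have kupd l (m : 'I_(L j)) : k (dupd l m) =2 k l.
  move=> t u; rewrite /k; congr (_ u); apply: eq_gauss_mix => i is_.
  rewrite dupd_neq//; apply/eqP => ji.
  by move: js; rewrite ji is_.
(* The densities for [s] do not depend on [l j], since [j \notin s]. This idle coordinate is
   exchanged with the index [m] just drawn by user [j], leaving a single sum over [l]. *)
have rs := @resample R _ _ (fun j (_ : 'I_(L j)) => (L j)%:R^-1 : R) j
  (fun l m => \prod_t mix (k l t) (a j) (nu m t) (b t)).
rewrite rs; apply: eq_bigr => l _.
rewrite (eq_bigr (fun _ => w l * (L j)%:R^-1 * \prod_t mix (k l t) (a j) (nu (l j) t) (b t))).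
  rewrite sumr_const card_ord -[_ *+ _]mulr_natr mulrAC; congr (_ * _).
  by rewrite -mulrA mulVf ?mulr1// pnatr_eq0 -lt0n.
move=> m _; congr (_ * _); apply: eq_bigr => t _.
by rewrite (_ : k (dupd l m) t = k l t)//; apply/funext => u; exact: kupd.
Qed.

End superposition.

(** * Chernoff bounds for the information density *)

Section chernoff_inequality.
Context {R : realType}.
Implicit Types x y s : R.

Lemma expR_le_quadratic x : expR x <= 1 + x + x ^+ 2 * expR `|x|.
Proof.
have h1 : expR x - 1 <= x * expR x.
  have : (1 - x) * expR x <= 1.
    apply: (@le_trans _ _ (expR (- x) * expR x)).
      by rewrite ler_wpM2r ?expR_ge0// expR_ge1Dx.
    by rewrite -expRD addNr expR0.
  by lra.
have e0 := @expR_ge0 R x.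
have [x0|x0] := leP 0 x.
  rewrite ger0_norm//; suff : x * (expR x - 1) <= x * (x * expR x) by rewrite expr2; lra.
  exact: ler_wpM2l.
have h2 : x <= expR x - 1 by have := @expR_ge1Dx R x; lra.
have h3 : 1 <= expR `|x| by rewrite -[leLHS]expR0 ler_expR.
have : x * (expR x - 1) <= x * x by rewrite ler_wnM2l// ltW.
have : x ^+ 2 * 1 <= x ^+ 2 * expR `|x| by rewrite ler_wpM2l// sqr_ge0.
rewrite !expr2; lra.
Qed.

(** [y <= expR y] at [y = |x| / 4], squared; this is the origin of the constant 16. *)
Lemma sqr_le_expR_norm x : x ^+ 2 <= 16 * expR (`|x| / 2).
Proof.
have h : `|x| / 4 <= expR (`|x| / 4) by have := @expR_ge1Dx R (`|x| / 4); lra.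
have -> : `|x| / 2 = `|x| / 4 + `|x| / 4 by lra.
rewrite expRD -real_normK ?num_real// expr2.
have n0 : 0 <= `|x| / 4 by rewrite divr_ge0.
have := ler_pM n0 n0 h h; lra.
Qed.

(** With [s <= 1/2], the factor [expR (s * |x|)] uses only half of [expR |x|], and the other half
    absorbs [x ^+ 2]. *)
Lemma expR_chernoff s x : 0 <= s -> s <= 2^-1 ->
  expR (s * x) <= 1 + s * x + 16 * s ^+ 2 * (expR x + expR (- x)).
Proof.
move=> s0 s1; apply: (le_trans (expR_le_quadratic _)); rewrite lerD2l normrM (ger0_norm s0).
have -> : (s * x) ^+ 2 = s ^+ 2 * x ^+ 2 by rewrite exprMn.
have h1 : expR (s * `|x|) <= expR (`|x| / 2).
  by rewrite ler_expR mulrC ler_wpM2l.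
have h2 : x ^+ 2 * expR (s * `|x|) <= 16 * expR `|x|.
  have -> : expR `|x| = expR (`|x| / 2) * expR (`|x| / 2) by rewrite -expRD -splitr.
  rewrite mulrA; by apply: ler_pM => //; rewrite ?sqr_ge0 ?expR_ge0 ?sqr_le_expR_norm.
have h3 : expR `|x| <= expR x + expR (- x).
  have [x0|x0] := leP 0 x.
    by rewrite ger0_norm// lerDl expR_ge0.
  by rewrite ltr0_norm// lerDr expR_ge0.
rewrite -[leLHS]mulrA [16 * _]mulrC -[leRHS]mulrA ler_wpM2l ?sqr_ge0//.
by apply: (le_trans h2); rewrite ler_wpM2l.
Qed.

Lemma ln_ge_1Bexp x : 0 < x -> 1 - x^-1 <= ln x.
Proof.
move=> x0; have := @expR_ge1Dx R (- ln x).
by rewrite expRN lnK ?posrE//; lra.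
Qed.

End chernoff_inequality.

Section lebesgue_functional.
Context {R : realType}.
Implicit Types (F G : R -> R).

Definition L_int F : \bar R := int_R (fun y => (F y)%:E).

Lemma L_int_ge0 F : (forall y, 0 <= F y) -> (0 <= L_int F)%E.
Proof. by move=> F0; apply: integral_ge0 => y _; rewrite lee_fin. Qed.

Lemma eq_L_int F G : (forall y, F y = G y) -> L_int F = L_int G.
Proof. by move=> FG; rewrite (_ : F = G)//; exact/funext. Qed.

Lemma L_int_le F G : measurable_fun setT F -> measurable_fun setT G ->
  (forall y, 0 <= F y) -> (forall y, F y <= G y) -> (L_int F <= L_int G)%E.
Proof.
move=> mF mG F0 FG; apply: ge0_le_integral => //; try exact/measurable_EFinP.
- by move=> y _; rewrite lee_fin.
- by move=> y _; rewrite lee_fin.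
Qed.

Lemma L_intD F G : measurable_fun setT F -> measurable_fun setT G ->
  (forall y, 0 <= F y) -> (forall y, 0 <= G y) ->
  (L_int (fun y => F y + G y)%R = L_int F + L_int G)%E.
Proof.
move=> mF mG F0 G0; rewrite -[RHS]ge0_integralD//; try exact/measurable_EFinP.
- by move=> y _; rewrite lee_fin.
- by move=> y _; rewrite lee_fin.
Qed.

Lemma L_intZ c F : 0 <= c -> measurable_fun setT F -> (forall y, 0 <= F y) ->
  (L_int (fun y => c * F y)%R = c%:E * L_int F)%E.
Proof.
move=> c0 mF F0; rewrite -[RHS]ge0_integralZl//; try exact/measurable_EFinP.
by move=> y _; rewrite lee_fin.
Qed.

Lemma L_int_sum (I : Type) (s : seq I) (P : pred I) (F : I -> R -> R) :
  (forall i, measurable_fun setT (F i)) -> (forall i y, 0 <= F i y) ->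
  (L_int (fun y => \sum_(i <- s | P i) F i y)%R = \sum_(i <- s | P i) L_int (F i))%E.
Proof.
move=> mF F0; elim: s => [|i s IH].
  rewrite big_nil -[RHS](@integral0 _ _ _ (@lebesgue_measure R) setT).
  by apply: eq_integral => y _; rewrite big_nil.
rewrite big_cons -IH; case: ifPn => Pi; last first.
  by apply: eq_L_int => y; rewrite big_cons (negbTE Pi).
rewrite -L_intD//.
- by apply: eq_L_int => y; rewrite big_cons Pi.
- exact: measurable_fun_bigsum.
- by move=> y; apply: sumr_ge0.
Qed.

End lebesgue_functional.

(** * Exponential moments of the information density *)

Section tilted_information_density.
Context {R : realType} {U A B : finType}.
Variables (p : U -> R) (a : U -> A) (b : U -> B) (g : U -> R -> R).
Hypothesis p_ge0 : forall u, 0 <= p u.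
Hypothesis p_sum1 : \sum_u p u = 1.
Hypothesis mg : forall u, measurable_fun setT (g u).
Hypothesis g_gt0 : forall u y, 0 < g u y.
Hypothesis g_int : forall u, L_int (g u) = 1%E.

Definition pxz x z := \sum_(u | (a u == x) && (b u == z)) p u.
Definition pz z := \sum_(u | b u == z) p u.
Definition qxz x z y := \sum_(u | (a u == x) && (b u == z)) p u * g u y.
Definition qz z y := \sum_(u | b u == z) p u * g u y.

(** The conditional information density [ln (p(y | x, z) / p(y | z))], written with the unnormalized
    densities [qxz] and [qz]. *)
Definition info_density x z y := ln ((qxz x z y / pxz x z) / (qz z y / pz z)).

(** Its integral over [y] is the moment [E e^(s xi)] of the information density. *)
Definition tilted s y := \sum_u p u * g u y * expR (s * info_density (a u) (b u) y).

Let pg_ge0 u y : 0 <= p u * g u y.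
Proof. by rewrite mulr_ge0// ltW. Qed.

Let pxz_ge0 x z : 0 <= pxz x z. Proof. exact: sumr_ge0. Qed.
Let pz_ge0 z : 0 <= pz z. Proof. exact: sumr_ge0. Qed.
Let qxz_ge0 x z y : 0 <= qxz x z y. Proof. exact: sumr_ge0. Qed.
Let qz_ge0 z y : 0 <= qz z y. Proof. exact: sumr_ge0. Qed.


Let sub_sum (F : U -> R) x z : (forall u, 0 <= F u) ->
  \sum_(u | (a u == x) && (b u == z)) F u <= \sum_(u | b u == z) F u.
Proof.
move=> F0; rewrite [leRHS](bigID (fun u => a u == x))/=.
rewrite (eq_bigl (fun u => (b u == z) && (a u == x))); last by move=> u; rewrite andbC.
by rewrite lerDl sumr_ge0.
Qed.

Let pxz_le x z : pxz x z <= pz z. Proof. exact: sub_sum. Qed.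
Let qxz_le x z y : qxz x z y <= qz z y. Proof. exact: sub_sum. Qed.

Let qxz_gt0 x z y : 0 < pxz x z -> 0 < qxz x z y.
Proof.
move=> p0; rewrite lt_neqAle qxz_ge0 andbT eq_sym; apply/eqP => q0.
move: p0; rewrite /pxz big1 ?ltxx// => u au.
have /eqP := psumr_eq0P (fun u _ => pg_ge0 u y) q0 au.
by rewrite mulf_eq0 (gt_eqF (g_gt0 u y)) orbF => /eqP.
Qed.

Let qxz0 x z y : pxz x z = 0 -> qxz x z y = 0.
Proof.
by move=> p0; apply: big1 => u au; rewrite (psumr_eq0P (fun u _ => p_ge0 u) p0 au) mul0r.
Qed.

Let sum_fiber (F : U -> R) : \sum_x \sum_z \sum_(u | (a u == x) && (b u == z)) F u = \sum_u F u.
Proof.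
by rewrite pair_big/= [RHS](partition_big (fun u => (a u, b u)) xpredT)//=.
Qed.

Let sum_pxz : \sum_x \sum_z pxz x z = 1.
Proof. by rewrite sum_fiber. Qed.

Let sum_pz : \sum_(x : A) \sum_z pz z = #|A|%:R.
Proof.
rewrite sumr_const; rewrite (_ : \sum_z pz z = 1)//.
by rewrite -p_sum1 [RHS](partition_big b xpredT).
Qed.

Let m_qxz x z : measurable_fun setT (qxz x z).
Proof.
by apply: measurable_fun_bigsum => u; apply: measurable_funM => //; exact: measurable_cst.
Qed.

Let m_qz z : measurable_fun setT (qz z).
Proof.
by apply: measurable_fun_bigsum => u; apply: measurable_funM => //; exact: measurable_cst.
Qed.

Lemma measurable_info_density x z : measurable_fun setT (info_density x z).
Proof.
apply: measurable_fun_ln; apply: measurable_fun_div; apply: measurable_fun_div => //;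
  exact: measurable_cst.
Qed.

Lemma measurable_tilted s : measurable_fun setT (tilted s).
Proof.
apply: measurable_fun_bigsum => u; apply: measurable_funM.
  by apply: measurable_funM => //; exact: measurable_cst.
apply: measurable_fun_exp; apply: measurable_funM; first exact: measurable_cst.
exact: measurable_info_density.
Qed.

Lemma tilted_ge0 s y : 0 <= tilted s y.
Proof. by apply: sumr_ge0 => u _; rewrite mulr_ge0// expR_ge0. Qed.

Let L_int_comb (P : pred U) : L_int (fun y => \sum_(u | P u) p u * g u y) = (\sum_(u | P u) p u)%:E.
Proof.
rewrite L_int_sum//; last by move=> u; apply: measurable_funM => //; exact: measurable_cst.
rewrite -sumEFin; apply: eq_bigr => u _.
by rewrite L_intZ//= ?g_int ?mule1// => y; exact: ltW.
Qed.

Let tiltedE s y : tilted s y = \sum_x \sum_z qxz x z y * expR (s * info_density x z y).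
Proof.
rewrite -[LHS]sum_fiber; apply: eq_bigr => x _; apply: eq_bigr => z _.
by rewrite mulr_suml; apply: eq_bigr => u /andP[/eqP -> /eqP ->].
Qed.

Let entropy_term x z y := - (qxz x z y * ln (qxz x z y / qz z y)).

Let entropy_term_ge0 x z y : 0 <= entropy_term x z y.
Proof.
rewrite /entropy_term; have [q0|q0] := eqVneq (qxz x z y) 0.
  by rewrite q0 mul0r oppr0.
have q1 : 0 < qxz x z y by rewrite lt_neqAle eq_sym q0 qxz_ge0.
have q2 : 0 < qz z y by exact: lt_le_trans (qxz_le x z y).
rewrite -mulrN mulr_ge0// oppr_ge0 ln_le0// ler_pdivrMr// mul1r; exact: qxz_le.
Qed.

Let m_entropy_term x z : measurable_fun setT (entropy_term x z).
Proof.
apply: measurable_fun_opp; apply: measurable_funM => //.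
by apply: measurable_fun_ln; exact: measurable_fun_div.
Qed.

Let H_cont := condH_cont p a b g (@int_R R).

Let H_contE : H_cont = L_int (fun y => \sum_x \sum_z entropy_term x z y).
Proof.
rewrite L_int_sum; last 2 first.
- by move=> x; apply: measurable_fun_bigsum => z.
- by move=> x y; apply: sumr_ge0.
by apply: eq_bigr => x _; rewrite L_int_sum.
Qed.

Let lnp x z := - ln (pxz x z / pz z).

Let lnp_ge0 x z : 0 <= lnp x z.
Proof.
rewrite /lnp oppr_ge0; have [p0|p0] := eqVneq (pz z) 0.
  by rewrite p0 invr0 mulr0 ln0.
have p1 : 0 < pz z by rewrite lt_neqAle eq_sym p0 pz_ge0.
by rewrite ln_le0// ler_pdivrMr// mul1r pxz_le.
Qed.

Let H_disc := condH_disc p a b.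

Let H_discE : H_disc = \sum_x \sum_z lnp x z * pxz x z.
Proof.
by apply: eq_bigr => x _; apply: eq_bigr => z _; rewrite /lnp mulNr mulrC.
Qed.

Let m_lin (al be : A -> B -> R) : measurable_fun setT
  (fun y => \sum_x \sum_z (al x z * qxz x z y + be x z * qz z y)).
Proof.
apply: measurable_fun_bigsum => x; apply: measurable_fun_bigsum => z.
by apply: measurable_funD; apply: measurable_funM => //; exact: measurable_cst.
Qed.

Let lin_ge0 (al be : A -> B -> R) y : (forall x z, 0 <= al x z) -> (forall x z, 0 <= be x z) ->
  0 <= \sum_x \sum_z (al x z * qxz x z y + be x z * qz z y).
Proof. by move=> a0 b0; do 2 apply: sumr_ge0 => ? _; rewrite addr_ge0// mulr_ge0. Qed.

(** The pointwise majorants below are nonnegative combinations of [qxz] and [qz], whose integrals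
    [pxz] and [pz] are known exactly. *)
Let L_int_lin (al be : A -> B -> R) : (forall x z, 0 <= al x z) -> (forall x z, 0 <= be x z) ->
  L_int (fun y => \sum_x \sum_z (al x z * qxz x z y + be x z * qz z y)) =
  (\sum_x \sum_z (al x z * pxz x z + be x z * pz z))%:E.
Proof.
move=> al0 be0.
have m1 x z : measurable_fun setT (fun y => al x z * qxz x z y).
  by apply: measurable_funM => //; exact: measurable_cst.
have m2 x z : measurable_fun setT (fun y => be x z * qz z y).
  by apply: measurable_funM => //; exact: measurable_cst.
have m3 x z : measurable_fun setT (fun y => al x z * qxz x z y + be x z * qz z y).
  exact: measurable_funD.
have p1 x z y : 0 <= al x z * qxz x z y by rewrite mulr_ge0.
have p2 x z y : 0 <= be x z * qz z y by rewrite mulr_ge0.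
rewrite L_int_sum; last 2 first.
- by move=> x; exact: measurable_fun_bigsum.
- by move=> x y; apply: sumr_ge0 => z _; rewrite addr_ge0.
rewrite -sumEFin; apply: eq_bigr => x _; rewrite L_int_sum//; last first.
  by move=> z y; rewrite addr_ge0.
rewrite -sumEFin; apply: eq_bigr => z _.
by rewrite L_intD// !L_intZ// !L_int_comb.
Qed.

(** [k] bounds [e^xi] on the support, because [qxz <= qz]; [m] is the factor that turns
    [qxz * e^(- xi)] into a multiple of [qz]. *)
Let k x z := pz z / pxz x z.
Let m x z := pxz x z / pz z.
Let k_ge0 x z : 0 <= k x z. Proof. by rewrite divr_ge0. Qed.
Let m_ge0 x z : 0 <= m x z. Proof. by rewrite divr_ge0. Qed.

(** The first term is at most [c * pz z] and the sum over [x] gives [#|A|], which bounds [E e^xi];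
    the second is at most [c * pxz x z] and contributes 1, which bounds [E e^(- xi)]. *)
Let km_sum (c : R) : 0 <= c ->
  \sum_x \sum_z ((c * k x z) * pxz x z + (c * m x z) * pz z) <= c * (#|A|%:R + 1).
Proof.
move=> c0; rewrite -sum_pz -sum_pxz -big_split/= mulr_sumr ler_sum// => x _.
rewrite -big_split/= mulr_sumr ler_sum// => z _.
rewrite -!mulrA -mulrDr ler_wpM2l// lerD//.
  have [->|p0] := eqVneq (pxz x z) 0; first by rewrite !mulr0.
  by rewrite mulVf// mulr1.
have [->|p0] := eqVneq (pz z) 0; first by rewrite !mulr0.
by rewrite mulVf// mulr1.
Qed.

(* The entropy integrand has no sign.  It is rewritten through the tilted exponentials,
   so that every integral taken below has a nonnegative integrand. *)
Let info_split x z y : 0 < pxz x z ->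
  [/\ qxz x z y * expR (info_density x z y) <= k x z * qxz x z y,
      qxz x z y * expR (- info_density x z y) = m x z * qz z y &
      entropy_term x z y = qxz x z y * lnp x z - qxz x z y * info_density x z y].
Proof.
move=> p0; have q0 := qxz_gt0 y p0.
have pz0 : 0 < pz z by exact: lt_le_trans (pxz_le x z).
have qz0 : 0 < qz z y by exact: lt_le_trans (qxz_le x z y).
have d0 : 0 < (qxz x z y / pxz x z) / (qz z y / pz z) by rewrite !divr_gt0.
split.
- rewrite /info_density lnK ?posrE// [leRHS]mulrC ler_wpM2l//.
  rewrite [leLHS](_ : _ = k x z * (qxz x z y / qz z y)); last first.
    by rewrite /k; field; rewrite !gt_eqF.
  by rewrite ler_piMr// ler_pdivrMr// mul1r qxz_le.
- rewrite expRN /info_density lnK ?posrE// /m.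
  by field; rewrite !gt_eqF.
- by rewrite /entropy_term /lnp /info_density !ln_div ?posrE ?divr_gt0//; ring.
Qed.

(** Adding [s] times the entropy integrand cancels the signed linear term [s * xi] of the Chernoff
    bound. The conditional entropy stays on the left because its finiteness is deduced from this
    very inequality. *)
Lemma tilted_up s : 0 <= s -> s <= 2^-1 ->
  (L_int (tilted s) + s%:E * H_cont <= (1 + s * H_disc + 16 * s ^+ 2 * (#|A|%:R + 1))%:E)%E.
Proof.
move=> s0 s1; rewrite H_contE -L_intZ//; last 2 first.
- by apply: measurable_fun_bigsum => x; exact: measurable_fun_bigsum.
- by move=> y; do 2 apply: sumr_ge0 => ? _.
have mH : measurable_fun setT (fun y => s * \sum_x \sum_z entropy_term x z y).
  apply: measurable_funM; first exact: measurable_cst.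
  by apply: measurable_fun_bigsum => x; exact: measurable_fun_bigsum.
have H0 y : 0 <= s * \sum_x \sum_z entropy_term x z y.
  by rewrite mulr_ge0//; do 2 apply: sumr_ge0 => ? _.
rewrite -L_intD//; last 2 first.
- exact: measurable_tilted.
- exact: tilted_ge0.
set c := 16 * s ^+ 2; have c0 : 0 <= c by rewrite mulr_ge0// sqr_ge0.
pose al x z := 1 + s * lnp x z + c * k x z.
pose be x z := c * m x z.
have al0 x z : 0 <= al x z by rewrite !addr_ge0// mulr_ge0.
have be0 x z : 0 <= be x z by rewrite mulr_ge0.
apply: (@le_trans _ _ (L_int (fun y => \sum_x \sum_z (al x z * qxz x z y + be x z * qz z y)))).
  apply: L_int_le => //.
  - by apply: measurable_funD => //; exact: measurable_tilted.
  - by move=> y; rewrite addr_ge0// tilted_ge0.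
  - move=> y; rewrite tiltedE mulr_sumr -big_split/= ler_sum// => x _.
    rewrite mulr_sumr -big_split/= ler_sum// => z _.
    have [p0|p0] := eqVneq (pxz x z) 0.
      rewrite /entropy_term (qxz0 _ p0) !mul0r oppr0 !mulr0 !add0r.
      by rewrite mulr_ge0.
    have {}p0 : 0 < pxz x z by rewrite lt_neqAle eq_sym p0 pxz_ge0.
    have [e1 e2 e3] := info_split y p0.
    have e4 := ler_wpM2l c0 e1.
    have := ler_wpM2l (qxz_ge0 x z y) (expR_chernoff (info_density x z y) s0 s1).
    rewrite -/c e3 /al /be -[c * m x z * _]mulrA -e2; lra.
rewrite L_int_lin// lee_fin H_discE.
have := km_sum c0.
have -> : \sum_x \sum_z (al x z * pxz x z + be x z * pz z) =
  \sum_x \sum_z pxz x z + s * (\sum_x \sum_z lnp x z * pxz x z) +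
  \sum_x \sum_z ((c * k x z) * pxz x z + (c * m x z) * pz z).
  rewrite mulr_sumr -!big_split/=; apply: eq_bigr => x _.
  rewrite mulr_sumr -!big_split/=; apply: eq_bigr => z _.
  by rewrite /al /be; ring.
by rewrite sum_pxz lerD2l.
Qed.

(** The counterpart for [- xi]: here the discrete entropy is added on the left, as an integral, to
    compensate the linear term. *)
Lemma tilted_down s : 0 <= s -> s <= 2^-1 ->
  (L_int (tilted (- s)) + (s * H_disc)%:E <=
   s%:E * H_cont + (1 + 16 * s ^+ 2 * (#|A|%:R + 1))%:E)%E.
Proof.
move=> s0 s1; rewrite H_contE -L_intZ//; last 2 first.
- by apply: measurable_fun_bigsum => x; exact: measurable_fun_bigsum.
- by move=> y; do 2 apply: sumr_ge0 => ? _.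
have mH : measurable_fun setT (fun y => s * \sum_x \sum_z entropy_term x z y).
  apply: measurable_funM; first exact: measurable_cst.
  by apply: measurable_fun_bigsum => x; exact: measurable_fun_bigsum.
have H0 y : 0 <= s * \sum_x \sum_z entropy_term x z y.
  by rewrite mulr_ge0//; do 2 apply: sumr_ge0 => ? _.
set c := 16 * s ^+ 2; have c0 : 0 <= c by rewrite mulr_ge0// sqr_ge0.
pose sl x z := s * lnp x z.
have sl0 x z : 0 <= sl x z by rewrite mulr_ge0.
have HdE : (s * H_disc)%:E = L_int (fun y => \sum_x \sum_z (sl x z * qxz x z y + 0 * qz z y)).
  rewrite (L_int_lin (be := fun _ _ => 0))//.
  rewrite H_discE mulr_sumr; congr (_%:E); apply: eq_bigr => x _.
  by rewrite mulr_sumr; apply: eq_bigr => z _; rewrite mul0r addr0 mulrA.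
pose al x z := 1 + c * k x z.
pose be x z := c * m x z.
have al0 x z : 0 <= al x z by rewrite !addr_ge0// mulr_ge0.
have be0 x z : 0 <= be x z by rewrite mulr_ge0.
have mt := measurable_tilted (- s).
have mz := m_lin sl (fun _ _ => 0).
have z0 y := @lin_ge0 sl (fun _ _ => 0) y sl0 (fun _ _ => lexx _).
have l0 y := lin_ge0 y al0 be0.
rewrite HdE -L_intD//; last exact: tilted_ge0.
apply: (@le_trans _ _ (L_int (fun y => s * (\sum_x \sum_z entropy_term x z y) +
    \sum_x \sum_z (al x z * qxz x z y + be x z * qz z y)))).
  apply: L_int_le => //.
  - exact: measurable_funD.
  - exact: measurable_funD.
  - by move=> y; rewrite addr_ge0 ?tilted_ge0.
  - move=> y; rewrite tiltedE mulr_sumr -!big_split/= ler_sum// => x _.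
    rewrite mulr_sumr -!big_split/= ler_sum// => z _.
    have [p0|p0] := eqVneq (pxz x z) 0.
      rewrite /entropy_term (qxz0 _ p0) !mul0r oppr0 !mulr0 !add0r.
      by rewrite mulr_ge0.
    have {}p0 : 0 < pxz x z by rewrite lt_neqAle eq_sym p0 pxz_ge0.
    have [e1 e2 e3] := info_split y p0.
    have e4 := ler_wpM2l c0 e1.
    have := ler_wpM2l (qxz_ge0 x z y) (expR_chernoff (- info_density x z y) s0 s1).
    rewrite opprK -/c e3 /al /be /sl -[c * m x z * _]mulrA -e2 mulrN mulNr; lra.
rewrite L_intD// leeD2l// L_int_lin// lee_fin.
have := km_sum c0.
have -> : \sum_x \sum_z (al x z * pxz x z + be x z * pz z) =
  \sum_x \sum_z pxz x z +
  \sum_x \sum_z ((c * k x z) * pxz x z + (c * m x z) * pz z).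
  rewrite -!big_split/=; apply: eq_bigr => x _.
  rewrite -!big_split/=; apply: eq_bigr => z _.
  by rewrite /al /be; ring.
by rewrite sum_pxz lerD2l.
Qed.

Lemma condH_cont_ge0 : (0 <= H_cont)%E.
Proof. by rewrite H_contE; apply: L_int_ge0 => y; do 2 apply: sumr_ge0 => ? _. Qed.

Lemma condH_cont_fin : H_cont \is a fin_num.
Proof.
(* Any positive [s] would do: [tilted_up] bounds [s * H_cont] by a real number. *)
have h0 : (0 : R) <= 2^-1 by [].
have h := tilted_up h0 (lexx _).
rewrite ge0_fin_numE; last exact: condH_cont_ge0.
have : (2^-1%:E * H_cont < +oo)%E.
  apply: le_lt_trans (ltry _); apply: le_trans h.
  by rewrite leeDr// L_int_ge0// => y; exact: tilted_ge0.
have := condH_cont_ge0.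
by case: H_cont => [r _|_|//]; rewrite ?ltry// mulry gtr0_sg// mul1e.
Qed.

Lemma minfo_fin : minfo p a b g (@int_R R) \is a fin_num.
Proof. by rewrite /minfo fin_numB condH_cont_fin. Qed.

(** [1 - xi <= e^(- xi)] and [E e^(- xi) <= 1]. The constant 1 is added on both sides so that all
    integrands are nonnegative. *)
Lemma minfo_ge0 : (0 <= minfo p a b g (@int_R R))%E.
Proof.
rewrite /minfo suber_ge0 ?condH_cont_fin// -/H_cont -/H_disc.
have one : L_int (fun y => \sum_x \sum_z (1 * qxz x z y + 0 * qz z y)) = 1%E.
  rewrite (L_int_lin (al := fun _ _ => 1) (be := fun _ _ => 0))//.
  rewrite -[RHS](congr1 EFin sum_pxz); congr (_%:E).
  by apply: eq_bigr => x _; apply: eq_bigr => z _; rewrite mul0r addr0 mul1r.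
have mH : measurable_fun setT (fun y => \sum_x \sum_z entropy_term x z y).
  by apply: measurable_fun_bigsum => x; exact: measurable_fun_bigsum.
have H0 y : 0 <= \sum_x \sum_z entropy_term x z y by do 2 apply: sumr_ge0 => ? _.
have mone := m_lin (fun _ _ => 1) (fun _ _ => 0).
have one0 y := @lin_ge0 (fun _ _ => 1) (fun _ _ => 0) y (fun _ _ => ler01) (fun _ _ => lexx _).
suff : (H_cont + 1 <= H_disc%:E + 1)%E by rewrite leeD2rE.
rewrite H_contE -[X in (_ + X <= _)%E]one -L_intD//.
apply: (@le_trans _ _ (L_int (fun y => \sum_x \sum_z (lnp x z * qxz x z y + m x z * qz z y)))).
  apply: L_int_le => //.
  - exact: measurable_funD.
  - by move=> y; rewrite addr_ge0.
  - move=> y; rewrite -big_split/= ler_sum// => x _; rewrite -big_split/= ler_sum// => z _.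
    have [p0|p0] := eqVneq (pxz x z) 0.
      rewrite /entropy_term (qxz0 _ p0) !mul0r oppr0 !mulr0 !add0r.
      by rewrite mulr_ge0.
    have {}p0 : 0 < pxz x z by rewrite lt_neqAle eq_sym p0 pxz_ge0.
    have [e1 e2 e3] := info_split y p0.
    have := ler_wpM2l (qxz_ge0 x z y) (@expR_ge1Dx R (- info_density x z y)).
    rewrite e3 -e2; lra.
rewrite L_int_lin// lee_fin H_discE -[in leRHS]sum_pxz -big_split/= ler_sum// => x _.
rewrite -big_split/= ler_sum// => z _; rewrite lerD2l /m.
have [->|p0] := eqVneq (pz z) 0; first by rewrite mulr0.
by rewrite -mulrA mulVf// mulr1.
Qed.

Lemma tilted_plus s : 0 <= s -> s <= 2^-1 ->
  (L_int (tilted s) <= (1 + s * fine (minfo p a b g (@int_R R)) + 16 * s ^+ 2 * (#|A|%:R + 1))%:E)%E.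
Proof.
move=> s0 s1; have := tilted_up s0 s1; rewrite /minfo -/H_cont -/H_disc.
have := condH_cont_fin; case: H_cont => // r _; rewrite -EFinM -leeBrDr//.
by move=> /le_trans; apply; rewrite -EFinB lee_fin /=; lra.
Qed.

Lemma tilted_minus s : 0 <= s -> s <= 2^-1 ->
  (L_int (tilted (- s)) <= (1 - s * fine (minfo p a b g (@int_R R)) + 16 * s ^+ 2 * (#|A|%:R + 1))%:E)%E.
Proof.
move=> s0 s1; have := tilted_down s0 s1; rewrite /minfo -/H_cont -/H_disc.
have := condH_cont_fin; case: H_cont => // r _; rewrite -EFinM -leeBrDr//.
by move=> /le_trans; apply; rewrite -EFinD -EFinB lee_fin /=; lra.
Qed.

End tilted_information_density.

(** * Tensorization of the leakage *)

Section log_sum.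
Context {R : realType}.

(** With [rho] the ratio of the two sums, [ln u >= 1 - 1/u] is applied at [u = A j / (B j * rho)];
    the resulting linear terms sum to zero by the choice of [rho]. *)
Lemma log_sum_ineq (J : finType) (c A B : J -> R) : (forall j, 0 <= c j) ->
  (forall j, 0 < A j) -> (forall j, 0 < B j) ->
  0 < \sum_j c j * A j -> 0 < \sum_j c j * B j ->
  (\sum_j c j * A j) * ln ((\sum_j c j * A j) / (\sum_j c j * B j)) <=
  \sum_j c j * (A j * ln (A j / B j)).
Proof.
move=> c0 A0 B0; set SA := \sum_j c j * A j; set SB := \sum_j c j * B j => SA0 SB0.
pose rho := SA / SB; have rho0 : 0 < rho by rewrite divr_gt0.
rewrite -/rho -subr_ge0.
have -> : \sum_j c j * (A j * ln (A j / B j)) - SA * ln rho =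
    \sum_j c j * (A j * ln (A j / (B j * rho))).
  rewrite mulr_suml -sumrB; apply: eq_bigr => j _.
  have -> : ln (A j / B j) = ln (A j / (B j * rho)) + ln rho.
    have ABr : 0 < A j / (B j * rho) by rewrite divr_gt0// mulr_gt0.
    rewrite -lnM ?posrE//; congr (ln _).
    by field; rewrite !gt_eqF.
  by ring.
apply: (@le_trans _ _ (\sum_j c j * (A j - B j * rho))).
  have -> : \sum_j c j * (A j - B j * rho) = SA - SB * rho.
    by rewrite mulr_suml -sumrB; apply: eq_bigr => j _; ring.
  by rewrite /rho mulrC divfK ?subrr// gt_eqF.
apply: ler_sum => j _; rewrite ler_wpM2l//.
have := ln_ge_1Bexp (divr_gt0 (A0 j) (mulr_gt0 (B0 j) rho0)).
move=> /(ler_wpM2l (ltW (A0 j))); apply: le_trans.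
by rewrite invf_div mulrBr mulr1 [A j * (_ / _)]mulrC divfK// gt_eqF.
Qed.

End log_sum.

(** * Conditional expectation on finite products *)

Section conditioning.
Context {R : realType} {I : finType} {T : I -> finType}.
Variable p : forall i, T i -> R.
Hypothesis p1 : forall i, \sum_(x : T i) p x = 1.
Local Notation tuples := {dffun forall i, T i}.
Local Notation wt := (dweight p).
Implicit Types (w : tuples) (s : seq I).

Definition merge s w w' : tuples := [ffun j => if j \in s then w j else w' j].

(** The conditional expectation of [q] given the coordinates in [s]: the remaining ones are drawn
    afresh. *)
Definition condE (q : tuples -> R) s w := \sum_w' wt w' * q (merge s w w').

Definition agree s w w' : bool := all (fun j => w j == w' j) s.

Lemma merge_nil w w' : merge [::] w w' = w'.
Proof. by apply/ffunP => j; rewrite ffunE. Qed.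

Lemma mergeK s w w' : merge s (merge s w w') (merge s w' w) = w.
Proof. by apply/ffunP => j; rewrite !ffunE; case: (j \in s). Qed.

Lemma dweight_merge s w w' : wt (merge s w w') * wt (merge s w' w) = wt w * wt w'.
Proof.
rewrite -!big_split; apply: eq_bigr => j _ /=.
by rewrite !ffunE; case: (j \in s); rewrite // mulrC.
Qed.

Lemma agree_merge s w w' : agree s w (merge s w w').
Proof. by apply/allP => j js; rewrite ffunE js. Qed.

Lemma agree_mergeE s w w' u : agree s w u -> merge s w w' = merge s u w'.
Proof.
by move=> /allP ag; apply/ffunP => j; rewrite !ffunE; case: ifPn => // /ag/eqP.
Qed.

Lemma sum_merge s (H : tuples -> tuples -> R) :
  \sum_w \sum_w' wt w * wt w' * H w w' =
  \sum_w \sum_w' wt w * wt w' * H (merge s w w') (merge s w' w).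
Proof.
rewrite !pair_big/=.
pose sw (u : tuples * tuples) := (merge s u.1 u.2, merge s u.2 u.1).
have swK : involutive sw by case=> w w'; rewrite /sw/= !mergeK.
by rewrite (reindex_inj (inv_inj swK)); apply: eq_bigr => -[w w'] _ /=; rewrite dweight_merge.
Qed.

Lemma condE_agree q s w u : agree s w u -> condE q s w = condE q s u.
Proof. by move=> ag; apply: eq_bigr => w' _; rewrite (agree_mergeE _ ag). Qed.

(** The characteristic property of conditional expectation. It follows from swapping the coordinates
    outside [s] between [w] and its copy, which does not affect [h]. *)
Lemma condE_weighted q s (h : tuples -> R) : (forall w u, agree s w u -> h w = h u) ->
  \sum_w wt w * (condE q s w * h w) = \sum_w wt w * (q w * h w).
Proof.
move=> hs.
transitivity (\sum_w \sum_w' wt w * wt w' * (q (merge s w w') * h (merge s w w'))).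
  apply: eq_bigr => w _; rewrite mulrCA mulrA -mulrA mulr_suml; apply: eq_bigr => w' _.
  by rewrite -(hs _ _ (agree_merge s w w')); ring.
rewrite -(sum_merge s (fun w w' => q w * h w)); apply: eq_bigr => w _.
rewrite -[RHS]mul1r -(sum_dweight1 p1) mulr_suml; apply: eq_bigr => w' _.
by ring.
Qed.

Lemma condE_nil q w : condE q [::] w = \sum_w' wt w' * q w'.
Proof. by apply: eq_bigr => w' _; rewrite merge_nil. Qed.

Lemma sum_condE q s : \sum_w wt w * condE q s w = \sum_w wt w * q w.
Proof.
have := @condE_weighted q s (fun=> 1) (fun _ _ _ => erefl).
by under eq_bigr do rewrite mulr1; under [in RHS]eq_bigr do rewrite mulr1.
Qed.

(** [condE_weighted] for the indicator of the tuples agreeing with [w] on [s]. *)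
Lemma fiber_condE q s w : \sum_(u | agree s u w) wt u * q u =
  (\sum_(u | agree s u w) wt u) * condE q s w.
Proof.
have hs u v : agree s u v -> (agree s u w)%:R = (agree s v w)%:R :> R.
  move=> /allP uv; congr (_%:R); apply: (congr1 nat_of_bool).
  by apply: eq_in_all => j js; rewrite (eqP (uv j js)).
rewrite big_mkcond/= [X in X * _]big_mkcond/= mulr_suml.
have := condE_weighted q hs.
rewrite (eq_bigr (fun u => if agree s u w then wt u * condE q s w else 0)); last first.
  move=> u _; case: ifPn => [ag|_]; last by rewrite !mulr0.
  by rewrite mulr1 (condE_agree q ag).
rewrite [in RHS](eq_bigr (fun u => if agree s u w then wt u * q u else 0)); last first.
  by move=> u _; case: ifP; rewrite ?mulr1 ?mulr0.
move=> <-; apply: eq_bigr => u _; case: ifP => //; by rewrite mul0r.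
Qed.

Definition avg1 i (G : tuples -> R) w := \sum_(x : T i) p x * G (dupd w x).

Lemma sum_avg1 i (G h : tuples -> R) : (forall w (x : T i), h (dupd w x) = h w) ->
  \sum_w wt w * (h w * avg1 i G w) = \sum_w wt w * (h w * G w).
Proof.
move=> hi.
transitivity (\sum_w \sum_(x : T i) wt w * p x * (h w * G (dupd w x))).
  apply: eq_bigr => w _; rewrite mulrA mulr_sumr; apply: eq_bigr => x _; by ring.
transitivity (\sum_w \sum_(x : T i) wt w * p x * (h w * G w)); last first.
  by apply: eq_bigr => w _; rewrite -mulr_suml -mulr_sumr p1 mulr1.
rewrite (@resample R I T p i (fun w x => h w * G w)).
by apply: eq_bigr => w _; apply: eq_bigr => x _; rewrite hi.
Qed.

Lemma condE_avg1 i (G : tuples -> R) s w : i \notin s ->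
  condE (avg1 i G) (i :: s) w = condE G s w.
Proof.
move=> is_.
have E w' (x : T i) : dupd (merge (i :: s) w w') x = merge s w (dupd w' x).
  apply/ffunP => j; have [<-|ij] := eqVneq i j.
    by rewrite dupd_same ffunE (negbTE is_) dupd_same.
  by rewrite dupd_neq// !ffunE inE eq_sym (negbTE ij)/=; case: ifP => // _; rewrite eqtype.dfwith_out.
rewrite /condE.
transitivity (\sum_w' wt w' * (1 * avg1 i (fun w' => G (merge s w w')) w')).
  apply: eq_bigr => w' _; congr (_ * _); rewrite mul1r; apply: eq_bigr => x _.
  by rewrite E.
by rewrite sum_avg1//; apply: eq_bigr => w' _; rewrite mul1r.
Qed.

Lemma condE_cons_weighted q s i (h : tuples -> R) : i \notin s ->
  (forall w u, agree s w u -> h w = h u) ->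
  \sum_w wt w * (condE q (i :: s) w * h w) = \sum_w wt w * (condE q s w * h w).
Proof.
move=> is_ hs; rewrite !condE_weighted// => w u /= /andP[_]; exact: hs.
Qed.

End conditioning.

(** * Chain rule for the leakage at a fixed output *)

Section entropy_tensorization.
Context {R : realType} {I : finType} {W Lt : I -> finType}.
Variables (pw : forall i, W i -> R) (pl : forall i, Lt i -> R).
Hypothesis pw0 : forall i x, 0 < pw (i:=i) x.
Hypothesis pl0 : forall i x, 0 < pl (i:=i) x.
Hypothesis pw1 : forall i, \sum_(x : W i) pw x = 1.
Hypothesis pl1 : forall i, \sum_(x : Lt i) pl x = 1.
Local Notation msgs := {dffun forall i, W i}.
Local Notation keys := {dffun forall i, Lt i}.
Variable phi : msgs -> keys -> R.
Hypothesis phi0 : forall w l, 0 < phi w l.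

Definition marg w := \sum_l dweight pl l * phi w l.
(** The output density when the codewords of all users but [i] are revealed: only the dummy index of
    user [i] is averaged. [Gbar] averages the message of user [i] as well. *)
Definition Gi i w l := avg1 pl i (phi w) l.
Definition Gbar i w l := avg1 pw i (fun w => Gi i w l) w.

(** The Bregman divergence of [x ln x]. Compared with [x * ln (x / r)], the linear part makes it
    nonnegative pointwise, so integration over the output and averaging over codebooks commute. *)
Definition bregman (x r : R) := x * ln (x / r) - x + r.

Definition leak_term (r : forall i : I, msgs -> keys -> R) i :=
  \sum_w \sum_l dweight pw w * dweight pl l * bregman (Gi i w l) (r i w l).

Let pw0W i (x : W i) : 0 <= pw x. Proof. exact: ltW. Qed.
Let pl0W i (x : Lt i) : 0 <= pl x. Proof. exact: ltW. Qed.

Let dwm0 w : 0 <= dweight pw w. Proof. exact: dweight_ge0. Qed.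
Let dwl0 l : 0 <= dweight pl l. Proof. exact: dweight_ge0. Qed.

Let sum_gt0 (J : finType) (c F : J -> R) : (forall j, 0 <= c j) -> \sum_j c j = 1 ->
  (forall j, 0 < F j) -> 0 < \sum_j c j * F j.
Proof.
move=> c0 c1 F0; rewrite lt_neqAle eq_sym sumr_ge0 ?andbT; last first.
  by move=> j _; rewrite mulr_ge0// ltW.
apply/eqP => S0; have : \sum_j c j = 0.
  apply: big1 => j _; have cF0 k : true -> 0 <= c k * F k by rewrite mulr_ge0// ltW.
  have /eqP := psumr_eq0P cF0 S0 (isT : xpredT j).
  by rewrite mulf_eq0 (gt_eqF (F0 j)) orbF => /eqP.
by move/eqP; rewrite c1 oner_eq0.
Qed.

Lemma marg_gt0 w : 0 < marg w.
Proof. by apply: sum_gt0 => //; exact: sum_dweight1. Qed.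

Lemma Gi_gt0 i w l : 0 < Gi i w l.
Proof. exact: sum_gt0. Qed.

Lemma Gbar_gt0 i w l : 0 < Gbar i w l.
Proof. by apply: sum_gt0 => // x; exact: Gi_gt0. Qed.

Let condE_gt0 (q : msgs -> R) s w : (forall w, 0 < q w) -> 0 < condE pw q s w.
Proof. by move=> q0; apply: sum_gt0 => //; exact: sum_dweight1. Qed.

Let Gi_margin i w : \sum_l dweight pl l * Gi i w l = marg w.
Proof.
have := @sum_avg1 R I Lt pl pl1 i (phi w) (fun=> 1) (fun _ _ => erefl).
by under eq_bigr do rewrite mul1r; under [in RHS]eq_bigr do rewrite mul1r.
Qed.

Let wl_sum (F : msgs -> keys -> R) s w :
  condE pw (fun w => \sum_l dweight pl l * F w l) s w =
  \sum_(u : msgs * keys) dweight pw u.1 * dweight pl u.2 * F (merge s w u.1) u.2.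
Proof.
rewrite -(pair_big xpredT xpredT (fun w' l => dweight pw w' * dweight pl l * F (merge s w w') l))/=.
apply: eq_bigr => w' _; rewrite mulr_sumr; apply: eq_bigr => l _; by rewrite mulrA.
Qed.

(** One step of the chain rule. The conditional densities given [i :: s] and given [s] are averages
    of [Gi] and [Gbar] with the same weights, so the log-sum inequality moves the average outside
    the divergence. *)
Let step s i : i \notin s ->
  \sum_w dweight pw w * (condE pw marg (i :: s) w *
     ln (condE pw marg (i :: s) w / condE pw marg s w)) <=
  \sum_w \sum_l dweight pw w * dweight pl l * (Gi i w l * ln (Gi i w l / Gbar i w l)).
Proof.
move=> is_.
pose c (u : msgs * keys) := dweight pw u.1 * dweight pl u.2.
have E1 w : condE pw marg (i :: s) w = \sum_u c u * Gi i (merge (i :: s) w u.1) u.2.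
  by rewrite -wl_sum; apply: eq_bigr => w' _; rewrite Gi_margin.
have E2 w : condE pw marg s w = \sum_u c u * Gbar i (merge (i :: s) w u.1) u.2.
  (* Conditioning on [i :: s] after averaging over coordinate [i] is the same as conditioning on
     [s]. *)
  rewrite -wl_sum -(condE_avg1 pw1 marg w is_).
  apply: eq_bigr => w' _; congr (_ * _); rewrite /avg1.
  under [RHS]eq_bigr do rewrite mulr_sumr.
  rewrite exchange_big; apply: eq_bigr => x _ /=.
  rewrite -(Gi_margin i) mulr_sumr; apply: eq_bigr => l _; by rewrite mulrCA.
have c0 u : 0 <= c u by rewrite mulr_ge0.
apply: (@le_trans _ _ (\sum_w dweight pw w * (\sum_u c u *
   (Gi i (merge (i :: s) w u.1) u.2 *
    ln (Gi i (merge (i :: s) w u.1) u.2 / Gbar i (merge (i :: s) w u.1) u.2))))).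
  apply: ler_sum => w _; rewrite ler_wpM2l//.
  have := condE_gt0 (i :: s) w marg_gt0; have := condE_gt0 s w marg_gt0.
  rewrite E1 E2 => h2 h1; apply: log_sum_ineq => // u; [exact: Gi_gt0|exact: Gbar_gt0].
rewrite (eq_bigr (fun w => dweight pw w * condE pw (fun w => \sum_l dweight pl l *
   (Gi i w l * ln (Gi i w l / Gbar i w l))) (i :: s) w)); last first.
  move=> w _; congr (_ * _).
  by rewrite (wl_sum (fun w l => Gi i w l * ln (Gi i w l / Gbar i w l))).
rewrite sum_condE// le_eqVlt; apply/orP; left; apply/eqP; apply: eq_bigr => w _.
by rewrite mulr_sumr; apply: eq_bigr => l _; rewrite mulrA.
Qed.

Let chain s : uniq s ->
  \sum_w dweight pw w * (condE pw marg s w * ln (condE pw marg s w / condE pw marg [::] w)) <=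
  \sum_(i <- s) \sum_w \sum_l dweight pw w * dweight pl l * (Gi i w l * ln (Gi i w l / Gbar i w l)).
Proof.
elim: s => [_|i s IH /= /andP[is_ us]].
  rewrite big_nil big1// => w _.
  by rewrite divff ?ln1 ?mulr0// gt_eqF// condE_gt0//; exact: marg_gt0.
rewrite big_cons; apply: le_trans (lerD (step is_) (IH us)).
rewrite le_eqVlt; apply/orP; left; apply/eqP.
(* The logarithm for [s] depends only on the messages in [s], so its weight can be refined to
   [i :: s]; the two logarithms then telescope. *)
rewrite -(@condE_cons_weighted R I W pw pw1 marg s i
  (fun w => ln (condE pw marg s w / condE pw marg [::] w)) is_); last first.
  by move=> w u ag; rewrite (condE_agree pw marg ag) !condE_nil.
rewrite -big_split/=; apply: eq_bigr => w _; rewrite -mulrDr -mulrDr; congr (_ * (_ * _)).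
have g0 s' : 0 < condE pw marg s' w by apply: condE_gt0; exact: marg_gt0.
by rewrite -lnM ?posrE ?divr_gt0//; congr ln; field; rewrite !gt_eqF.
Qed.

(* Gbar i is the average of Gi i over the message of user i, hence the minimizer of the
   average Bregman divergence: any reference r free of that message only increases it. *)
Lemma entropy_le_leak (r : forall i : I, msgs -> keys -> R) s : uniq s ->
  (forall i w l, 0 < r i w l) -> (forall i w l (x : W i), r i (dupd w x) l = r i w l) ->
  \sum_w dweight pw w * (condE pw marg s w * ln (condE pw marg s w / condE pw marg [::] w)) <=
  \sum_(i <- s) leak_term r i.
Proof.
move=> us r0 ri; apply: (le_trans (chain us)); apply: ler_sum => i _.
rewrite -subr_ge0 /leak_term.
have -> : \sum_w \sum_l dweight pw w * dweight pl l * bregman (Gi i w l) (r i w l) -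
    \sum_w \sum_l dweight pw w * dweight pl l * (Gi i w l * ln (Gi i w l / Gbar i w l)) =
    \sum_l dweight pl l * (\sum_w dweight pw w * ((ln (Gbar i w l / r i w l) - 1) * Gi i w l)
       + \sum_w dweight pw w * r i w l).
  rewrite -sumrB.
  rewrite (eq_bigr (fun w => \sum_l dweight pl l * (dweight pw w * ((ln (Gbar i w l / r i w l) - 1) * Gi i w l)
       + dweight pw w * r i w l))); last first.
    move=> w _; rewrite -sumrB; apply: eq_bigr => l _; rewrite /bregman.
    have -> : ln (Gi i w l / r i w l) = ln (Gi i w l / Gbar i w l) + ln (Gbar i w l / r i w l).
      have g1 := Gi_gt0 i w l; have g2 := Gbar_gt0 i w l; have g3 := r0 i w l.
      by rewrite -lnM ?posrE ?divr_gt0//; congr ln; field; rewrite !gt_eqF.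
    by ring.
  by rewrite exchange_big/=; apply: eq_bigr => l _; rewrite -mulr_sumr big_split.
apply: sumr_ge0 => l _; rewrite mulr_ge0//.
rewrite -(@sum_avg1 R I W pw pw1 i (fun w => Gi i w l)
  (fun w => ln (Gbar i w l / r i w l) - 1)); last first.
  move=> w x; rewrite ri; congr (ln (_ / _) - _).
  by apply: eq_bigr => x' _; rewrite dupd_dupd.
rewrite -big_split/=; apply: sumr_ge0 => w _; rewrite -mulrDr mulr_ge0//.
rewrite -/(Gbar i w l).
have g2 := Gbar_gt0 i w l; have g3 := r0 i w l.
have := ln_ge_1Bexp (divr_gt0 g2 g3); rewrite invf_div => h.
have : Gbar i w l * (- (r i w l / Gbar i w l)) <= Gbar i w l * (ln (Gbar i w l / r i w l) - 1).
  by rewrite ler_wpM2l ?(ltW g2)//; lra.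
rewrite mulrN mulrC divfK ?gt_eqF// => h2; rewrite mulrC; lra.
Qed.

End entropy_tensorization.

Section bregman_facts.
Context {R : realType}.

Lemma bregman_ge0 (x r : R) : 0 < x -> 0 < r -> 0 <= bregman x r.
Proof.
move=> x0 r0; have := ln_ge_1Bexp (divr_gt0 x0 r0); rewrite invf_div.
move=> /(ler_wpM2l (ltW x0)); rewrite mulrBr mulr1 [x * (r / x)]mulrC divfK ?gt_eqF// /bregman.
lra.
Qed.

Lemma sum_unit (F : unit -> R) : \sum_z F z = F tt.
Proof. by rewrite (bigD1 tt)//= big1 ?addr0// => -[]. Qed.

Lemma esum_unit (F : unit -> \bar R) : (\sum_z F z = F tt)%E.
Proof. by rewrite (bigD1 tt)//= big1 ?adde0// => -[]. Qed.

Lemma sum_image (U A : finType) (a : U -> A) (c : U -> R) (T : A -> R) :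
  \sum_x (\sum_(u | a u == x) c u) * T x = \sum_u c u * T (a u).
Proof.
rewrite [RHS](partition_big a xpredT)//=; apply: eq_bigr => x _.
by rewrite mulr_suml; apply: eq_bigr => u /eqP ->.
Qed.

End bregman_facts.

Section code_secrecy.
Context {R : realType} {I : finType} {W Lt : I -> finType} {n : nat}.
Variables (pw : forall i, W i -> R) (pl : forall i, Lt i -> R).
Hypothesis pw0 : forall i x, 0 < pw (i:=i) x.
Hypothesis pl0 : forall i x, 0 < pl (i:=i) x.
Hypothesis pw1 : forall i, \sum_(x : W i) pw x = 1.
Hypothesis pl1 : forall i, \sum_(x : Lt i) pl x = 1.
Local Notation msgs := {dffun forall i, W i}.
Local Notation keys := {dffun forall i, Lt i}.
Variable phi : ('I_n -> R) -> msgs -> keys -> R.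
Hypothesis phi0 : forall y w l, 0 < phi y w l.
Hypothesis mphi : forall w l, rmeasurable (fun y => phi y w l).
Hypothesis phi1 : forall w l, Rn_int (fun y => phi y w l) = 1%E.
Variable r : forall i : I, ('I_n -> R) -> msgs -> keys -> R.
Hypothesis r0 : forall i y w l, 0 < r i y w l.
Hypothesis mr : forall i w l, rmeasurable (fun y => r i y w l).
Hypothesis rinv : forall i y w l (x : W i), r i y (dupd w x) l = r i y w l.

Definition leakage i : \bar R := Rn_int (fun y => leak_term pw pl (phi y) (fun i => r i y) i).

Let pw0W i (x : W i) : 0 <= pw x. Proof. exact: ltW. Qed.
Let pl0W i (x : Lt i) : 0 <= pl x. Proof. exact: ltW. Qed.

Lemma marg_measurable w : rmeasurable (fun y => marg pl (phi y) w).
Proof.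
by apply: measurable_fun_bigsum => l; apply: measurable_funM; [exact: measurable_cst|exact: mphi].
Qed.

Lemma Gi_measurable i w l : rmeasurable (fun y => Gi pl (phi y) i w l).
Proof.
by apply: measurable_fun_bigsum => x; apply: measurable_funM;
  [exact: measurable_cst|exact: mphi].
Qed.

Lemma bregman_measurable i w l :
  rmeasurable (fun y => bregman (Gi pl (phi y) i w l) (r i y w l)).
Proof.
have mG := Gi_measurable i w l.
apply: measurable_funD; last exact: mr.
apply: measurable_funB => //; apply: measurable_funM => //.
by apply: measurable_fun_ln; apply: measurable_fun_div => //; exact: mr.
Qed.

Lemma leak_term_measurable i :
  rmeasurable (fun y => leak_term pw pl (phi y) (fun i => r i y) i).
Proof.
apply: measurable_fun_bigsum => w; apply: measurable_fun_bigsum => l.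
by apply: measurable_funM; [exact: measurable_cst|exact: bregman_measurable].
Qed.

Lemma leak_term_ge0 i y : 0 <= leak_term pw pl (phi y) (fun i => r i y) i.
Proof.
do 2 apply: sumr_ge0 => ? _; rewrite mulr_ge0//.
  by rewrite mulr_ge0//; apply: dweight_ge0.
by rewrite bregman_ge0//; exact: Gi_gt0.
Qed.

Lemma marg_int w : Rn_int (fun y => marg pl (phi y) w) = 1%E.
Proof.
rewrite Rn_int_sum.
- rewrite -[RHS](congr1 EFin (sum_dweight1 pl1)) -sumEFin; apply: eq_bigr => l _.
  rewrite Rn_intZ ?phi1 ?mule1//; first exact: dweight_ge0.
  by move=> y; exact: ltW.
- by move=> l; apply: measurable_funM; [exact: measurable_cst|exact: mphi].
- by move=> l y; apply: mulr_ge0; [exact: dweight_ge0|exact: ltW].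
Qed.

(** The hypothesis on [a] says that it reveals exactly the messages of the users in [s]: all users
    for the eavesdropper, all but one for a receiver. Both entropies become integrals over the same
    output, where [entropy_le_leak] applies pointwise. *)
Theorem entropy_loss_le_leakage (A : finType) (a : msgs -> A) s : uniq s ->
  (forall w u, (a w == a u) = agree s w u) ->
  ((condH_disc (dweight pw) a (fun _ => tt))%:E <=
   condH_cont (dweight pw) a (fun _ => tt) (fun w y => marg pl (phi y) w) (@int_Rn R n)
   + \sum_(i <- s) leakage i)%E.
Proof.
move=> us ag.
pose px x := \sum_(u | a u == x) dweight pw u.
pose qx y x := \sum_(u | a u == x) dweight pw u * marg pl (phi y) u.
pose qb y := \sum_u dweight pw u * marg pl (phi y) u.
have w0 u : 0 <= dweight pw u by exact: dweight_ge0.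
have m0 y u : 0 <= marg pl (phi y) u by rewrite ltW// marg_gt0.
have mq x : rmeasurable (fun y => qx y x).
  apply: measurable_fun_bigsum => u; apply: measurable_funM; first exact: measurable_cst.
  exact: marg_measurable.
have mqb : rmeasurable qb.
  apply: measurable_fun_bigsum => u; apply: measurable_funM; first exact: measurable_cst.
  exact: marg_measurable.
have qx0 y x : 0 <= qx y x by apply: sumr_ge0 => u _; rewrite mulr_ge0.
have px1 x : px x <= 1.
  rewrite -(sum_dweight1 pw1) [leRHS](bigID (fun u => a u == x))/= lerDl sumr_ge0//.
have lnp x : 0 <= - ln (px x) by rewrite oppr_ge0 ln_le0.
pose et x y := - (qx y x * ln (qx y x / qb y)).
have et0 x y : 0 <= et x y.
  have qle : qx y x <= qb y.
    by rewrite /qb [leRHS](bigID (fun u => a u == x))/= lerDl sumr_ge0// => u _; rewrite mulr_ge0.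
  rewrite /et; have [->|q0] := eqVneq (qx y x) 0; first by rewrite mul0r oppr0.
  have q1 : 0 < qx y x by rewrite lt_neqAle eq_sym q0 qx0.
  have q2 : 0 < qb y by exact: lt_le_trans qle.
  by rewrite -mulrN mulr_ge0// oppr_ge0 ln_le0// ler_pdivrMr// mul1r.
have met x : rmeasurable (et x).
  apply: measurable_fun_opp; apply: measurable_funM; first exact: mq.
  by apply: measurable_fun_ln; apply: measurable_fun_div; [exact: mq|exact: mqb].
have -> : condH_cont (dweight pw) a (fun _ => tt) (fun w y => marg pl (phi y) w) (@int_Rn R n) =
    Rn_int (fun y => \sum_x et x y).
  rewrite Rn_int_sum//; apply: eq_bigr => x _; rewrite esum_unit.
  apply: eq_Rn_int => y /=; rewrite /et /qx /qb.
  by under eq_bigl do rewrite andbT.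
(* The discrete entropy does not involve the output; it is spread over it with the densities [marg],
   each of mass 1. *)
have -> : (condH_disc (dweight pw) a (fun _ => tt))%:E =
    Rn_int (fun y => \sum_x (- ln (px x)) * qx y x).
  rewrite Rn_int_sum; last 2 first.
  - by move=> x; apply: measurable_funM; [exact: measurable_cst|exact: mq].
  - by move=> x y; rewrite mulr_ge0.
  rewrite -sumEFin; apply: eq_bigr => x _; rewrite sum_unit Rn_intZ// Rn_int_sum; last 2 first.
  - by move=> u; apply: measurable_funM; [exact: measurable_cst|exact: marg_measurable].
  - by move=> u y; rewrite mulr_ge0.
  rewrite (eq_bigr (fun u => (dweight pw u)%:E)); last first.
    by move=> u _; rewrite Rn_intZ ?marg_int ?mule1//; exact: marg_measurable.
  rewrite sumEFin -EFinM -/(px x) /=.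
  rewrite (eq_bigl (fun u => a u == x)) => [|u]; last by rewrite andbT.
  by rewrite -/(px x) (sum_dweight1 pw1) divr1 mulNr mulrC.
have sleak : (\sum_(i <- s) leakage i)%E =
    Rn_int (fun y => \sum_(i <- s) leak_term pw pl (phi y) (fun i => r i y) i).
  rewrite Rn_int_sum//; [exact: leak_term_measurable|exact: leak_term_ge0].
rewrite sleak -Rn_intD//; last 4 first.
- exact: measurable_fun_bigsum.
- by apply: measurable_fun_bigsum => i; exact: leak_term_measurable.
- by move=> y; apply: sumr_ge0.
- by move=> y; apply: sumr_ge0 => i _; exact: leak_term_ge0.
apply: Rn_int_le.
- by apply: measurable_fun_bigsum => x; apply: measurable_funM; [exact: measurable_cst|exact: mq].
- apply: measurable_funD; first exact: measurable_fun_bigsum.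
  by apply: measurable_fun_bigsum => i; exact: leak_term_measurable.
- by move=> y; apply: sumr_ge0 => x _; rewrite mulr_ge0.
move=> y.
have := @entropy_le_leak R I W Lt pw pl pw0 pl0 pw1 pl1 (phi y) (phi0 y) (fun i => r i y) s us
  (fun i => r0 i y) (fun i => @rinv i y).
rewrite -lerBlDl; apply: le_trans.
set q := marg pl (phi y).
pose h w := ln (condE pw q s w / condE pw q [::] w).
have hE w u : agree s w u -> h w = h u.
  by move=> wu; rewrite /h (condE_agree pw q wu) !condE_nil.
rewrite (condE_weighted pw1 q hE) le_eqVlt; apply/orP; left; apply/eqP.
rewrite -sumrB.
transitivity (\sum_x qx y x * (ln (qx y x / qb y) - ln (px x))).
  by apply: eq_bigr => x _; rewrite /et; ring.
rewrite (sum_image a (fun u => dweight pw u * q u) (fun x => ln (qx y x / qb y) - ln (px x))).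
apply: eq_bigr => w _; rewrite -mulrA; congr (_ * (_ * _)).
have wt_gt0 : 0 < dweight pw w by apply: prodr_gt0.
have pa : 0 < px (a w).
  by rewrite /px (bigD1 w)//= ltr_pwDl// sumr_ge0.
have qaE : qx y (a w) = px (a w) * condE pw q s w.
  rewrite /px /qx (eq_bigl (fun u => agree s u w)); last by move=> u; rewrite ag.
  rewrite [in RHS](eq_bigl (fun u => agree s u w)); last by move=> u; rewrite ag.
  exact: fiber_condE.
have q0 u : 0 < q u by exact: marg_gt0.
have cE0 s' : 0 < condE pw q s' w.
  rewrite /condE (bigD1 w)//= ltr_pwDl//; first by rewrite mulr_gt0.
  by apply: sumr_ge0 => u _; rewrite mulr_ge0// ltW.
have -> : qb y = condE pw q [::] w by rewrite condE_nil.
rewrite qaE /h -mulrA lnM ?posrE ?divr_gt0//; ring.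
Qed.

End code_secrecy.

(** * Random coding *)

Section log_bounds.
Context {R : realType}.

Lemma ln_le_sub1 (x : R) : 0 < x -> ln x <= x - 1.
Proof. by move=> x0; have := @expR_ge1Dx R (ln x); rewrite lnK ?posrE//; lra. Qed.

Lemma ln1D_tangent (a b : R) : 0 < a -> 0 <= b -> ln (a + b) <= ln (1 + a) + (b - 1) / (1 + a).
Proof.
move=> a0 b0; have a1 : 0 < 1 + a by lra.
have ab : 0 < a + b by lra.
have := ln_le_sub1 (divr_gt0 ab a1); rewrite ln_div ?posrE//.
have -> : (a + b) / (1 + a) - 1 = (b - 1) / (1 + a) by field; rewrite gt_eqF.
lra.
Qed.

(** For [a <= 1] the chain is [ln (1 + a) <= a <= a^s]. For [a > 1], [ln (1 + a) <= ln a + 1] and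
    [e^t >= 1 + t] at [t = s * ln a]. *)
Lemma ln1D_le_pow (a s : R) : 0 < a -> 0 < s -> s <= 1 -> ln (1 + a) <= s^-1 * expR (s * ln a).
Proof.
move=> a0 s0 s1; have si : 1 <= s^-1 by rewrite invf_ge1.
have [a1|a1] := leP a 1.
  have la : ln a <= 0 by rewrite ln_le0.
  have h1 : a <= expR (s * ln a).
    rewrite -[leLHS](@lnK R) ?posrE// ler_expR -[leLHS]mul1r.
    by rewrite ler_wnM2r.
  have h2 : expR (s * ln a) <= s^-1 * expR (s * ln a).
    by rewrite ler_peMl// expR_ge0.
  have := ln_le_sub1 (_ : 0 < 1 + a); rewrite ltr_pwDl//; last exact: ltW.
  move=> /(_ isT); lra.
have h1 : ln (1 + a) <= ln a + a^-1.
  have := ln_le_sub1 (_ : 0 < 1 + a^-1).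
  rewrite addr_gt0 ?invr_gt0// => /(_ isT).
  have -> : 1 + a = a * (1 + a^-1) by field; rewrite gt_eqF.
  rewrite lnM ?posrE ?addr_gt0 ?invr_gt0//; lra.
have h2 : a^-1 <= 1 by rewrite invf_le1// ltW.
have h3 := @expR_ge1Dx R (s * ln a).
have h4 : s^-1 * (1 + s * ln a) <= s^-1 * expR (s * ln a).
  by rewrite ler_wpM2l// invr_ge0 ltW.
have h5 : s^-1 * (1 + s * ln a) = s^-1 + ln a by field; rewrite gt_eqF.
lra.
Qed.

Lemma expR_sum (J : finType) (F : J -> R) : expR (\sum_j F j) = \prod_j expR (F j).
Proof. exact: (big_morph expR (@expRD R) (@expR0 R)). Qed.

Lemma ln_prod (J : finType) (F : J -> R) : (forall j, 0 < F j) ->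
  ln (\prod_j F j) = \sum_j ln (F j).
Proof.
move=> F0; apply: (@expR_inj R); rewrite lnK ?posrE ?prodr_gt0// expR_sum.
by apply: eq_bigr => j _; rewrite lnK// posrE.
Qed.

End log_bounds.

Section random_coding.
Context {R : realType} {I : finType} {V W Lt : I -> finType} {n : nat}.
Variable p : forall i, V i -> R.
Hypothesis p0 : forall i x, 0 <= p (i:=i) x.
Hypothesis p1 : forall i, \sum_(x : V i) p x = 1.
Hypothesis W0 : forall i, (0 < #|W i|)%N.
Hypothesis Lt0 : forall i, (0 < #|Lt i|)%N.
Local Notation letters := {dffun forall i, V i}.
Local Notation msgs := {dffun forall i, W i}.
Local Notation keys := {dffun forall i, Lt i}.
Local Notation codebooks := (codebook V (fun i => (W i * Lt i)%type) n).
Local Notation Q := (@codebook_weight R I V (fun i => (W i * Lt i)%type) n p).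
Local Notation P := (@words_weight R I V n p).
Variable f : 'I_n -> letters -> R -> R.
Hypothesis f0 : forall t u y, 0 < f t u y.
Implicit Types (C : codebooks) (y : 'I_n -> R) (v : words V n) (w : msgs) (l : keys).

Definition uW i (_ : W i) : R := #|W i|%:R^-1.
Definition uL i (_ : Lt i) : R := #|Lt i|%:R^-1.

Lemma uW_gt0 i (x : W i) : 0 < uW x.
Proof. by rewrite invr_gt0 ltr0n. Qed.
Lemma uL_gt0 i (x : Lt i) : 0 < uL x.
Proof. by rewrite invr_gt0 ltr0n. Qed.
Lemma uW_sum1 i : \sum_(x : W i) uW x = 1.
Proof. by rewrite sumr_const -[_ *+ _]mulr_natr mulVf// pnatr_eq0 -lt0n. Qed.
Lemma uL_sum1 i : \sum_(x : Lt i) uL x = 1.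
Proof. by rewrite sumr_const -[_ *+ _]mulr_natr mulVf// pnatr_eq0 -lt0n. Qed.

Definition word_density v y := \prod_t f t (v t) (y t).
(** The density [p(y | v_{-i})]: the letter of user [i] is averaged under its design law. This is
    the reference to which soft covering compares the bin of user [i], and it is free of that user's
    message. *)
Definition letter_ref i t (u : letters) (z : R) := \sum_(x : V i) p x * f t (dupd u x) z.
Definition word_ref i v y := \prod_t letter_ref i t (v t) (y t).
Definition key w l : forall i, (W i * Lt i)%type := fun i => (w i, l i).
Definition code_density C y w l := word_density (cwords C (key w l)) y.
Definition code_ref C i y w l := word_ref i (cwords C (key w l)) y.

(** Single-letter integrand of [E e^(s xi)], for [xi] the information density of user [i] given the
    other users. *)
Definition resolvability_letter i t s z :=
  \sum_u dweight p u * (f t u z * expR (s * ln (f t u z / letter_ref i t u z))).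

Let Q0 C : 0 <= Q C.
Proof. by do 3 apply: prodr_ge0 => ? _. Qed.
Let P0 v : 0 <= P v.
Proof. by apply: prodr_ge0 => ? _; exact: dweight_ge0. Qed.

Lemma letter_ref_gt0 i t u z : 0 < letter_ref i t u z.
Proof.
rewrite lt_neqAle eq_sym sumr_ge0 ?andbT; last first.
  by move=> x _; rewrite mulr_ge0// ltW.
apply/eqP => S0; have : \sum_(x : V i) p x = 0.
  apply: big1 => x _; have pf0 (k : V i) : true -> 0 <= p k * f t (dupd u k) z.
    by move=> _; rewrite mulr_ge0// ltW.
  have /eqP := psumr_eq0P pf0 S0 (isT : xpredT x).
  by rewrite mulf_eq0 (gt_eqF (f0 _ _ _)) orbF => /eqP.
by move/eqP; rewrite p1 oner_eq0.
Qed.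

Lemma word_density_gt0 v y : 0 < word_density v y.
Proof. exact: prodr_gt0. Qed.

Lemma word_ref_gt0 i v y : 0 < word_ref i v y.
Proof. by apply: prodr_gt0 => t _; exact: letter_ref_gt0. Qed.

Lemma word_refE i v y :
  \sum_(u : word V n i) word_weight p u * word_density (set_coord v u) y = word_ref i v y.
Proof.
rewrite /word_ref /letter_ref -(sum_word_weight_prod p (fun t (x : V i) => f t (dupd (v t) x) (y t))).
apply: eq_bigr => u _; congr (_ * _); apply: eq_bigr => t _.
by rewrite ffunE.
Qed.

Lemma set_coord_cwords C (k k' : forall i, (W i * Lt i)%type) i (u : word V n i) :
  (forall j, i != j -> k j = k' j) -> set_coord (cwords C k) u = set_coord (cwords C k') u.
Proof.
move=> kk; apply/ffunP => t; rewrite !ffunE; apply/ffunP => j; rewrite !ffunE.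
have [<-|ij] := eqVneq i j; first by rewrite !eqtype.dfwith_in.
by rewrite !eqtype.dfwith_out// !ffunE kk.
Qed.

Lemma set_coord_own C (k : forall i, (W i * Lt i)%type) i :
  set_coord (cwords C k) (C i (k i)) = cwords C k.
Proof.
apply/ffunP => t; rewrite !ffunE; apply/ffunP => j; rewrite !ffunE.
have [<-|ij] := eqVneq i j; first by rewrite !eqtype.dfwith_in.
by rewrite !eqtype.dfwith_out// !ffunE.
Qed.

Lemma cwords_set_codeword C i (k : (W i * Lt i)%type) u (k' : forall i, (W i * Lt i)%type) :
  k' i != k -> cwords (set_codeword C k u) k' = cwords C k'.
Proof.
move=> kk; apply/ffunP => t; apply/ffunP => j; rewrite !ffunE.
have [<-|ij] := eqVneq i j; last by rewrite eqtype.dfwith_out.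
by rewrite eqtype.dfwith_in ffunE (negbTE kk).
Qed.

Lemma set_coord_set_codeword C i (k : (W i * Lt i)%type) (u u' : word V n i) (k' : forall i, (W i * Lt i)%type) :
  set_coord (cwords (set_codeword C k u) k') u' = set_coord (cwords C k') u'.
Proof.
apply/ffunP => t; rewrite !ffunE; apply/ffunP => j; rewrite !ffunE.
have [<-|ij] := eqVneq i j; first by rewrite !eqtype.dfwith_in.
by rewrite !eqtype.dfwith_out// !ffunE eqtype.dfwith_out.
Qed.

Lemma eq_word_ref i v v' y : (forall u : word V n i, set_coord v u = set_coord v' u) ->
  word_ref i v y = word_ref i v' y.
Proof. by move=> vv; rewrite -!word_refE; apply: eq_bigr => u _; rewrite vv. Qed.

Lemma code_ref_dupdW C i y w l (x : W i) : code_ref C i y (dupd w x) l = code_ref C i y w l.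
Proof.
apply: eq_word_ref => u; apply: set_coord_cwords => j ij.
by rewrite /key dupd_neq.
Qed.

Lemma code_ref_dupdL C i y w l (x : Lt i) : code_ref C i y w (dupd l x) = code_ref C i y w l.
Proof.
apply: eq_word_ref => u; apply: set_coord_cwords => j ij.
by rewrite /key dupd_neq.
Qed.

Let lc i : R := #|Lt i|%:R^-1.
Let lc_gt0 i : 0 < lc i. Proof. by rewrite invr_gt0 ltr0n. Qed.

(* Soft covering: condition on the codeword in use and bound ln by its tangent line at
   1 + lc i * word_density / word_ref.  The other codewords of the bin are independent
   of it, so that the linear term has nonpositive mean. *)
Lemma expected_bregman i y w l :
  \sum_C Q C * bregman (Gi uL (code_density C y) i w l) (code_ref C i y w l) <=
  \sum_v P v * (word_density v y * ln (1 + lc i * word_density v y / word_ref i v y)).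
Proof.
pose X C (m : Lt i) := code_density C y w (dupd l m).
pose r C := code_ref C i y w l.
pose a C (m : Lt i) := lc i * X C m / r C.
pose psi C (m : Lt i) := X C m / (1 + a C m).
have X0 C m : 0 < X C m by exact: word_density_gt0.
have r0 C : 0 < r C by exact: word_ref_gt0.
have a0 C m : 0 < a C m by rewrite divr_gt0 ?mulr_gt0.
have a1 C m : 0 < 1 + a C m by rewrite addr_gt0.
have psi0 C m : 0 <= psi C m by rewrite divr_ge0// ltW.
have GE C : Gi uL (code_density C y) i w l = \sum_(m : Lt i) lc i * X C m by [].
have EX (m : Lt i) : \sum_C Q C * X C m = \sum_C Q C * r C.
  pose H C (u : word V n i) := word_density (set_coord (cwords C (key w (dupd l m))) u) y.
  rewrite (eq_bigr (fun C => Q C * H C (C i (w i, m)))); last first.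
    move=> C _; congr (_ * _); rewrite /H /X /code_density.
    have -> : (w i, m) = key w (dupd l m) i by rewrite /key dupd_same.
    by rewrite set_coord_own.
  rewrite (codeword_resample p1); last first.
    by move=> C u u'; rewrite /H set_coord_set_codeword.
  apply: eq_bigr => C _; congr (_ * _).
  by rewrite word_refE -/(code_ref C i y w (dupd l m)) code_ref_dupdL.
have EpsiX (m m' : Lt i) : m' != m ->
    \sum_C Q C * (psi C m * (X C m' / r C)) = \sum_C Q C * psi C m.
  move=> mm'.
  pose kk := key w (dupd l m).
  pose psi' C := word_density (cwords C kk) y /
    (1 + lc i * word_density (cwords C kk) y / word_ref i (cwords C kk) y).
  have psiE C : psi C m = psi' C.
    by rewrite /psi /psi' /a /r -(code_ref_dupdL C y w l m).
  (* [psi'] reads only the codeword with index [m] and the other users, so the codeword with index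
     [m'] can be redrawn; its mean density is the reference, which cancels the denominator. *)
  pose H C (u : word V n i) := psi' C * (word_density (set_coord (cwords C kk) u) y / word_ref i (cwords C kk) y).
  rewrite (eq_bigr (fun C => Q C * H C (C i (w i, m')))); last first.
    move=> C _; rewrite psiE /H; congr (_ * (_ * (_ / _))); last first.
      by rewrite /r -(code_ref_dupdL C y w l m).
    rewrite (@set_coord_cwords C kk (key w (dupd l m')) i); last first.
      by move=> j ij; rewrite /kk /key !dupd_neq.
    have -> : (w i, m') = key w (dupd l m') i by rewrite /key dupd_same.
    by rewrite set_coord_own.
  rewrite (codeword_resample p1); last first.
    have kkne : kk i != (w i, m').
      by rewrite /kk /key dupd_same xpair_eqE eqxx/= eq_sym.
    by move=> C u u'; rewrite /H /psi' set_coord_set_codeword cwords_set_codeword.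
  apply: eq_bigr => C _; rewrite psiE; congr (_ * _).
  rewrite /H; under eq_bigr do rewrite mulrCA mulrA.
  rewrite (eq_bigr (fun u => psi' C / word_ref i (cwords C kk) y *
     (word_weight p u * word_density (set_coord (cwords C kk) u) y))); last first.
    by move=> u _; ring.
  by rewrite -mulr_sumr word_refE divfK// gt_eqF// word_ref_gt0.
have point C : bregman (Gi uL (code_density C y) i w l) (r C) <=
    \sum_(m : Lt i) lc i * (X C m * ln (1 + a C m)) +
    \sum_(m : Lt i) lc i * (\sum_(m' | m' != m) lc i * (psi C m * (X C m' / r C)) - psi C m) -
    \sum_(m : Lt i) lc i * X C m + r C.
  rewrite /bregman GE lerD2r lerB// mulr_suml -big_split/= ler_sum// => m _.
  rewrite -mulrA -mulrDr; apply: ler_wpM2l; first exact: ltW.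
  (* The codeword in use contributes [a C m]; the remaining sum is the variable [b] of
     [ln1D_tangent]. *)
  have -> : (\sum_(m : Lt i) lc i * X C m) / r C =
      a C m + \sum_(m' | m' != m) lc i * X C m' / r C.
    by rewrite (bigD1 m)//= mulrDl mulr_suml.
  have B0 : 0 <= \sum_(m' | m' != m) lc i * X C m' / r C.
    by apply: sumr_ge0 => m' _; rewrite divr_ge0 ?mulr_ge0// ltW.
  have := ler_wpM2l (ltW (X0 C m)) (ln1D_tangent (a0 C m) B0).
  move=> /le_trans; apply; rewrite mulrDr lerD2l mulrCA mulrC -/(psi C m) mulrBr mulr1.
  rewrite lerD2r [psi C m * _]mulrC mulr_suml ler_sum// => m' _.
  by rewrite le_eqVlt; apply/orP; left; apply/eqP; ring.
apply: (@le_trans _ _ (\sum_C Q C * (\sum_(m : Lt i) lc i * (X C m * ln (1 + a C m)) +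
    \sum_(m : Lt i) lc i * (\sum_(m' | m' != m) lc i * (psi C m * (X C m' / r C)) - psi C m) -
    \sum_(m : Lt i) lc i * X C m + r C))).
  by apply: ler_sum => C _; rewrite ler_wpM2l.
have sumlc : \sum_(m : Lt i) lc i = 1 by exact: uL_sum1.
have E1 : \sum_C Q C * \sum_(m : Lt i) lc i * (X C m * ln (1 + a C m)) =
    \sum_v P v * (word_density v y * ln (1 + lc i * word_density v y / word_ref i v y)).
  rewrite -[RHS]mul1r -[X in _ = X * _]sumlc mulr_suml.
  under eq_bigr do rewrite mulr_sumr.
  rewrite exchange_big/=; apply: eq_bigr => m _.
  pose H v := word_density v y * ln (1 + lc i * word_density v y / word_ref i v y).
  rewrite -[X in _ = _ * X](@cwords_marginal R I V _ n p p1 (key w (dupd l m)) H).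
  rewrite mulr_sumr; apply: eq_bigr => C _; rewrite mulrCA; congr (_ * (_ * (_ * ln (1 + _ / _)))).
  by rewrite /r -(code_ref_dupdL C y w l m).
have E2 : \sum_C Q C * \sum_(m : Lt i) lc i *
    (\sum_(m' | m' != m) lc i * (psi C m * (X C m' / r C)) - psi C m) <= 0.
  under eq_bigr do rewrite mulr_sumr.
  rewrite exchange_big/=; apply: sumr_le0 => m _.
  have -> : \sum_C Q C * (lc i * (\sum_(m' | m' != m) lc i * (psi C m * (X C m' / r C)) - psi C m)) =
    lc i * (\sum_(m' | m' != m) lc i * (\sum_C Q C * (psi C m * (X C m' / r C))) - \sum_C Q C * psi C m).
    rewrite (eq_bigr (fun C => lc i * (\sum_(m' | m' != m) lc i * (Q C * (psi C m * (X C m' / r C))) - Q C * psi C m))).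
      rewrite -[LHS]mulr_sumr [in LHS]sumrB [in LHS]exchange_big/=; congr (_ * (_ - _)).
      by apply: eq_bigr => m' _; rewrite mulr_sumr.
    move=> C _; rewrite mulrCA mulrBr mulr_sumr; congr (_ * (_ - _)).
    by apply: eq_bigr => m' _; rewrite mulrCA.
  apply: mulr_ge0_le0; [exact: ltW|rewrite subr_le0].
  (* The other codewords of the bin have total weight [1 - lc i], against the 1 that is
     subtracted. *)
  rewrite (eq_bigr (fun m' => lc i * (\sum_C Q C * psi C m))); last by move=> m' /EpsiX ->.
  rewrite -mulr_suml ler_piMl//; first by apply: sumr_ge0 => C _; rewrite mulr_ge0.
  by rewrite -sumlc [leRHS](bigD1 m)//= lerDr ltW.
have E3 : \sum_C Q C * \sum_(m : Lt i) lc i * X C m = \sum_C Q C * r C.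
  under eq_bigr do rewrite mulr_sumr.
  rewrite exchange_big/= -[RHS]mul1r -sumlc mulr_suml; apply: eq_bigr => m _.
  by rewrite -(EX m) mulr_sumr; apply: eq_bigr => C _; rewrite mulrCA.
rewrite (eq_bigr (fun C => Q C * (\sum_(m : Lt i) lc i * (X C m * ln (1 + a C m))) +
  Q C * (\sum_(m : Lt i) lc i * (\sum_(m' | m' != m) lc i * (psi C m * (X C m' / r C)) - psi C m)) +
  (Q C * r C - Q C * (\sum_(m : Lt i) lc i * X C m)))); last by move=> C _; ring.
rewrite !big_split/= sumrN E1 E3 subrr addr0 gerDl; exact: E2.
Qed.

(** Once the logarithm is replaced by a power, the bound is multiplicative over channel uses, and
    the mean over i.i.d. letters factors. *)
Lemma expected_leak_term i y s : 0 < s -> s <= 1 ->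
  \sum_C Q C * leak_term uW uL (code_density C y) (fun i => code_ref C i y) i <=
  s^-1 * expR (s * ln (lc i)) * \prod_t resolvability_letter i t s (y t).
Proof.
move=> s0 s1.
pose B := s^-1 * expR (s * ln (lc i)) * \prod_t resolvability_letter i t s (y t).
have HB w l : \sum_C Q C * bregman (Gi uL (code_density C y) i w l) (code_ref C i y w l) <= B.
  apply: (le_trans (expected_bregman i y w l)).
  rewrite /B -(sum_words_weight_prod p
    (fun t u => f t u (y t) * expR (s * ln (f t u (y t) / letter_ref i t u (y t))))) mulr_sumr.
  apply: ler_sum => v _; rewrite [leRHS]mulrCA ler_wpM2l//.
  have d0 := word_density_gt0 v y; have r0 := word_ref_gt0 i v y.
  have la : 0 < lc i * word_density v y / word_ref i v y by rewrite divr_gt0// mulr_gt0.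
  apply: (le_trans (ler_wpM2l (ltW d0) (ln1D_le_pow la s0 s1))).
  rewrite big_split/= -/(word_density v y) -expR_sum -mulr_sumr -ln_prod; last first.
    by move=> t; rewrite divr_gt0// letter_ref_gt0.
  rewrite prodf_div -/(word_density v y) -/(word_ref i v y).
  rewrite -mulrA lnM ?posrE ?divr_gt0// mulrDr expRD.
  by rewrite le_eqVlt; apply/orP; left; apply/eqP; ring.
rewrite /leak_term.
have -> : \sum_C Q C * (\sum_w \sum_l dweight uW w * dweight uL l *
     bregman (Gi uL (code_density C y) i w l) (code_ref C i y w l)) =
   \sum_w \sum_l dweight uW w * dweight uL l *
     \sum_C Q C * bregman (Gi uL (code_density C y) i w l) (code_ref C i y w l).
  under eq_bigr do rewrite mulr_sumr.
  rewrite exchange_big/=; apply: eq_bigr => w _.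
  under eq_bigr do rewrite mulr_sumr.
  rewrite exchange_big/=; apply: eq_bigr => l _.
  by rewrite mulr_sumr; apply: eq_bigr => C _; rewrite mulrCA.
have dW w : 0 <= dweight uW w by apply: dweight_ge0 => j x; rewrite ltW// uW_gt0.
have dL l : 0 <= dweight uL l by apply: dweight_ge0 => j x; rewrite ltW// uL_gt0.
apply: (@le_trans _ _ (\sum_w \sum_l dweight uW w * dweight uL l * B)).
  by apply: ler_sum => w _; apply: ler_sum => l _; rewrite ler_wpM2l// mulr_ge0.
rewrite (eq_bigr (fun w => dweight uW w * B)); last first.
  by move=> w _; rewrite -mulr_suml -mulr_sumr (sum_dweight1 uL_sum1) mulr1.
by rewrite -mulr_suml (sum_dweight1 uW_sum1) mul1r.
Qed.

Variable j : I.
Variable xi : 'I_n -> V j -> R -> R.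
Hypothesis xi1 : forall t z, \sum_(x : V j) p x * expR (xi t x z) <= 1.
Variables (gam s : R).
Hypothesis s_ge0 : 0 <= s.

Definition score (u : word V n j) y := \sum_t xi t (u t) (y t).

(** Some codeword above the threshold is taken, without asking for uniqueness, and its dummy index
    is discarded; [d0] is returned when there is none. *)
Definition threshold_decode (d0 : W j) C y : W j :=
  odflt d0 [pick x : W j | [exists m : Lt j, gam < score (C j (x, m)) y]].

(** An error requires that the sent codeword miss the threshold or that one with another message
    exceed it. Each indicator is replaced by an exponential: tilt [s] for the miss, tilt 1 for the
    false alarm. *)
Lemma decode_error (d0 : W j) C y w l : (threshold_decode d0 C y != w j)%:R <=
  expR (s * (gam - score (C j (w j, l j)) y)) +
  \sum_(k : W j * Lt j | k != (w j, l j)) expR (score (C j k) y - gam).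
Proof.
have S0 : 0 <= \sum_(k : W j * Lt j | k != (w j, l j)) expR (score (C j k) y - gam).
  by apply: sumr_ge0 => k _; exact: expR_ge0.
have [le_gam|gt_gam] := leP (score (C j (w j, l j)) y) gam.
  apply: (@le_trans _ _ (1 + 0)); first by rewrite addr0; case: (_ != _); rewrite ?ler01.
  rewrite lerD// -[leLHS]expR0 ler_expR mulr_ge0// subr_ge0//.
rewrite -[leLHS]add0r lerD ?expR_ge0//.
case: eqP => [//|/eqP ne]/=; move: ne; rewrite /threshold_decode; case: pickP => [x|/(_ (w j))]/=.
  move=> /existsP[m hm] xw.
  rewrite (bigD1 (x, m))/=; last by rewrite xpair_eqE (negbTE xw).
  rewrite -[leLHS]addr0 lerD//; last by apply: sumr_ge0 => k _; exact: expR_ge0.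
  by rewrite -[leLHS]expR0 ler_expR subr_ge0 ltW.
by move=> /negbT /existsPn /(_ (l j)); rewrite gt_gam.
Qed.

Definition reliability_letter t z :=
  \sum_u dweight p u * (f t u z * expR (- s * xi t (u j) z)).
Definition output_letter t z := \sum_u dweight p u * f t u z.

Lemma expected_decode_error (d0 : W j) y :
  \sum_C Q C * (\sum_w dweight uW w * (\sum_l dweight uL l *
     (code_density C y w l * (threshold_decode d0 C y != w j)%:R))) <=
  expR (s * gam) * \prod_t reliability_letter t (y t) +
  (#|W j| * #|Lt j|)%:R * expR (- gam) * \prod_t output_letter t (y t).
Proof.
set B := (X in _ <= X).
have HB w l : \sum_C Q C * (code_density C y w l * (threshold_decode d0 C y != w j)%:R) <= B.
  apply: (@le_trans _ _ (\sum_C Q C * (code_density C y w l *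
     (expR (s * (gam - score (C j (w j, l j)) y)) +
      \sum_(k : W j * Lt j | k != (w j, l j)) expR (score (C j k) y - gam))))).
    apply: ler_sum => C _; rewrite ler_wpM2l// ler_wpM2l//.
      by rewrite ltW// word_density_gt0.
    exact: decode_error.
  have -> : \sum_C Q C * (code_density C y w l *
     (expR (s * (gam - score (C j (w j, l j)) y)) +
      \sum_(k : W j * Lt j | k != (w j, l j)) expR (score (C j k) y - gam))) =
    \sum_C Q C * (code_density C y w l * expR (s * (gam - score (C j (w j, l j)) y))) +
    \sum_(k : W j * Lt j | k != (w j, l j))
      \sum_C Q C * (code_density C y w l * expR (score (C j k) y - gam)).
    rewrite exchange_big/= -big_split/=; apply: eq_bigr => C _.
    by rewrite mulrDr mulrDr mulr_sumr mulr_sumr.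
  rewrite lerD//.
    rewrite le_eqVlt; apply/orP; left; apply/eqP.
    pose H v := word_density v y * expR (s * (gam - score (wcoord v j) y)).
    rewrite (eq_bigr (fun C => Q C * H (cwords C (key w l)))); last first.
      by move=> C _; rewrite /H coord_cwords.
    rewrite (cwords_marginal p1).
    rewrite -(sum_words_weight_prod p (fun t u => f t u (y t) * expR (- s * xi t (u j) (y t)))).
    rewrite mulr_sumr; apply: eq_bigr => v _; rewrite [RHS]mulrCA; congr (_ * _).
    rewrite big_split/= -/(word_density v y) -expR_sum /H mulrCA; congr (_ * _).
    rewrite -expRD; congr expR; rewrite -mulr_sumr mulrBr mulNr; congr (_ - _ * _).
    by apply: eq_bigr => t _; rewrite ffunE.
  apply: (@le_trans _ _ (\sum_(k : W j * Lt j) expR (- gam) * \prod_t output_letter t (y t))); last first.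
    by rewrite sumr_const card_prod -[leRHS]mulrA [leRHS]mulr_natl.
  rewrite [leRHS](bigID (fun k => k != (w j, l j)))/=.
  rewrite -[leLHS]addr0 lerD//; last first.
    apply: sumr_ge0 => k _; rewrite mulr_ge0 ?expR_ge0// prodr_ge0// => t _.
    by apply: sumr_ge0 => u _; rewrite mulr_ge0 ?dweight_ge0// ltW.
  apply: ler_sum => k kne.
  pose H C (u : word V n j) := code_density C y w l * expR (score u y - gam).
  rewrite (eq_bigr (fun C => Q C * H C (C j k)))//.
  rewrite (codeword_resample p1); last first.
    by move=> C u u'; rewrite /H /code_density cwords_set_codeword// eq_sym.
  (* A competing codeword is independent of the sent ones, so its exponential score has mean at most
     1 by [xi1], and each false alarm costs [expR (- gam)]. *)
  have sc1 : \sum_(u : word V n j) word_weight p u * expR (score u y) <= 1.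
    rewrite (eq_bigr (fun u => word_weight p u * \prod_t expR (xi t (u t) (y t)))); last first.
      by move=> u _; rewrite expR_sum.
    rewrite (sum_word_weight_prod p (fun t x => expR (xi t x (y t)))).
    rewrite -[leRHS](@big1_eq R 1 *%R 'I_n (index_enum _) xpredT) ler_prod// => t _.
    by rewrite xi1 andbT; apply: sumr_ge0 => x _; rewrite mulr_ge0 ?expR_ge0.
  apply: (@le_trans _ _ (\sum_C Q C * (code_density C y w l * expR (- gam)))).
    apply: ler_sum => C _; rewrite ler_wpM2l//.
    rewrite (eq_bigr (fun u => (code_density C y w l * expR (- gam)) *
       (word_weight p u * expR (score u y)))); last first.
      by move=> u _; rewrite /H expRD; ring.
    rewrite -mulr_sumr ler_piMr// mulr_ge0 ?expR_ge0// ltW// word_density_gt0//.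
  rewrite (cwords_marginal p1 (key w l) (fun v => word_density v y * expR (- gam))).
  rewrite -(sum_words_weight_prod p (fun t u => f t u (y t))) mulr_sumr.
  by apply: ler_sum => v _; rewrite mulrA mulrC.
have -> : \sum_C Q C * (\sum_w dweight uW w * (\sum_l dweight uL l *
     (code_density C y w l * (threshold_decode d0 C y != w j)%:R))) =
   \sum_w dweight uW w * (\sum_l dweight uL l *
     \sum_C Q C * (code_density C y w l * (threshold_decode d0 C y != w j)%:R)).
  under eq_bigr do rewrite mulr_sumr.
  rewrite exchange_big/=; apply: eq_bigr => w _.
  under eq_bigr do rewrite mulrCA.
  rewrite -mulr_sumr; congr (_ * _).
  under eq_bigr do rewrite mulr_sumr.
  rewrite exchange_big/=; apply: eq_bigr => l _.
  by rewrite mulr_sumr; apply: eq_bigr => C _; rewrite mulrCA.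
have dW w : 0 <= dweight uW w by apply: dweight_ge0 => k x; rewrite ltW// uW_gt0.
have dL l : 0 <= dweight uL l by apply: dweight_ge0 => k x; rewrite ltW// uL_gt0.
apply: (@le_trans _ _ (\sum_w dweight uW w * \sum_l dweight uL l * B)).
  by apply: ler_sum => w _; rewrite ler_wpM2l//; apply: ler_sum => l _; rewrite ler_wpM2l.
rewrite (eq_bigr (fun w => dweight uW w * B)); last first.
  by move=> w _; rewrite -mulr_suml (sum_dweight1 uL_sum1) mul1r.
by rewrite -mulr_suml (sum_dweight1 uW_sum1) mul1r.
Qed.

End random_coding.

Section codeword_cost.
Context {R : realType} {I : finType} {V W : I -> finType} {n : nat}.
Variable p : forall i, V i -> R.
Hypothesis p1 : forall i, \sum_(x : V i) p x = 1.

Lemma expected_codeword_exp i (k : W i) (h : 'I_n -> V i -> R) :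
  \sum_(C : codebook V W n) codebook_weight p C * expR (\sum_t h t (C i k t)) =
  \prod_t \sum_(x : V i) p x * expR (h t x).
Proof.
rewrite (@codeword_resample _ _ _ _ _ _ p1 _ _ (fun _ u => expR (\sum_t h t (u t))))//.
rewrite -mulr_suml (sum_codebook_weight p1) mul1r.
rewrite -(sum_word_weight_prod p (fun t x => expR (h t x))).
by apply: eq_bigr => u _; rewrite expR_sum.
Qed.

End codeword_cost.

Section letter_bounds.
Context {R : realType} {K : nat} {V : 'I_K -> finType}.
Variable pV : forall j, V j -> R.
Hypothesis pV_ge0 : forall j v, 0 <= pV (j:=j) v.
Hypothesis pV_sum1 : forall j, \sum_(v : V j) pV v = 1.
Local Notation letters := {dffun forall j : 'I_K, V j}.
Local Notation p := (dweight pV).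
Variable f : letters -> R -> R.
Hypothesis mf : forall u, measurable_fun setT (f u).
Hypothesis f0 : forall u y, 0 < f u y.
Hypothesis f1 : forall u, L_int (f u) = 1%E.

Let p0 u : 0 <= p u. Proof. exact: dweight_ge0. Qed.
Let p1 : \sum_u p u = 1. Proof. exact: sum_dweight1. Qed.

Lemma proj_miP i (u u' : letters) :
  reflect (forall k, i != k -> u' k = u k) (proj_mi i u' == proj_mi i u).
Proof.
apply: (iffP eqP) => [/ffunP uu k ik|uu].
  by have := uu k; rewrite !ffunE eq_sym (negbTE ik) => -[].
by apply/ffunP => k; rewrite !ffunE; case: eqVneq => [//|ki]; rewrite uu// eq_sym.
Qed.

Lemma sum_proj_mi i (u : letters) (H : letters -> R) :
  \sum_(u' | proj_mi i u' == proj_mi i u) H u' = \sum_(x : V i) H (dupd u x).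
Proof.
rewrite (reindex_onto (fun x : V i => dupd u x) (fun u' => u' i))/=; last first.
  move=> u' /proj_miP uu; apply/ffunP => k; have [<-|ik] := eqVneq i k.
    by rewrite dupd_same.
  by rewrite dupd_neq// uu.
apply: eq_bigl => x; rewrite dupd_same eqxx andbT.
by apply/proj_miP => k ik; rewrite dupd_neq.
Qed.

Lemma sum_proj_i_mi i (u : letters) (H : letters -> R) :
  \sum_(u' | (proj_i i u' == proj_i i u) && (proj_mi i u' == proj_mi i u)) H u' = H u.
Proof.
rewrite (big_pred1 u)// => u' /=; apply/andP/eqP => [[/eqP ui /proj_miP uu]|->//].
by apply/ffunP => k; have [<-|ik] := eqVneq i k; [exact: ui|exact: uu].
Qed.

(** Fixing the letters of all users but [i] leaves weights proportional to [pV]; the common factor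
    [p u / pV (u i)] cancels in the ratio of densities. *)
Lemma resolvability_tilted i s z :
  \sum_u p u * (f u z * expR (s * ln (f u z / (\sum_(x : V i) pV x * f (dupd u x) z)))) =
  tilted p (proj_i i) (proj_mi i) f s z.
Proof.
apply: eq_bigr => u _; rewrite mulrA.
have [->|pu0] := eqVneq (p u) 0; first by rewrite !mul0r.
congr (_ * expR (_ * _)); rewrite /info_density /pxz /qxz /pz /qz.
rewrite !sum_proj_i_mi !sum_proj_mi.
have pu : 0 < p u by rewrite lt_neqAle eq_sym pu0 p0.
have pi : 0 < pV (u i).
  rewrite lt_neqAle pV_ge0 andbT eq_sym; apply/eqP => e.
  by move: pu; rewrite /dweight (bigD1 i)//= e mul0r ltxx.
have E (x : V i) : p (dupd u x) = (p u / pV (u i)) * pV x.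
  by have D := dweight_dupd pV u x; rewrite mulrAC -D mulfK// gt_eqF.
rewrite [X in ln (_ / (_ / X))](_ : _ = p u / pV (u i)); last first.
  by under eq_bigr do rewrite E; rewrite -mulr_sumr pV_sum1 mulr1.
have -> : \sum_(x : V i) p (dupd u x) * f (dupd u x) z =
    (p u / pV (u i)) * \sum_(x : V i) pV x * f (dupd u x) z.
  by rewrite mulr_sumr; apply: eq_bigr => x _; rewrite E mulrA.
rewrite [p u * f u z]mulrC mulfK// [_ / _ * _]mulrC mulfK//.
by rewrite mulf_neq0 ?invr_neq0 ?gt_eqF.
Qed.

(** [\sum_x p(x) p(y | x) / p(y)] is 1; letters of probability zero are simply bounded. *)
Lemma score_normalized j z :
  \sum_(x : V j) pV x * expR (info_density p (proj_i j) (fun=> tt) f x tt z) <= 1.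
Proof.
have pzE : pz p (fun _ : letters => tt) tt = 1 by rewrite /pz -p1; exact: eq_bigl.
have qz_gt0 : 0 < qz p (fun _ : letters => tt) f tt z.
  have -> : qz p (fun _ : letters => tt) f tt z = \sum_u p u * f u z by exact: eq_bigl.
  rewrite lt_neqAle eq_sym sumr_ge0 ?andbT; last by move=> u _; rewrite mulr_ge0// ltW.
  apply/eqP => S0; have : \sum_u p u = 0.
    apply: big1 => u _; have pf0 k : true -> 0 <= p k * f k z by rewrite mulr_ge0// ltW.
    have /eqP : p u * f u z = 0 by apply: (psumr_eq0P pf0 S0).
    by rewrite mulf_eq0 (gt_eqF (f0 _ _)) orbF => /eqP.
  by move/eqP; rewrite p1 oner_eq0.
have pxE x : pxz p (proj_i j) (fun=> tt) x tt = pV x.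
  rewrite /pxz (eq_bigl (fun u => proj_i j u == x)); last by move=> u; rewrite andbT.
  rewrite big_mkcond/=.
  rewrite (eq_bigr (fun u : letters => p u * (u j == x)%:R)); last first.
    by move=> u _; rewrite /proj_i; case: eqP; rewrite ?mulr1 ?mulr0.
  apply: etrans; first exact: (dweight_marginal (fun x' : V j => (x' == x)%:R) pV_sum1).
  rewrite (bigD1 x)//= eqxx mulr1 big1 ?addr0// => x' /negbTE ->.
  by rewrite mulr0.
apply: (@le_trans _ _ (\sum_(x : V j) qxz p (proj_i j) (fun=> tt) f x tt z /
    qz p (fun=> tt) f tt z)).
  apply: ler_sum => x _; have [->|px0] := eqVneq (pV x) 0.
    rewrite mul0r; apply: divr_ge0; last exact: ltW.
    by apply: sumr_ge0 => u _; rewrite mulr_ge0// ltW.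
  have px : 0 < pV x by rewrite lt_neqAle eq_sym px0 pV_ge0.
  have q0 : 0 < qxz p (proj_i j) (fun=> tt) f x tt z.
    rewrite lt_neqAle eq_sym sumr_ge0 ?andbT; last by move=> u _; rewrite mulr_ge0// ltW.
    apply/eqP => S0; have : pxz p (proj_i j) (fun=> tt) x tt = 0.
      apply: big1 => u Pu.
      have pf0 k : (proj_i j k == x) && (tt == tt) -> 0 <= p k * f k z by rewrite mulr_ge0// ltW.
      have /eqP := psumr_eq0P pf0 S0 Pu.
      by rewrite mulf_eq0 (gt_eqF (f0 _ _)) orbF => /eqP.
    by rewrite pxE => /eqP; rewrite (negbTE px0).
  rewrite /info_density lnK ?posrE; last by rewrite !divr_gt0// ?pxE// pzE.
  rewrite pzE divr1 pxE mulrA [pV x * _]mulrC divfK//.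
rewrite -mulr_suml ler_pdivrMr// mul1r le_eqVlt; apply/orP; left; apply/eqP.
rewrite /qz /qxz [RHS](partition_big (proj_i j) xpredT)//=; apply: eq_bigr => x _.
by apply: eq_bigl => u; rewrite andbT.
Qed.

End letter_bounds.

(** * Secrecy, reliability and power of a coding scheme *)

Section letter_density.
Context {R : realType} {K : nat} {V : 'I_K -> finType}.
Variables (h : 'I_K -> 'I_K -> R) (g : 'I_K -> R).
Variable nu : forall j, V j -> probability R R.

Lemma out_densityE o (v : {dffun forall j, V j}) (y : R) :
  out_density h g nu o v y = gauss_mix (gain h g o) (fun j => nu (v j)) (enum 'I_K) y.
Proof.
rewrite /out_density (iint_gauss (gain h g o) (fun j => nu (v j)) y (fun=> 0) (enum_uniq _))/=.
by rewrite big_pred0 ?subr0// => j; rewrite mem_enum.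
Qed.

Lemma out_density_bounded o v : bounded_density (out_density h g nu o v).
Proof.
rewrite (_ : out_density h g nu o v = gauss_mix (gain h g o) (fun j => nu (v j)) (enum 'I_K)).
  exact: bounded_density_gauss_mix.
by apply/funext => y; exact: out_densityE.
Qed.

Lemma out_density_gt0 o v y : 0 < out_density h g nu o v y.
Proof. by have [] := out_density_bounded o v. Qed.

Lemma out_density_measurable o v : measurable_fun setT (out_density h g nu o v).
Proof. by have [] := out_density_bounded o v. Qed.

Lemma out_density_int o v : L_int (out_density h g nu o v) = 1%E.
Proof.
have [_ _ _ /(_ 0) <-] := out_density_bounded o v.
by apply: eq_integral => y _; rewrite subr0.
Qed.

End letter_density.

Section coding_scheme.
Context {R : realType} {K n : nat} {V : 'I_K -> finType}.
Variables (h : 'I_K -> 'I_K -> R) (g : 'I_K -> R).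
Variable pV : forall j, V j -> R.
Hypothesis pV_ge0 : forall j v, 0 <= pV (j:=j) v.
Hypothesis pV_sum1 : forall j, \sum_(v : V j) pV v = 1.
Variable mu : 'I_n -> forall j, V j -> probability R R.
Variables (M L : 'I_K -> nat).
Hypothesis M0 : forall j, (0 < M j)%N.
Hypothesis L0 : forall j, (0 < L j)%N.
Local Notation W := (fun j => 'I_(M j) : finType).
Local Notation Lt := (fun j => 'I_(L j) : finType).
Local Notation codebooks := (codebook V (fun j => ('I_(M j) * 'I_(L j))%type : finType) n).
Implicit Types C : codebooks.

Definition letter_density o t := out_density h g (mu t) o.

Definition letter_score j t (x : V j) (z : R) : R :=
  info_density (pV_joint pV) (proj_i j) (fun=> tt) (letter_density (Some j) t) x tt z.

Definition scheme (gam : 'I_K -> R) C : Defs.code R n M :=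
  Code (fun j w => uniform_mixture (L0 j)
          (fun l => product_law (fun t => mu t (C j (w, l) t))))
       (fun j x => @threshold_decode R 'I_K V W Lt n j (@letter_score j) (gam j)
          (Ordinal (M0 j)) C (tnth x)).

Definition scheme_density o C : ('I_n -> R) -> {dffun forall j, W j} -> {dffun forall j, Lt j} -> R :=
  @code_density R 'I_K V W Lt n (letter_density o) C.

(** The stochastic encoder makes the output density, given the messages, an average over dummy
    indices of product densities, which is the form required by the leakage bound. *)
Lemma scheme_blk gam C o w y :
  blk_density h g (scheme gam C) o w y = marg (@uL R 'I_K Lt) (scheme_density o C y) w.
Proof.
rewrite /blk_density /=.
rewrite (iint_block (gain h g o) L0 (fun j l t => mu t (C j (w j, l) t)) y
  (fun=> [tuple (0 : R) | _ < n]) (enum_uniq _))/=.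
apply: eq_bigr => l _; congr (_ * _).
  by apply: eq_bigr => j _; rewrite /uL card_ord.
apply: eq_bigr => t _; rewrite big_pred0; last by move=> j; rewrite mem_enum.
rewrite subr0 /letter_density out_densityE; congr (gauss_mix _ _ _ _).
by apply/funext => j; rewrite !ffunE.
Qed.

Lemma scheme_density_gt0 o C y w l : 0 < scheme_density o C y w l.
Proof. by apply: word_density_gt0 => t u z; exact: out_density_gt0. Qed.

Lemma word_density_measurable o v : rmeasurable (word_density (letter_density o) v).
Proof.
apply: measurable_fun_bigprod => t.
by apply: (@rmeasurable_coord R n (letter_density o t (v t)) t); exact: out_density_measurable.
Qed.

Lemma scheme_density_measurable o C w l : rmeasurable (fun y => scheme_density o C y w l).
Proof. exact: word_density_measurable. Qed.

Lemma scheme_density_int o C w l : Rn_int (fun y => scheme_density o C y w l) = 1%E.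
Proof.
rewrite [LHS](@Rn_int_prod R n (fun t => letter_density o t (cwords C (key w l) t)) (fun=> 1)) ?big1//.
- by move=> t; exact: out_density_measurable.
- by move=> t u; rewrite ltW// out_density_gt0.
- by move=> t; exact: out_density_int.
Qed.

Lemma letter_score_measurable j t x : measurable_fun setT (@letter_score j t x).
Proof. by apply: measurable_info_density => u; exact: out_density_measurable. Qed.

Lemma score_measurable j (u : word V n j) : rmeasurable (score (@letter_score j) u).
Proof.
apply: measurable_fun_bigsum => t.
by apply: (@rmeasurable_coord R n (letter_score t (u t)) t); exact: letter_score_measurable.
Qed.

(** The decision depends on the output only through finitely many threshold tests; its indicator is
    a sum over all patterns [be] of test results. *)
Lemma decision_measurable gam C j (d : 'I_(M j)) :
  rmeasurable (fun y => (@threshold_decode R 'I_K V W Lt n j (@letter_score j) gam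
    (Ordinal (M0 j)) C y == d)%:R).
Proof.
pose D (be : {ffun 'I_(M j) * 'I_(L j) -> bool}) : 'I_(M j) :=
  odflt (Ordinal (M0 j)) [pick x : 'I_(M j) | [exists m : 'I_(L j), be (x, m)]].
pose b (k : 'I_(M j) * 'I_(L j)) (y : 'I_n -> R) : bool := gam < score (@letter_score j) (C j k) y.
rewrite (_ : (fun y => _) = fun y => \sum_be (D be == d)%:R * \prod_k (b k y == be k)%:R); last first.
  apply/funext => y; rewrite (bigD1 [ffun k => b k y])//= [X in _ = _ + X]big1 ?addr0.
    rewrite [\prod__ _]big1 ?mulr1; last by move=> k _; rewrite ffunE eqxx.
    congr ((_ == _)%:R); rewrite /D /threshold_decode; congr odflt.
    apply: eq_pick => x /=; apply: eq_existsb => m; by rewrite ffunE.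
  move=> be /eqP ne; have [k nk] : exists k, b k y != be k.
    apply/existsP; apply: contra_notT ne => /existsPn H; apply/ffunP => k.
    by rewrite ffunE; have := H k; rewrite negbK => /eqP.
  by rewrite (bigD1 k)//= (negbTE nk) mul0r mulr0.
apply: measurable_fun_bigsum => be; apply: measurable_funM; first exact: measurable_cst.
apply: measurable_fun_bigprod => k; apply: measurable_fun_nat.
have mb : measurable_fun setT (fun t : n.-tuple R => b k (tnth t)).
  apply: measurable_fun_ltr; first exact: measurable_cst.
  exact: score_measurable.
case: (be k).
  by rewrite (_ : (fun t => _) = (fun t : n.-tuple R => b k (tnth t)))//; apply/funext => t; case: (b k _).
rewrite (_ : (fun t => _) = (fun t : n.-tuple R => ~~ b k (tnth t))); last first.
  by apply/funext => t; case: (b k _).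
exact: measurable_neg.
Qed.

Lemma scheme_dec_measurable gam C j (d : 'I_(M j)) :
  measurable [set x : n.-tuple R | dec (scheme gam C) j x = d].
Proof.
have := decision_measurable (gam j) C d.
move=> /(_ measurableT _ (measurable_set1 1)); rewrite setTI.
congr (measurable _); apply/seteqP; split => x /=.
  by case: eqP => // _ /eqP; rewrite eq_sym oner_eq0.
by move=> ->; rewrite eqxx.
Qed.

Definition scheme_error gam C j : \bar R :=
  Rn_int (fun y => \sum_w dweight (@uW R 'I_K W) w * (\sum_l dweight (@uL R 'I_K Lt) l *
    (scheme_density (Some j) C y w l *
     (@threshold_decode R 'I_K V W Lt n j (@letter_score j) gam (Ordinal (M0 j)) C y != w j)%:R))).

Lemma p_msgE w : @p_msg R K M w = dweight (@uW R 'I_K W) w.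
Proof. by apply: eq_bigr => j _; rewrite /uW card_ord. Qed.

Let uW_gt0' j (x : 'I_(M j)) : 0 < @uW R 'I_K W j x.
Proof. by apply: uW_gt0 => k; rewrite card_ord. Qed.
Let uL_gt0' j (x : 'I_(L j)) : 0 < @uL R 'I_K Lt j x.
Proof. by apply: uL_gt0 => k; rewrite card_ord. Qed.
Let dW0 w : 0 <= dweight (@uW R 'I_K W) w.
Proof. by apply: dweight_ge0 => j x; rewrite ltW// uW_gt0'. Qed.
Let dL0 l : 0 <= dweight (@uL R 'I_K Lt) l.
Proof. by apply: dweight_ge0 => j x; rewrite ltW// uL_gt0'. Qed.

Lemma error_summand_measurable gam C j w l : rmeasurable (fun y => scheme_density (Some j) C y w l *
     (@threshold_decode R 'I_K V W Lt n j (@letter_score j) gam (Ordinal (M0 j)) C y != w j)%:R).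
Proof.
apply: measurable_funM; first exact: scheme_density_measurable.
rewrite (_ : (fun t => _) = (fun t : n.-tuple R => 1 -
   (@threshold_decode R 'I_K V W Lt n j (@letter_score j) gam (Ordinal (M0 j)) C (tnth t) == w j)%:R)).
  by apply: measurable_funB; [exact: measurable_cst|exact: decision_measurable].
by apply/funext => t; case: (_ == _); rewrite ?subr0 ?subrr.
Qed.

Lemma scheme_errorE gam C j : err_prob h g (scheme gam C) j = scheme_error (gam j) C j.
Proof.
have mE := @error_summand_measurable (gam j) C j.
have E0 w l y : 0 <= scheme_density (Some j) C y w l *
     (@threshold_decode R 'I_K V W Lt n j (@letter_score j) (gam j) (Ordinal (M0 j)) C y != w j)%:R.
  by rewrite mulr_ge0// ltW// scheme_density_gt0.
have mE2 w : rmeasurable (fun y => \sum_l dweight (@uL R 'I_K Lt) l * (scheme_density (Some j) C y w l *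
     (@threshold_decode R 'I_K V W Lt n j (@letter_score j) (gam j) (Ordinal (M0 j)) C y != w j)%:R)).
  apply: measurable_fun_bigsum => l; apply: measurable_funM; [exact: measurable_cst|exact: mE].
have E20 w y : 0 <= \sum_l dweight (@uL R 'I_K Lt) l * (scheme_density (Some j) C y w l *
     (@threshold_decode R 'I_K V W Lt n j (@letter_score j) (gam j) (Ordinal (M0 j)) C y != w j)%:R).
  by apply: sumr_ge0 => l _; rewrite mulr_ge0.
rewrite /scheme_error Rn_int_sum; last 2 first.
- by move=> w; apply: measurable_funM; [exact: measurable_cst|exact: mE2].
- by move=> w y; rewrite mulr_ge0.
apply: eq_bigr => w _; rewrite Rn_intZ// p_msgE; congr (_ * _)%E.
apply: eq_Rn_int => y; rewrite scheme_blk /= tnth_mktuple_fun /marg mulr_suml.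
by apply: eq_bigr => l _; rewrite mulrA.
Qed.

Definition scheme_ref o C : 'I_K -> ('I_n -> R) -> {dffun forall j, W j} -> {dffun forall j, Lt j} -> R :=
  @code_ref R 'I_K V W Lt n pV (letter_density o) C.

Definition scheme_leakage o C i : \bar R :=
  leakage (@uW R 'I_K W) (@uL R 'I_K Lt) (scheme_density o C) (scheme_ref o C) i.

Lemma letter_ref_measurable o i t u :
  measurable_fun setT (letter_ref pV (letter_density o) i t u).
Proof.
apply: measurable_fun_bigsum => x.
by apply: measurable_funM; [exact: measurable_cst|exact: out_density_measurable].
Qed.

Lemma scheme_ref_gt0 o C i y w l : 0 < scheme_ref o C i y w l.
Proof. by apply: word_ref_gt0 => // t u z; exact: out_density_gt0. Qed.

Lemma scheme_ref_measurable o C i w l : rmeasurable (fun y => scheme_ref o C i y w l).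
Proof.
apply: measurable_fun_bigprod => t.
apply: (@rmeasurable_coord R n (letter_ref pV (letter_density o) i t _) t).
exact: letter_ref_measurable.
Qed.

Lemma scheme_secrecy gam C o (A : finType) (a : msg M -> A) (s : seq 'I_K) : uniq s ->
  (forall w u : msg M, (a w == a u) = agree s w u) ->
  ((condH_disc (@p_msg R K M) a (fun _ => tt))%:E <=
   condH_cont (@p_msg R K M) a (fun _ => tt) (blk_density h g (scheme gam C) o) (@int_Rn R n)
   + \sum_(i <- s) scheme_leakage o C i)%E.
Proof.
move=> us ag.
rewrite (_ : @p_msg R K M = dweight (@uW R 'I_K W)); last by apply/funext => w; exact: p_msgE.
rewrite (_ : blk_density h g (scheme gam C) o =
  (fun w y => marg (@uL R 'I_K Lt) (scheme_density o C y) w)); last first.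
  by apply/funext => w; apply/funext => y; exact: scheme_blk.
apply: entropy_loss_le_leakage => //.
- by move=> j; apply: uW_sum1 => k; rewrite card_ord.
- by move=> j; apply: uL_sum1 => k; rewrite card_ord.
- by move=> y w l; exact: scheme_density_gt0.
- by move=> w l; exact: scheme_density_measurable.
- by move=> w l; exact: scheme_density_int.
- by move=> i y w l; exact: scheme_ref_gt0.
- by move=> i w l; exact: scheme_ref_measurable.
- by move=> i y w l x; exact: code_ref_dupdW.
Qed.

Lemma scheme_power gam C j (w : 'I_(M j)) (c : 'I_n -> V j -> R) :
  (forall l t, \int[mu t (C j (w, l) t)]_x (x ^+ 2)%:E = (c t (C j (w, l) t))%:E)%E ->
  (\int[enc (scheme gam C) w]_x (\sum_(t < n) tnth x t ^+ 2)%:E =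
   (\sum_(l < L j) (L j)%:R^-1 * \sum_t c t (C j (w, l) t))%:E)%E.
Proof.
move=> hc /=.
have mX t : measurable_fun setT (fun x : n.-tuple R => tnth x t ^+ 2).
  by apply: measurable_funX; exact: measurable_tnth.
rewrite uniform_mixtureP; last 2 first.
- by apply/measurable_EFinP; exact: measurable_fun_bigsum.
- by move=> x; rewrite lee_fin; apply: sumr_ge0 => t _; exact: sqr_ge0.
rewrite -sumEFin; apply: eq_bigr => l _; rewrite EFinM; congr (_ * _)%E.
under eq_integral => x _ do rewrite -sumEFin.
rewrite ge0_integral_sum//; last 2 first.
- by move=> t; apply/measurable_EFinP.
- by move=> t x _; rewrite lee_fin sqr_ge0.
rewrite -sumEFin; apply: eq_bigr => t _.
(* The second moment of one coordinate is the integral of a product test function that equals 1 on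
   all other coordinates. *)
pose F (k : 'I_n) (z : R) : R := if k == t then z ^+ 2 else 1.
have := @product_lawP R n (fun t => mu t (C j (w, l) t)) F
  (fun k => if k == t then c t (C j (w, l) t) else 1).
rewrite (bigD1 t)//= eqxx big1 ?mulr1; last by move=> k /negbTE ->.
move=> <-.
- apply: eq_integral => x _; congr (_%:E).
  by rewrite (bigD1 t)//= /F eqxx big1 ?mulr1// => k /negbTE ->.
- move=> k; rewrite /F; case: eqP => _; [exact: measurable_funX|exact: measurable_cst].
- by move=> k u; rewrite /F; case: eqP => _; rewrite ?sqr_ge0.
- move=> k; rewrite /F; case: eqP => [->|_]; first exact: hc.
  exact: integral_const_probability.
Qed.

End coding_scheme.

(** * Expectations over the random codebook *)

Section finite_blocklength.
Context {R : realType} {K n : nat} {V : 'I_K -> finType}.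
Variables (h : 'I_K -> 'I_K -> R) (g : 'I_K -> R).
Variable pV : forall j, V j -> R.
Hypothesis pV_ge0 : forall j v, 0 <= pV (j:=j) v.
Hypothesis pV_sum1 : forall j, \sum_(v : V j) pV v = 1.
Variable nu : forall j, V j -> probability R R.
Variables (M L : 'I_K -> nat).
Hypothesis M0 : forall j, (0 < M j)%N.
Hypothesis L0 : forall j, (0 < L j)%N.
Variable n1 : nat.
Hypothesis n1n : (n1 <= n)%N.
Local Notation W := (fun j => 'I_(M j) : finType).
Local Notation Lt := (fun j => 'I_(L j) : finType).
Local Notation codebooks := (codebook V (fun j => ('I_(M j) * 'I_(L j))%type : finType) n).
Local Notation Q := (@codebook_weight R 'I_K V (fun j => ('I_(M j) * 'I_(L j))%type : finType) n pV).
Implicit Types (C : codebooks) (s : R).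

(* The last n - n1 channel uses are idle: every transmitter sends 0, which lowers the
   average power below P without changing the information terms. *)
Definition padded (t : 'I_n) j (v : V j) : probability R R :=
  if (t < n1)%N then nu v else (@dirac _ _ (0 : R) R : probability R R).

Local Notation lett := (letter_density h g padded).

Let lett_active o (t : 'I_n) : (t < n1)%N -> lett o t = out_density h g nu o.
Proof.
move=> tn; rewrite /letter_density (_ : padded t = nu)//.
by apply: functional_extensionality_dep => j; apply/funext => v; rewrite /padded tn.
Qed.

Let lett_idle o (t : 'I_n) u u' : (t < n1)%N = false -> lett o t u = lett o t u'.
Proof.
move=> tn; apply/funext => z; rewrite /letter_density !out_densityE.
by congr (gauss_mix _ _ _ _); apply/funext => j; rewrite /padded tn.
Qed.

Let lett_gt0 o t u z : 0 < lett o t u z. Proof. exact: out_density_gt0. Qed.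
Let m_lett o t u : measurable_fun setT (lett o t u). Proof. exact: out_density_measurable. Qed.
Let lett_int o t u : L_int (lett o t u) = 1%E. Proof. exact: out_density_int. Qed.
Let p0 u : 0 <= dweight pV u. Proof. exact: dweight_ge0. Qed.
Let p1 : \sum_u dweight pV u = 1. Proof. exact: sum_dweight1. Qed.

Let sum_cst (J : finType) (x : R) : \sum_(j : J) x = #|J|%:R * x.
Proof. by rewrite sumr_const mulr_natl. Qed.

Lemma prod_active (c : 'I_n -> R) (x : R) : (forall t, 0 <= c t) ->
  (forall t, c t <= if (t < n1)%N then expR x else 1) -> \prod_t c t <= expR (n1%:R * x).
Proof.
move=> c0 cx; apply: (@le_trans _ _ (\prod_(t < n) (if (t < n1)%N then expR x else 1))).
  by apply: ler_prod => t _; rewrite c0 cx.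
rewrite -big_mkcond/= (big_ord_narrow n1n) prodr_const card_ord.
by rewrite expRM_natl.
Qed.

Definition single_info j := fine (MI_single h g pV nu j (Some j)).
Definition cond_info i o := fine (MI_cond h g pV nu i o).

Let Rn_int_prod_le (T : 'I_n -> R -> R) (x : R) :
  (forall t, measurable_fun setT (T t)) -> (forall t z, 0 <= T t z) ->
  (forall t, (L_int (T t) <= (if (t < n1)%N then expR x else 1)%:E)%E) ->
  (Rn_int (fun y => \prod_t T t (y t))%R <= (expR (n1%:R * x))%:E)%E.
Proof.
move=> mT T0 Tx.
(* [Rn_int_prod] factors integrals with real values, so finiteness comes before the product. *)
have fT t : (L_int (T t) = (fine (L_int (T t)))%:E)%E.
  rewrite fineK// ge0_fin_numE; last exact: L_int_ge0.
  by apply: le_lt_trans (Tx t) (ltry _).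
rewrite (@Rn_int_prod R n T (fun t => fine (L_int (T t))))// lee_fin; apply: prod_active.
  by move=> t; apply: fine_ge0; exact: L_int_ge0.
by move=> t; rewrite -lee_fin -fT.
Qed.

Lemma resolvability_measurable i o t s :
  measurable_fun setT (resolvability_letter pV (lett o) i t s).
Proof.
apply: measurable_fun_bigsum => u; apply: measurable_funM; first exact: measurable_cst.
apply: measurable_funM => //; apply: measurable_fun_exp.
apply: measurable_funM; first exact: measurable_cst.
apply: measurable_fun_ln; apply: measurable_fun_div => //.
by apply: measurable_fun_bigsum => x; apply: measurable_funM => //; exact: measurable_cst.
Qed.

Lemma resolvability_ge0 i o t s z : 0 <= resolvability_letter pV (lett o) i t s z.
Proof. by apply: sumr_ge0 => u _; rewrite mulr_ge0// mulr_ge0 ?expR_ge0// ltW. Qed.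

(** On an active use this is the tilted bound, with [1 + u <= expR u]. On an idle use the output is
    pure noise, so the information density is zero and the factor is 1. *)
Lemma resolvability_int i o t s : 0 <= s -> s <= 2^-1 ->
  (L_int (resolvability_letter pV (lett o) i t s) <=
   (if (t < n1)%N then expR (s * cond_info i o + 16 * s ^+ 2 * (#|V i|%:R + 1)) else 1)%:E)%E.
Proof.
move=> s0 s1; case: ifPn => [tn|/negbTE tn].
  rewrite (@eq_L_int _ _ (tilted (pV_joint pV) (proj_i i) (proj_mi i) (out_density h g nu o) s)); last first.
    move=> z; rewrite -[RHS](resolvability_tilted pV_ge0 pV_sum1).
    by rewrite /resolvability_letter /letter_ref lett_active.
  have := @tilted_plus R _ _ _ (pV_joint pV) (proj_i i) (proj_mi i) (out_density h g nu o) p0 p1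
    (out_density_measurable h g nu o) (out_density_gt0 h g nu o) (out_density_int h g nu o) s s0 s1.
  by move=> /le_trans; apply; rewrite lee_fin -addrA; exact: expR_ge1Dx.
rewrite (@eq_L_int _ _ (fun z => \sum_u dweight pV u * lett o t u z)); last first.
  move=> z; apply: eq_bigr => u _; congr (_ * _).
  have -> : letter_ref pV (lett o) i t u z = lett o t u z.
    rewrite /letter_ref (eq_bigr (fun x => pV x * lett o t u z)).
      by rewrite -mulr_suml pV_sum1 mul1r.
    by move=> x _; rewrite (lett_idle o (dupd u x) u tn).
  by rewrite divff ?gt_eqF// ln1 mulr0 expR0 mulr1.
rewrite L_int_sum.
- rewrite -[X in (_ <= X%:E)%E]p1 -sumEFin le_eqVlt; apply/orP; left; apply/eqP.
  apply: eq_bigr => u _; rewrite L_intZ//= ?lett_int ?mule1// => z; exact: ltW.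
- by move=> u; apply: measurable_funM => //; exact: measurable_cst.
- by move=> u z; rewrite mulr_ge0// ltW.
Qed.

Let Q0 C : 0 <= Q C.
Proof. by do 3 apply: prodr_ge0 => ? _. Qed.

Let W0 i : (0 < #|W i|)%N. Proof. by rewrite card_ord. Qed.
Let Lt0 i : (0 < #|Lt i|)%N. Proof. by rewrite card_ord. Qed.

Let leak_y o C i y := leak_term (@uW R 'I_K W) (@uL R 'I_K Lt)
  (scheme_density h g padded o C y) (fun i => scheme_ref h g pV padded o C i y) i.

Let leak_y_measurable o C i : rmeasurable (leak_y o C i).
Proof.
apply: (@leak_term_measurable R 'I_K W Lt n (@uW R 'I_K W) (@uL R 'I_K Lt)
  (scheme_density h g padded o C) _ (scheme_ref h g pV padded o C)).
- by move=> w l; exact: scheme_density_measurable.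
- by move=> k w l; exact: scheme_ref_measurable.
Qed.

Let leak_y_ge0 o C i y : 0 <= leak_y o C i y.
Proof.
apply: leak_term_ge0.
- by move=> k x; exact: uW_gt0.
- by move=> k x; exact: uL_gt0.
- by move=> k; exact: uL_sum1.
- by move=> z w l; exact: scheme_density_gt0.
- by move=> k z w l; exact: scheme_ref_gt0.
Qed.

Lemma scheme_leakage_ge0 o C i : (0 <= scheme_leakage h g pV padded o C i)%E.
Proof. by apply: Rn_int_ge0 => y; exact: leak_y_ge0. Qed.

Lemma expected_leakage i o s : 0 < s -> s <= 2^-1 ->
  (\sum_C (Q C)%:E * scheme_leakage h g pV padded o C i <=
   (s^-1 * expR (- s * ln (L i)%:R) *
    expR (n1%:R * (s * cond_info i o + 16 * s ^+ 2 * (#|V i|%:R + 1))))%:E)%E.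
Proof.
move=> s0 s1.
have -> : (\sum_C (Q C)%:E * scheme_leakage h g pV padded o C i =
    Rn_int (fun y => \sum_C Q C * leak_y o C i y)%R)%E.
  rewrite Rn_int_sum.
  - by apply: eq_bigr => C _; rewrite (Rn_intZ (Q0 C) (leak_y_measurable o C i) (leak_y_ge0 o C i)).
  - by move=> C; apply: measurable_funM; [exact: measurable_cst|exact: leak_y_measurable].
  - by move=> C y; rewrite mulr_ge0.
have s_le1 : s <= 1 by lra.
pose c := s^-1 * expR (s * ln (#|Lt i|%:R)^-1).
have c0 : 0 <= c by rewrite mulr_ge0 ?expR_ge0// invr_ge0 ltW.
have mT : rmeasurable (fun y => \prod_t resolvability_letter pV (lett o) i t s (y t)).
  apply: measurable_fun_bigprod => t.
  by apply: (@rmeasurable_coord R n _ t); exact: resolvability_measurable.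
apply: (@le_trans _ _ (Rn_int (fun y => c * \prod_t resolvability_letter pV (lett o) i t s (y t)))).
  apply: Rn_int_le.
  - apply: measurable_fun_bigsum => C.
    by apply: measurable_funM; [exact: measurable_cst|exact: leak_y_measurable].
  - by apply: measurable_funM => //; exact: measurable_cst.
  - by move=> y; apply: sumr_ge0 => C _; rewrite mulr_ge0.
  - by move=> y; exact: expected_leak_term.
rewrite Rn_intZ//; last by move=> y; apply: prodr_ge0 => t _; exact: resolvability_ge0.
rewrite [in leRHS]EFinM /c card_ord lnV ?posrE ?ltr0n// mulrN -mulNr.
apply: lee_wpmul2l; first by rewrite lee_fin mulr_ge0 ?expR_ge0// invr_ge0 ltW.
apply: (Rn_int_prod_le (T := fun t => resolvability_letter pV (lett o) i t s)).
- by move=> t; exact: resolvability_measurable.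
- by move=> t z; exact: resolvability_ge0.
- by move=> t; apply: resolvability_int => //; exact: ltW.
Qed.

Lemma reliability_letterE j t s z :
  reliability_letter pV (lett (Some j)) (@letter_score R K n V h g pV padded j) s t z =
  tilted (pV_joint pV) (proj_i j) (fun=> tt) (lett (Some j) t) (- s) z.
Proof. by apply: eq_bigr => u _; rewrite mulrA. Qed.

Lemma reliability_int j t s : 0 <= s -> s <= 2^-1 ->
  (L_int (reliability_letter pV (lett (Some j)) (@letter_score R K n V h g pV padded j) s t) <=
   (if (t < n1)%N then expR (- s * single_info j + 16 * s ^+ 2 * (#|V j|%:R + 1)) else 1)%:E)%E.
Proof.
move=> s0 s1; rewrite (eq_L_int (@reliability_letterE j t s)).
case: ifPn => [tn|/negbTE tn].
  rewrite lett_active//.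
  have := @tilted_minus R _ _ _ (pV_joint pV) (proj_i j) (fun=> tt) (out_density h g nu (Some j))
    p0 p1 (out_density_measurable h g nu (Some j)) (out_density_gt0 h g nu (Some j))
    (out_density_int h g nu (Some j)) s s0 s1.
  by move=> /le_trans; apply; rewrite lee_fin -addrA mulNr; exact: expR_ge1Dx.
have u0 : {dffun forall j : 'I_K, V j}.
  have /eqP : \sum_u dweight pV u != 0 by rewrite p1 oner_eq0.
  case: (pickP (fun _ : {dffun forall j : 'I_K, V j} => true)) => [u //|e].
  by rewrite big_pred0.
rewrite (@eq_L_int _ _ (fun z => \sum_u dweight pV u * lett (Some j) t u z)); last first.
  move=> z; apply: eq_bigr => u _.
  rewrite [X in _ * expR (_ * X)](_ : _ = 0) ?mulr0 ?expR0 ?mulr1//.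
  rewrite /info_density; set px := pxz _ _ _ _ _; set pz' := pz _ _ _.
  have f0 := lett_gt0 (Some j) t u z.
  have -> : qxz (pV_joint pV) (proj_i j) (fun=> tt) (lett (Some j) t) (proj_i j u) tt z =
      px * lett (Some j) t u z.
    by rewrite mulr_suml; apply: eq_bigr => u' _; rewrite (lett_idle (Some j) u' u tn).
  have -> : qz (pV_joint pV) (fun=> tt) (lett (Some j) t) tt z = pz' * lett (Some j) t u z.
    by rewrite mulr_suml; apply: eq_bigr => u' _; rewrite (lett_idle (Some j) u' u tn).
  have -> : pz' = 1 by rewrite /pz' /pz -p1; exact: eq_bigl.
  (* For a letter of probability zero the density ratio is 0 by convention, and [ln 0 = 0] again
     gives a zero score. *)
  rewrite mul1r divr1; have [->|px0] := eqVneq px 0.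
    by rewrite invr0 mulr0 mul0r ln0.
  by rewrite mulrAC mulfK ?gt_eqF// divff// ln1.
rewrite L_int_sum.
- rewrite -[X in (_ <= X%:E)%E]p1 -sumEFin le_eqVlt; apply/orP; left; apply/eqP.
  apply: eq_bigr => u _; rewrite L_intZ//= ?lett_int ?mule1// => z; exact: ltW.
- by move=> u; apply: measurable_funM => //; exact: measurable_cst.
- by move=> u z; rewrite mulr_ge0// ltW.
Qed.

Let err_y gam C j y := \sum_w dweight (@uW R 'I_K W) w * (\sum_l dweight (@uL R 'I_K Lt) l *
    (scheme_density h g padded (Some j) C y w l *
     (@threshold_decode R 'I_K V W Lt n j (@letter_score R K n V h g pV padded j) gam
        (Ordinal (M0 j)) C y != w j)%:R)).

Let dW0 w : 0 <= dweight (@uW R 'I_K W) w.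
Proof. by apply: dweight_ge0 => j x; rewrite ltW//; exact: uW_gt0. Qed.
Let dL0 l : 0 <= dweight (@uL R 'I_K Lt) l.
Proof. by apply: dweight_ge0 => j x; rewrite ltW//; exact: uL_gt0. Qed.

Let err_y_measurable gam C j : rmeasurable (err_y gam C j).
Proof.
apply: measurable_fun_bigsum => w; apply: measurable_funM; first exact: measurable_cst.
apply: measurable_fun_bigsum => l; apply: measurable_funM; first exact: measurable_cst.
exact: error_summand_measurable.
Qed.

Let err_y_ge0 gam C j y : 0 <= err_y gam C j y.
Proof.
apply: sumr_ge0 => w _; rewrite mulr_ge0//; apply: sumr_ge0 => l _; rewrite mulr_ge0//.
by rewrite mulr_ge0// ltW// scheme_density_gt0.
Qed.

Lemma scheme_error_ge0 gam C j : (0 <= scheme_error h g pV padded M0 gam C j)%E.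
Proof. by apply: Rn_int_ge0 => y; exact: err_y_ge0. Qed.

Lemma expected_error j s gam : 0 < s -> s <= 2^-1 ->
  (\sum_C (Q C)%:E * scheme_error h g pV padded M0 gam C j <=
   (expR (s * gam) * expR (n1%:R * (- s * single_info j + 16 * s ^+ 2 * (#|V j|%:R + 1))) +
    (M j * L j)%:R * expR (- gam))%:E)%E.
Proof.
move=> s0 s1.
have -> : (\sum_C (Q C)%:E * scheme_error h g pV padded M0 gam C j =
    Rn_int (fun y => \sum_C Q C * err_y gam C j y)%R)%E.
  rewrite Rn_int_sum.
  - by apply: eq_bigr => C _; rewrite Rn_intZ.
  - by move=> C; apply: measurable_funM; [exact: measurable_cst|exact: err_y_measurable].
  - by move=> C y; rewrite mulr_ge0.
set rel := reliability_letter pV (lett (Some j)) (@letter_score R K n V h g pV padded j) s.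
set outl := output_letter pV (lett (Some j)).
have mrel t : measurable_fun setT (rel t).
  apply: measurable_fun_bigsum => u; apply: measurable_funM; first exact: measurable_cst.
  apply: measurable_funM => //; apply: measurable_fun_exp.
  by apply: measurable_funM; [exact: measurable_cst|exact: letter_score_measurable].
have rel0 t z : 0 <= rel t z.
  by apply: sumr_ge0 => u _; rewrite mulr_ge0// mulr_ge0 ?expR_ge0// ltW.
have mout t : measurable_fun setT (outl t).
  by apply: measurable_fun_bigsum => u; apply: measurable_funM => //; exact: measurable_cst.
have out0 t z : 0 <= outl t z by apply: sumr_ge0 => u _; rewrite mulr_ge0// ltW.
have out1 t : (L_int (outl t) = 1%:E)%E.
  rewrite L_int_sum.
  - rewrite -p1 -sumEFin; apply: eq_bigr => u _.
    by rewrite L_intZ//= ?lett_int ?mule1// => z; exact: ltW.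
  - by move=> u; apply: measurable_funM => //; exact: measurable_cst.
  - by move=> u z; rewrite mulr_ge0// ltW.
have mP1 : rmeasurable (fun y => \prod_t rel t (y t)).
  by apply: measurable_fun_bigprod => t; exact: (@rmeasurable_coord R n _ t).
have mP2 : rmeasurable (fun y => \prod_t outl t (y t)).
  by apply: measurable_fun_bigprod => t; exact: (@rmeasurable_coord R n _ t).
have P10 y : 0 <= \prod_t rel t (y t) by apply: prodr_ge0.
have P20 y : 0 <= \prod_t outl t (y t) by apply: prodr_ge0.
have c20 : 0 <= (#|W j| * #|Lt j|)%:R * expR (- gam) by rewrite mulr_ge0 ?expR_ge0.
apply: (@le_trans _ _ (Rn_int (fun y => expR (s * gam) * \prod_t rel t (y t) +
   (#|W j| * #|Lt j|)%:R * expR (- gam) * \prod_t outl t (y t)))).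
  apply: Rn_int_le.
  - apply: measurable_fun_bigsum => C.
    by apply: measurable_funM; [exact: measurable_cst|exact: err_y_measurable].
  - by apply: measurable_funD; apply: measurable_funM => //; exact: measurable_cst.
  - by move=> y; apply: sumr_ge0 => C _; rewrite mulr_ge0.
  - move=> y; apply: expected_decode_error => //; last exact: ltW.
    by move=> t z; apply: score_normalized.
rewrite Rn_intD//; last 4 first.
- by apply: measurable_funM => //; exact: measurable_cst.
- by apply: measurable_funM => //; exact: measurable_cst.
- by move=> y; rewrite mulr_ge0 ?expR_ge0.
- by move=> y; rewrite mulr_ge0.
rewrite !Rn_intZ ?expR_ge0// EFinD; apply: leeD.
  rewrite EFinM; apply: lee_wpmul2l; first by rewrite lee_fin expR_ge0.
  by apply: Rn_int_prod_le => // t; apply: reliability_int => //; exact: ltW.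
rewrite (@Rn_int_prod R n outl (fun=> 1))// big1 ?mule1//.
by rewrite !card_ord.
Qed.

Variable cost : forall j, V j -> R.

Definition active_cost C j (k : 'I_(M j) * 'I_(L j)) : R :=
  \sum_(t < n) if (t < n1)%N then cost (C j k t) else 0.

(** A codeword average of [s^-1 * expR (s * x)], an exponential majorant of the excess [x] of the
    cost over [theta]; being multiplicative over letters, its mean over codebooks is computable. *)
Definition excess_power C j s theta : R :=
  \sum_(k : 'I_(M j) * 'I_(L j)) (M j)%:R^-1 * (L j)%:R^-1 *
    (s^-1 * expR (s * (active_cost C k - theta))).

(** The same Chernoff bound as for the information density, with the letter cost in its place; the
    alphabet is finite, so its exponential moments are finite. *)
Lemma expected_excess_power j s theta : 0 < s -> s <= 2^-1 ->
  \sum_C Q C * excess_power C j s theta <=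
  s^-1 * expR (- s * theta) * expR (n1%:R * (s * (\sum_(v : V j) pV v * cost v) +
    16 * s ^+ 2 * \sum_(v : V j) pV v * (expR (cost v) + expR (- cost v)))).
Proof.
move=> s0 s1.
set B := (X in _ <= X).
have HB (k : 'I_(M j) * 'I_(L j)) :
    \sum_C Q C * (s^-1 * expR (s * (active_cost C k - theta))) <= B.
  pose hh (t : 'I_n) (v : V j) := if (t < n1)%N then s * cost v else 0.
  have -> : \sum_C Q C * (s^-1 * expR (s * (active_cost C k - theta))) =
      s^-1 * expR (- s * theta) * \sum_C Q C * expR (\sum_t hh t (C j k t)).
    rewrite mulr_sumr; apply: eq_bigr => C _.
    rewrite mulrBr expRD -mulNr.
    have -> : s * active_cost C k = \sum_t hh t (C j k t).
      by rewrite mulr_sumr; apply: eq_bigr => t _; rewrite /hh; case: ifP => //; rewrite mulr0.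
    by ring.
  rewrite /B ler_wpM2l ?mulr_ge0 ?expR_ge0 ?invr_ge0 ?(ltW s0)//.
  rewrite (expected_codeword_exp pV_sum1 k hh); apply: prod_active => t.
    by apply: sumr_ge0 => v _; rewrite mulr_ge0 ?expR_ge0.
  rewrite /hh; case: (t < n1)%N; last first.
    by rewrite -mulr_suml pV_sum1 expR0 mul1r.
  apply: le_trans (expR_ge1Dx _).
  have -> : 1 + (s * (\sum_(v : V j) pV v * cost v) +
     16 * s ^+ 2 * \sum_(v : V j) pV v * (expR (cost v) + expR (- cost v))) =
     \sum_(v : V j) pV v * (1 + s * cost v + 16 * s ^+ 2 * (expR (cost v) + expR (- cost v))).
    rewrite -[X in X + _](pV_sum1 j) addrA !mulr_sumr -!big_split/=.
    by apply: eq_bigr => v _; ring.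
  apply: ler_sum => v _; rewrite ler_wpM2l//.
  by apply: expR_chernoff => //; exact: ltW.
have -> : \sum_C Q C * excess_power C j s theta =
    \sum_(k : 'I_(M j) * 'I_(L j)) (M j)%:R^-1 * (L j)%:R^-1 *
    \sum_C Q C * (s^-1 * expR (s * (active_cost C k - theta))).
  under eq_bigr do rewrite mulr_sumr.
  rewrite exchange_big/=; apply: eq_bigr => k _.
  by rewrite mulr_sumr; apply: eq_bigr => C _; rewrite mulrCA.
apply: (@le_trans _ _ (\sum_(k : 'I_(M j) * 'I_(L j)) (M j)%:R^-1 * (L j)%:R^-1 * B)).
  by apply: ler_sum => k _; rewrite ler_wpM2l// mulr_ge0.
rewrite sum_cst card_prod !card_ord mulrA natrM.
by rewrite -invfM divff ?mul1r// mulf_neq0// pnatr_eq0 -lt0n.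
Qed.

Lemma avg_active_cost_le C j s theta : 0 < s ->
  \sum_(w < M j) \sum_(l < L j) (L j)%:R^-1 * active_cost C (w, l) <=
  (M j)%:R * (theta + excess_power C j s theta).
Proof.
move=> s0.
have M1 : (M j)%:R != 0 :> R by rewrite pnatr_eq0 -lt0n.
have L1 : (L j)%:R != 0 :> R by rewrite pnatr_eq0 -lt0n.
rewrite pair_big/=.
have -> : (M j)%:R * (theta + excess_power C j s theta) =
   \sum_(k : 'I_(M j) * 'I_(L j)) (L j)%:R^-1 *
     (theta + s^-1 * expR (s * (active_cost C k - theta))).
  rewrite (eq_bigr (fun k => (L j)%:R^-1 * theta +
     (L j)%:R^-1 * (s^-1 * expR (s * (active_cost C k - theta))))); last by move=> k _; rewrite mulrDr.
  rewrite big_split/= sum_cst card_prod !card_ord mulrDr natrM.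
  congr (_ + _); first by field.
  rewrite /excess_power mulr_sumr; apply: eq_bigr => k _.
  by field; rewrite M1 L1 gt_eqF.
apply: ler_sum => -[w l] _ /=; rewrite ler_wpM2l//.
have := @expR_ge1Dx R (s * (active_cost C (w, l) - theta)).
move=> /(ler_wpM2l (_ : 0 <= s^-1)); rewrite invr_ge0 => /(_ (ltW s0)).
rewrite mulrDr mulrA mulVf ?gt_eqF// mul1r mulr1.
have : 0 < s^-1 by rewrite invr_gt0.
lra.
Qed.

(** Some codebook does no worse than the mean. It is taken of positive weight, so that its letters
    have positive probability and hence a finite second moment. *)
Lemma good_codebook (B : codebooks -> \bar R) (eta : R) : (forall C, 0 <= B C)%E ->
  (\sum_C (Q C)%:E * B C <= eta%:E)%E -> exists2 C, 0 < Q C & (B C <= eta%:E)%E.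
Proof.
move=> B0 Beta; apply: contrapT => /forall2NP nex.
have BC C : 0 < Q C -> (eta%:E < B C)%E.
  by move=> QC; have [//|/negP] := nex C; rewrite -ltNge.
have S1 : \sum_C Q C = 1 by exact: sum_codebook_weight.
have [C0 QC0] : exists C, 0 < Q C.
  apply: contrapT => /forallNP nQ; have : \sum_C Q C = 0.
    by apply: big1 => C _; apply/eqP; rewrite eq_le Q0 andbT leNgt; exact/negP.
  by rewrite S1 => /eqP; rewrite oner_eq0.
have : (\sum_C (Q C)%:E * eta%:E < \sum_C (Q C)%:E * B C)%E.
  rewrite (bigD1 C0)//= [ltRHS](bigD1 C0)//=; apply: lte_leD.
  - by under eq_bigr do rewrite -EFinM; rewrite sumEFin.
  - by rewrite lte_pmul2l ?lte_fin// BC.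
  - apply: lee_sum => C _; have [QC|QC] := ltP 0 (Q C).
      by rewrite lee_pmul2l// ltW// BC.
    have -> : Q C = 0 by apply/eqP; rewrite eq_le QC Q0.
    by rewrite !mul0e.
rewrite ltNge => /negP; apply; apply: (le_trans Beta).
by under eq_bigr do rewrite -EFinM; rewrite sumEFin -mulr_suml S1 mul1r.
Qed.

End finite_blocklength.

(** * Selection of one codebook *)

Section nonneg_sums.
Context {R : realType}.

Lemma le_sume_term (J : finType) (P : pred J) (F : J -> \bar R) (j : J) : P j ->
  (forall k, 0 <= F k)%E -> (F j <= \sum_(k | P k) F k)%E.
Proof. by move=> Pj F0; rewrite (bigD1 j)//= leeDl// sume_ge0. Qed.

(** A positive minimum over a finite type; the added 1 in the witness covers an empty [J]. *)
Lemma exists_lower_bound (J : finType) (F : J -> R) : (forall j, 0 < F j) ->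
  exists2 d, 0 < d & forall j, d <= F j.
Proof.
move=> F0; have S0 : 0 < 1 + \sum_j (F j)^-1.
  by rewrite ltr_pwDl// sumr_ge0// => j _; rewrite invr_ge0 ltW.
exists (1 + \sum_j (F j)^-1)^-1; first by rewrite invr_gt0.
move=> j; rewrite -[leRHS]invrK lef_pV2 ?posrE ?invr_gt0//.
rewrite (bigD1 j)//= addrCA lerDl addr_ge0// sumr_ge0// => k _.
by rewrite invr_ge0 ltW.
Qed.

Lemma exists_nat_bound (J : finType) (F : J -> R) :
  exists2 q : nat, (0 < q)%N & forall j, F j <= q%:R.
Proof.
exists (Num.truncn (\sum_j `|F j|)).+1 => // j.
apply: (@le_trans _ _ (\sum_j `|F j|)); last by rewrite ltW// truncnS_gt.
by rewrite (bigD1 j)//= (le_trans (ler_norm _))// lerDl sumr_ge0.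
Qed.

End nonneg_sums.

Section good_codebook.
Context {R : realType} {K n : nat} {V : 'I_K -> finType}.
Variables (h : 'I_K -> 'I_K -> R) (g : 'I_K -> R).
Variable pV : forall j, V j -> R.
Hypothesis pV_ge0 : forall j v, 0 <= pV (j:=j) v.
Hypothesis pV_sum1 : forall j, \sum_(v : V j) pV v = 1.
Variable nu : forall j, V j -> probability R R.
Variables (M L : 'I_K -> nat).
Hypothesis M0 : forall j, (0 < M j)%N.
Hypothesis L0 : forall j, (0 < L j)%N.
Variable n1 : nat.
Hypothesis n1n : (n1 <= n)%N.
Variable cost : forall j, V j -> R.
Variables (gam theta : 'I_K -> R) (s e eta : R).
Hypothesis s_gt0 : 0 < s.
Hypothesis s_le : s <= 2^-1.
Local Notation codebooks := (codebook V (fun j => ('I_(M j) * 'I_(L j))%type : finType) n).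
Local Notation Q := (@codebook_weight R 'I_K V (fun j => ('I_(M j) * 'I_(L j))%type : finType) n pV).
Local Notation mu := (@padded R K n V nu n1).
Implicit Types C : codebooks.

Hypothesis error_bound : forall j,
  expR (s * gam j) * expR (n1%:R * (- s * single_info h g pV nu j + 16 * s ^+ 2 * (#|V j|%:R + 1))) +
    (M j * L j)%:R * expR (- gam j) <= e.
Hypothesis leakage_bound : forall i o, o != Some i ->
  s^-1 * expR (- s * ln (L i)%:R) *
    expR (n1%:R * (s * cond_info h g pV nu i o + 16 * s ^+ 2 * (#|V i|%:R + 1))) <= e.
Hypothesis power_bound : forall j,
  s^-1 * expR (- s * theta j) * expR (n1%:R * (s * (\sum_(v : V j) pV v * cost v) +
    16 * s ^+ 2 * \sum_(v : V j) pV v * (expR (cost v) + expR (- cost v)))) <= e.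
Hypothesis eta_bound : (K * (K + 3))%:R * e <= eta.

Let Q0 C : 0 <= Q C.
Proof. by do 3 apply: prodr_ge0 => ? _. Qed.

Lemma excess_power_ge0 C j : 0 <= excess_power n1 cost C j s (theta j).
Proof.
by apply: sumr_ge0 => k _; rewrite mulr_ge0// mulr_ge0 ?expR_ge0// invr_ge0 ltW.
Qed.

(** All error, leakage and power terms are nonnegative, so a bound on their total mean suffices.
    There are [K] errors, at most [(K + 1) * K] leakages and [K] power terms, hence the factor
    [K * (K + 3)]. *)
Lemma exists_good_codebook : exists C, [/\ 0 < Q C,
  forall j, (scheme_error h g pV mu M0 (gam j) C j <= eta%:E)%E,
  forall o, (\sum_(i | o != Some i) scheme_leakage h g pV mu o C i <= eta%:E)%E &
  forall j, excess_power n1 cost C j s (theta j) <= eta].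
Proof.
pose BE C := (\sum_j scheme_error h g pV mu M0 (gam j) C j)%E.
pose BL C := (\sum_o \sum_(i | o != Some i) scheme_leakage h g pV mu o C i)%E.
pose BP C := (\sum_j (excess_power n1 cost C j s (theta j))%:E)%E.
have err0 C j : (0 <= scheme_error h g pV mu M0 (gam j) C j)%E.
  exact: scheme_error_ge0.
have lk0 o C i : (0 <= scheme_leakage h g pV mu o C i)%E.
  exact: scheme_leakage_ge0.
have pw0 C j : (0 <= (excess_power n1 cost C j s (theta j))%:E)%E.
  by rewrite lee_fin excess_power_ge0.
have BE0 C : (0 <= BE C)%E by exact: sume_ge0.
have lks0 o C : (0 <= \sum_(i | o != Some i) scheme_leakage h g pV mu o C i)%E by exact: sume_ge0.
have BL0 C : (0 <= BL C)%E by exact: sume_ge0.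
have BP0 C : (0 <= BP C)%E by exact: sume_ge0.
have distr (J : finType) (P : pred J) (F : codebooks -> J -> \bar R) (c : R) :
    (forall C j, 0 <= F C j)%E -> 0 <= c ->
    (forall j, P j -> \sum_C (Q C)%:E * F C j <= c%:E)%E ->
    (\sum_C (Q C)%:E * (\sum_(j | P j) F C j) <= (#|J|%:R * c)%:E)%E.
  move=> F0 c0 Fc; under eq_bigr do rewrite ge0_sume_distrr//.
  rewrite exchange_big/=; apply: (@le_trans _ _ (\sum_(j : J) c%:E)%E).
    rewrite [leRHS](bigID P)/=; apply: (@le_trans _ _ (\sum_(j | P j) c%:E)%E).
      exact: lee_sum.
    by rewrite leeDl// sume_ge0.
  by rewrite sumEFin sumr_const mulr_natl.
have e0 (j : 'I_K) : 0 <= e.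
  by apply: (le_trans _ (error_bound j)); rewrite addr_ge0 ?mulr_ge0 ?expR_ge0.
have [C QC BC] : exists2 C, 0 < Q C & (BE C + BL C + BP C <= eta%:E)%E.
  apply: good_codebook => //; first by move=> C; rewrite !adde_ge0.
  have -> : (\sum_C (Q C)%:E * (BE C + BL C + BP C) =
      \sum_C (Q C)%:E * BE C + \sum_C (Q C)%:E * BL C + \sum_C (Q C)%:E * BP C)%E.
    rewrite -!big_split/=; apply: eq_bigr => C _.
    by rewrite ge0_muleDr ?adde_ge0// ge0_muleDr.
  (* [e] is nonnegative as soon as there is a user; a negative [e] means [K = 0], where all sums are
     empty. *)
  have [e_ge0|e_lt0] := leP 0 e; last first.
    have noK (j : 'I_K) : False by move: e_lt0; rewrite ltNge (e0 j).
    have -> : (\sum_C (Q C)%:E * BE C = 0)%E.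
      by apply: big1 => C _; rewrite /BE big1 ?mule0// => j _; case: (noK j).
    have -> : (\sum_C (Q C)%:E * BL C = 0)%E.
      apply: big1 => C _; rewrite /BL big1 ?mule0// => o _.
      by rewrite big1// => j _; case: (noK j).
    have -> : (\sum_C (Q C)%:E * BP C = 0)%E.
      by apply: big1 => C _; rewrite /BP big1 ?mule0// => j _; case: (noK j).
    have K0 : K = 0%N by case: (posnP K) => // K1; case: (noK (Ordinal K1)).
    have : (K * (K + 3))%N = 0%N by rewrite K0.
    by rewrite !adde0 lee_fin => e'; move: eta_bound; rewrite e' mul0r.
  have h1 : (\sum_C (Q C)%:E * BE C <= (K%:R * e)%:E)%E.
    rewrite -[X in (X%:R * e)%:E](card_ord K).
    apply: (distr _ xpredT (fun C j => scheme_error h g pV mu M0 (gam j) C j)) => // j _.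
    apply: (le_trans (expected_error h g pV_ge0 pV_sum1 nu M0 L0 n1n j (gam j) s_gt0 s_le)).
    by rewrite lee_fin.
  have h2 : (\sum_C (Q C)%:E * BL C <= ((K + 1)%:R * (K%:R * e))%:E)%E.
    have -> : (K + 1)%N = #|{: option 'I_K}| by rewrite card_option card_ord addn1.
    apply: (distr _ xpredT (fun C o => \sum_(i | o != Some i) scheme_leakage h g pV mu o C i)%E) => //.
      by rewrite mulr_ge0.
    move=> o _; rewrite -[X in (X%:R * e)%:E](card_ord K).
    apply: (distr _ (fun i => o != Some i) (fun C i => scheme_leakage h g pV mu o C i)) => // i oi.
    apply: (le_trans (expected_leakage h g pV_ge0 pV_sum1 nu M0 L0 n1n i o s_gt0 s_le)).
    by rewrite lee_fin; exact: leakage_bound.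
  have h3 : (\sum_C (Q C)%:E * BP C <= (K%:R * e)%:E)%E.
    rewrite -[X in (X%:R * e)%:E](card_ord K).
    apply: (distr _ xpredT (fun C j => (excess_power n1 cost C j s (theta j))%:E)) => // j _.
    under eq_bigr do rewrite -EFinM; rewrite sumEFin lee_fin.
    apply: le_trans (power_bound j).
    exact: expected_excess_power.
  apply: (le_trans (leeD (leeD h1 h2) h3)); rewrite -!EFinD lee_fin.
  apply: le_trans eta_bound; rewrite natrM !natrD.
  by rewrite le_eqVlt; apply/orP; left; apply/eqP; ring.
exists C; split => //.
- move=> j; apply: le_trans BC.
  apply: (@le_trans _ _ (BE C)); first exact: (le_sume_term (P := xpredT) (F := fun j => scheme_error h g pV mu M0 (gam j) C j)).
  by rewrite -addeA leeDl// adde_ge0.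
- move=> o; apply: le_trans BC.
  apply: (@le_trans _ _ (BL C)).
    exact: (le_sume_term (P := xpredT) (F := fun o => \sum_(i | o != Some i) scheme_leakage h g pV mu o C i)%E).
  by rewrite addeAC leeDr// adde_ge0.
- move=> j; rewrite -lee_fin; apply: le_trans BC.
  apply: (@le_trans _ _ (BP C)).
    exact: (le_sume_term (P := xpredT) (F := fun j => (excess_power n1 cost C j s (theta j))%:E)).
  by rewrite leeDr// adde_ge0.
Qed.

Lemma codebook_support C j k t : 0 < Q C -> 0 < pV (C j k t).
Proof.
move=> QC; rewrite lt_neqAle pV_ge0 andbT eq_sym; apply/eqP => p0.
by move: QC; rewrite /codebook_weight /dweight (bigD1 j)//= (bigD1 k)//= /word_weight
  (bigD1 t)//= p0 !mul0r ltxx.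
Qed.

Lemma padded_second_moment C j k t :
  (forall v : V j, 0 < pV v -> (\int[nu v]_x (x ^+ 2)%:E = (cost v)%:E)%E) -> 0 < Q C ->
  (\int[mu t (C j k t)]_x (x ^+ 2)%:E = (if (t < n1)%N then cost (C j k t) else 0)%:E)%E.
Proof.
move=> hc QC; rewrite /padded; case: ifP => _; first by apply: hc; exact: codebook_support.
rewrite integral_dirac//.
  by rewrite diracT mul1e expr0n.
by apply/measurable_EFinP; exact: measurable_funX.
Qed.

End good_codebook.

(** * Choice of the parameters *)

Section ceiling.
Context {R : realType}.

Definition exp_ceil (x : R) : nat := (Num.truncn (expR x)).+1.

Lemma exp_ceil_ge (x : R) : expR x <= (exp_ceil x)%:R.
Proof. by rewrite ltW// truncnS_gt. Qed.

Lemma exp_ceil_le (x : R) : 0 <= x -> (exp_ceil x)%:R <= 2 * expR x.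
Proof.
move=> x0; have e1 : 1 <= expR x by rewrite -[leLHS]expR0 ler_expR.
rewrite /exp_ceil -addn1 natrD.
have : (Num.truncn (expR x))%:R <= expR x by rewrite truncn_le ?expR_ge0.
lra.
Qed.

Lemma ln_exp_ceil_ge (x : R) : x <= ln (exp_ceil x)%:R.
Proof. by rewrite -[leLHS](@expRK R) ler_ln ?posrE ?expR_gt0 ?ltr0n// exp_ceil_ge. Qed.

End ceiling.

Section exponents.
Context {R : realType}.
Implicit Types N s d c x a b : R.

Lemma error_exponent N s d c x a : 0 <= N -> 0 < s -> 16 * s * c <= d -> x <= N * (s * d) ->
  s * (N * (a - 2 * d)) + N * (- s * a + 16 * s ^+ 2 * c) <= - x.
Proof.
move=> N0 s0 sc xd; have : N * s * (16 * s * c) <= N * s * d.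
  by rewrite ler_wpM2l// mulr_ge0// ltW.
rewrite expr2; lra.
Qed.

(** The budget of [6 * d]: two parts in the dummy rate, two in the threshold, one for the rate lost
    on idle uses, and one left for the exponential decay. *)
Lemma rate_exponent N m s d x a b r : 0 <= N -> m * r <= N * d -> r + b + 6 * d <= a ->
  0 < d -> s <= 1 -> x <= N * (s * d) ->
  (N + m) * r + N * (b + 2 * d) - N * (a - 2 * d) <= - x.
Proof.
move=> N0 mr g d0 s1 xd; have h1 := ler_wpM2l N0 g.
have h2 : N * (s * d) <= N * d by rewrite ler_wpM2l// ger_pMl.
lra.
Qed.

Lemma leakage_exponent N s d c x b i t : 0 <= N -> 0 < s -> 16 * s * c <= d -> i <= b ->
  N * (b + 2 * d) <= t -> x <= N * (s * d) ->
  - s * t + N * (s * i + 16 * s ^+ 2 * c) <= - x.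
Proof.
move=> N0 s0 sc ib tb xd; have Ns : 0 <= N * s by rewrite mulr_ge0// ltW.
have h1 := ler_wpM2l Ns sc; have h2 := ler_wpM2l Ns ib; have h3 := ler_wpM2l (ltW s0) tb.
rewrite expr2; lra.
Qed.

Lemma power_exponent N s d c x i p : 0 <= N -> 0 < s -> 16 * s * c <= d -> i <= p ->
  x <= N * (s * d) -> - s * (N * (p + 2 * d)) + N * (s * i + 16 * s ^+ 2 * c) <= - x.
Proof. by move=> N0 s0 sc ip xd; exact: (leakage_exponent N0 s0 sc ip (lexx _) xd). Qed.

Lemma le_5Dinv s y : 0 < s -> 0 <= y -> s^-1 * y <= (5 + s^-1) * y.
Proof. by move=> s0 y0; rewrite ler_wpM2r// lerDr. Qed.

(** The idle uses free the energy [m * p = 3 * N * d]: [2 * N * d] pays for the slack of the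
    threshold [theta], and the rest for the mean excess, at most [d]. *)
Lemma idle_power N m q p d : 1 <= N -> 0 < d -> N = q * m -> d * (3 * q) = p ->
  N * (p + 2 * d) + d <= (N + m) * p.
Proof.
move=> N1 d0 Nqm dp; have : 1 * d <= N * d by rewrite ler_wpM2r// ltW.
have : N * d * 3 = m * p by rewrite Nqm -dp; ring.
lra.
Qed.

End exponents.

Section achievability.
Context {R : realType} {K : nat} {V : 'I_K -> finType}.
Variables (P : R) (h : 'I_K -> 'I_K -> R) (g : 'I_K -> R).
Variable pV : forall j, V j -> R.
Hypothesis pV_ge0 : forall j v, 0 <= pV (j:=j) v.
Hypothesis pV_sum1 : forall j, \sum_(v : V j) pV v = 1.
Variable mu : forall j, V j -> probability R R.
Hypothesis power : forall j,
  (\sum_(v : V j) (pV v)%:E * \int[mu v]_x ((x ^+ 2)%R)%:E <= P%:E)%E.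
Variable Rt : 'I_K -> R.
Hypothesis Rt_ge0 : forall i, 0 <= Rt i.

Definition second_moment j (v : V j) : R := fine (\int[mu v]_x (x ^+ 2)%:E).

Let int_ge0 j (v : V j) : (0 <= \int[mu v]_x (x ^+ 2)%:E)%E.
Proof. by apply: integral_ge0 => x _; rewrite lee_fin sqr_ge0. Qed.

Lemma second_momentE j (v : V j) : 0 < pV v ->
  (\int[mu v]_x (x ^+ 2)%:E = (second_moment v)%:E)%E.
Proof.
move=> pv; rewrite /second_moment fineK// ge0_fin_numE//.
have : ((pV v)%:E * \int[mu v]_x (x ^+ 2)%:E < +oo)%E.
  apply: le_lt_trans (ltry P); apply: le_trans (power j).
  by apply: (le_sume_term (P := xpredT)
    (F := fun v : V j => (pV v)%:E * \int[mu v]_x ((x ^+ 2)%R)%:E)%E) => // u; rewrite mule_ge0 ?lee_fin.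
by case: (\int[_]_ _ _)%E (int_ge0 v) => [r _ _|_|//]; rewrite ?ltry// mulry gtr0_sg// mul1e.
Qed.

Lemma second_moment_ge0 j (v : V j) : 0 <= second_moment v.
Proof. exact: fine_ge0. Qed.

Lemma mean_second_moment j : \sum_(v : V j) pV v * second_moment v <= P.
Proof.
rewrite -lee_fin; apply: le_trans (power j); rewrite -sumEFin.
apply: lee_sum => v _; have [->|pv0] := eqVneq (pV v) 0; first by rewrite mul0r mul0e.
have pv : 0 < pV v by rewrite lt_neqAle eq_sym pv0 pV_ge0.
by rewrite second_momentE.
Qed.

Variable beta : 'I_K -> R.
Hypothesis beta_ge0 : forall i, 0 <= beta i.
Hypothesis cond_info_le : forall i o, o != Some i -> cond_info h g pV mu i o <= beta i.
Variable d : R.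
Hypothesis d_gt0 : 0 < d.
Hypothesis gap : forall j, Rt j + beta j + 6 * d <= single_info h g pV mu j.

Let agree_all (M : 'I_K -> nat) (w u : msg M) :
  (msg_all w == msg_all u) = agree (enum 'I_K) w u.
Proof.
apply/eqP/allP => [|H]; first by rewrite /msg_all => -> j _.
apply/ffunP => j; apply/eqP; apply: H.
by rewrite mem_enum.
Qed.

Let agree_mi (M : 'I_K -> nat) i (w u : msg M) :
  (msg_mi i w == msg_mi i u) = agree [seq j <- enum 'I_K | j != i] w u.
Proof.
apply/eqP/allP => [/ffunP H j|H].
  rewrite mem_filter => /andP[ji _]; have := H j; rewrite !ffunE (negbTE ji) => -[->].
  by rewrite eqxx.
apply/ffunP => j; rewrite !ffunE; case: eqVneq => [//|ji]; congr Some.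
by apply/eqP; apply: H; rewrite mem_filter ji mem_enum.
Qed.

Lemma achievable_of_gap : achievable P h g Rt.
Proof.
move=> eps eps0.
(* One idle use is inserted for every [q] active ones, so that carrying the rate over the idle uses
   costs at most [d] per active use. *)
have [q q0 hq] := exists_nat_bound (fun j => Rt j / d).
(* The power slack [dP] defined next is fixed by [idle_power]; its value 1 for [P <= 0] is only a
   positive placeholder, that case being settled without idle energy. *)
have q0R : 0 < q%:R :> R by rewrite ltr0n.
pose dP := if 0 < P then P / (3 * q%:R) else 1.
have dP0 : 0 < dP by rewrite /dP; case: ifP => // P0; rewrite divr_gt0// mulr_gt0.
pose S j := \sum_(v : V j) pV v * (expR (second_moment v) + expR (- second_moment v)).
have S0 j : 0 <= S j.
  by apply: sumr_ge0 => v _; rewrite mulr_ge0// addr_ge0// expR_ge0.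
have card_gt0 j : 0 < #|V j|%:R + 1 :> R by rewrite ltr_wpDl.
pose slack (x : 'I_K + 'I_K) := match x with
  | inl j => d / (16 * (#|V j|%:R + 1)) | inr j => dP / (16 * S j + 1) end.
have [s0 s0_gt0 hs0] : exists2 s0, 0 < s0 & forall x, s0 <= slack x.
  apply: exists_lower_bound => -[j|j] /=; first by rewrite divr_gt0// mulr_gt0.
  by rewrite divr_gt0// ltr_wpDl// mulr_ge0.
pose s := Num.min 2^-1 s0.
have s_gt0 : 0 < s by rewrite lt_min s0_gt0 andbT.
have s_le : s <= 2^-1 by rewrite ge_min lexx.
have sV j : 16 * s * (#|V j|%:R + 1) <= d.
  have : s <= slack (inl j) by rewrite ge_min hs0 orbT.
  by rewrite /slack ler_pdivlMr ?mulr_gt0// mulrCA mulrA.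
have sS j : 16 * s * S j <= dP.
  have S1 : 0 < 16 * S j + 1 by rewrite ltr_wpDl// mulr_ge0.
  have : s <= slack (inr j) by rewrite ge_min hs0 orbT.
  by rewrite /slack ler_pdivlMr// mulrDr mulr1 mulrCA mulrA => /(le_trans _); apply; rewrite lerDl ltW.
pose eta := Num.min eps dP.
have eta_gt0 : 0 < eta by rewrite lt_min eps0.
have eta_eps : eta <= eps by rewrite ge_min lexx.
have eta_dP : eta <= dP by rewrite ge_min lexx orbT.
pose dmin := Num.min d dP.
have dmin_gt0 : 0 < dmin by rewrite lt_min d_gt0.
have dmin_d : dmin <= d by rewrite ge_min lexx.
have dmin_dP : dmin <= dP by rewrite ge_min lexx orbT.
pose A := (K * (K + 3))%:R * (5 + s^-1).
(* [m] makes [A <= eta * x] for the exponent [x] below; then [A * expR (- x) <= eta], since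
   [x <= expR x]. *)
have [m m0 hm] := exists_nat_bound (fun _ : unit => A / (eta * (s * dmin))).
have m1R : 1 <= m%:R :> R by rewrite ler1n.
have q1R : 1 <= q%:R :> R by rewrite ler1n.
pose n1 := (q * m)%N; pose n := (q.+1 * m)%N.
have n1n : (n1 <= n)%N by rewrite leq_mul2r leqnSn orbT.
have n1E : n1%:R = q%:R * m%:R :> R by rewrite natrM.
have nE : n%:R = n1%:R + m%:R :> R by rewrite /n mulSn natrD natrM addrC.
have n_gt0 : (0 < n)%N by rewrite muln_gt0.
have n1m : m%:R <= n1%:R :> R by rewrite n1E ler_peMl.
have n1_ge0 : 0 <= n1%:R :> R by [].
pose M j := exp_ceil (n%:R * Rt j); pose L j := exp_ceil (n1%:R * (beta j + 2 * d)).
have M0 j : (0 < M j)%N by []. have L0 j : (0 < L j)%N by [].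
pose gam j := n1%:R * (single_info h g pV mu j - 2 * d).
pose theta (_ : 'I_K) := n1%:R * (P + 2 * dP).
(* A common exponent, below both [n1 * s * d] and [n1 * s * dP], serves the error, leakage and power
   bounds. *)
pose x := m%:R * (s * dmin).
(* The 5 is 1 for the miss plus 4 for the false alarms, as each of [M j] and [L j] may double when
   rounded up; [s^-1] comes from the leakage and power bounds. *)
pose e := (5 + s^-1) * expR (- x).
have si0 : 0 < s^-1 by rewrite invr_gt0.
have s_le1 : s <= 1 by apply: (le_trans s_le); rewrite invf_le1// ler1n.
have nsd : m%:R * (s * dmin) <= n1%:R * (s * d) by rewrite !ler_pM ?mulr_ge0// ltW.
have nsdP : m%:R * (s * dmin) <= n1%:R * (s * dP) by rewrite !ler_pM ?mulr_ge0// ltW.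
have error_bound j :
  expR (s * gam j) * expR (n1%:R * (- s * single_info h g pV mu j + 16 * s ^+ 2 * (#|V j|%:R + 1))) +
    (M j * L j)%:R * expR (- gam j) <= e.
  have b1 : expR (s * gam j) *
      expR (n1%:R * (- s * single_info h g pV mu j + 16 * s ^+ 2 * (#|V j|%:R + 1))) <= expR (- x).
    by rewrite -expRD ler_expR; exact: error_exponent.
  have b2 : (M j * L j)%:R * expR (- gam j) <= 4 * expR (- x).
    have hM : (M j)%:R <= 2 * expR (n%:R * Rt j) by rewrite exp_ceil_le// mulr_ge0.
    have hL : (L j)%:R <= 2 * expR (n1%:R * (beta j + 2 * d)).
      by rewrite exp_ceil_le// mulr_ge0// addr_ge0// mulr_ge0// ltW.
    rewrite natrM.
    apply: (@le_trans _ _ ((2 * expR (n%:R * Rt j)) * (2 * expR (n1%:R * (beta j + 2 * d))) * expR (- gam j))).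
      by rewrite ler_wpM2r ?expR_ge0// ler_pM.
    rewrite (_ : _ * _ * _ = 4 * expR (n%:R * Rt j + n1%:R * (beta j + 2 * d) - gam j)); last first.
      by rewrite !expRD; ring.
    rewrite ler_pM2l// ler_expR nE.
    apply: (rate_exponent n1_ge0 _ (gap j) d_gt0 s_le1 nsd).
    have := hq j; rewrite ler_pdivrMr// => hR.
    by rewrite n1E [q%:R * _]mulrC -mulrA ler_wpM2l.
  apply: (le_trans (lerD b1 b2)).
  have -> : expR (- x) + 4 * expR (- x) = 5 * expR (- x) by ring.
  by rewrite /e ler_wpM2r ?expR_ge0// lerDl ltW.
have leakage_bound i o : o != Some i ->
  s^-1 * expR (- s * ln (L i)%:R) *
    expR (n1%:R * (s * cond_info h g pV mu i o + 16 * s ^+ 2 * (#|V i|%:R + 1))) <= e.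
  move=> oi; rewrite -mulrA -expRD.
  have b1 : expR (- s * ln (L i)%:R +
      n1%:R * (s * cond_info h g pV mu i o + 16 * s ^+ 2 * (#|V i|%:R + 1))) <= expR (- x).
    rewrite ler_expR; apply: (leakage_exponent n1_ge0 s_gt0 (sV i) (cond_info_le oi) _ nsd).
    exact: ln_exp_ceil_ge.
  by apply: (le_trans (ler_wpM2l (ltW si0) b1)); rewrite le_5Dinv// expR_ge0.
have power_bound j :
  s^-1 * expR (- s * theta j) * expR (n1%:R * (s * (\sum_(v : V j) pV v * second_moment v) +
    16 * s ^+ 2 * \sum_(v : V j) pV v * (expR (second_moment v) + expR (- second_moment v)))) <= e.
  rewrite -mulrA -expRD -/(S j).
  have b1 : expR (- s * theta j + n1%:R * (s * (\sum_(v : V j) pV v * second_moment v) +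
      16 * s ^+ 2 * S j)) <= expR (- x).
    by rewrite ler_expR; apply: power_exponent => //; exact: mean_second_moment.
  by apply: (le_trans (ler_wpM2l (ltW si0) b1)); rewrite le_5Dinv// expR_ge0.
have eta_bound : (K * (K + 3))%:R * e <= eta.
  rewrite /e mulrA -/A expRN ler_pdivrMr ?expR_gt0//.
  have : A <= eta * x.
    by have := hm tt; rewrite ler_pdivrMr ?mulr_gt0// /x mulrCA.
  move=> /le_trans; apply; rewrite ler_wpM2l ?(ltW eta_gt0)//.
  by apply: le_trans (expR_ge1Dx x); rewrite lerDr.
have [C [QC errC leakC powC]] := @exists_good_codebook R K n V h g pV pV_ge0 pV_sum1 mu M L M0 L0
  n1 n1n second_moment gam theta s e eta s_gt0 s_le error_bound leakage_bound power_bound eta_bound.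
exists n, M, (scheme h g pV (padded mu n1) M0 L0 gam C).
have n1R : 1 <= n%:R :> R by rewrite ler1n.
have secrecy (o : option 'I_K) (B : finType) (a : msg M -> B) (t : seq 'I_K) : uniq t ->
    (forall w u : msg M, (a w == a u) = agree t w u) -> (t = [seq i <- enum 'I_K | o != Some i]) ->
    ((condH_disc (@p_msg R K M) a (fun _ => tt) - n%:R * eps)%:E <=
     condH_cont (@p_msg R K M) a (fun _ => tt)
       (blk_density h g (scheme h g pV (padded mu n1) M0 L0 gam C) o) (@int_Rn R n))%E.
  move=> ut ag tE.
  have := @scheme_secrecy R K n V h g pV pV_ge0 pV_sum1 (padded mu n1) M L M0 L0 gam C o B a t ut ag.
  rewrite EFinB leeBlDr// => /le_trans; apply; rewrite leeD2l//.
  (* The total leakage is at most [eta <= eps], hence below [n * eps] since [n >= 1]. *)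
  rewrite tE big_filter big_enum_cond/=.
  apply: (le_trans (leakC o)); rewrite lee_fin; apply: (le_trans eta_eps).
  by rewrite ler_peMl// ltW.
split.
  split => // j; rewrite ler_pdivlMr ?ltr0n// mulrC.
  exact: ln_exp_ceil_ge.
split.
  move=> j; under eq_bigr => w _.
    rewrite (@scheme_power R K n V h g pV (padded mu n1) M L M0 L0 gam C j w
      (fun t v => if (t < n1)%N then second_moment v else 0)); last first.
      move=> l t.
      exact: (@padded_second_moment R K n V pV pV_ge0 mu M L n1 second_moment C j (w, l) t
        (@second_momentE j) QC).
  over.
  rewrite sumEFin lee_fin.
  have [P0|P0] := ltP 0 P.
    have := avg_active_cost_le M0 L0 n1 second_moment C j (theta j) s_gt0.
    move=> /le_trans; apply; rewrite -mulrA ler_wpM2l//.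
    apply: (@le_trans _ _ (theta j + dP)); first by rewrite lerD2l (le_trans (powC j)).
    have dPE : dP * (3 * q%:R) = P.
      by rewrite /dP P0 divfK// gt_eqF// mulr_gt0.
    by rewrite /theta nE; apply: idle_power n1E dPE => //; exact: le_trans n1m.
  (* Without positive power, every letter in the support of the codebook has zero energy. *)
  have mean0 : \sum_(v : V j) pV v * second_moment v = 0.
    apply/eqP; rewrite eq_le (le_trans (mean_second_moment j) P0) sumr_ge0// => v _.
    by rewrite mulr_ge0// second_moment_ge0.
  have P00 : 0 <= P.
    by rewrite -mean0; exact: mean_second_moment.
  rewrite big1 ?mulr_ge0// => w _; rewrite big1// => l _.
  rewrite big1 ?mulr0// => t _; case: ifP => // _.
  have pv := @codebook_support R K n V pV pV_ge0 M L C j (w, l) t QC.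
  have cost0 (v : V j) : true -> 0 <= pV v * second_moment v.
    by move=> _; rewrite mulr_ge0// second_moment_ge0.
  have /eqP := psumr_eq0P cost0 mean0 (isT : xpredT (C j (w, l) t)).
  by rewrite mulf_eq0 gt_eqF//= => /eqP.
split; first by move=> j w; exact: scheme_dec_measurable.
split.
  by move=> j; rewrite scheme_errorE; apply: (le_trans (errC j)); rewrite lee_fin.
split.
  apply: (secrecy None _ _ (enum 'I_K)); [exact: enum_uniq|exact: agree_all|].
  by rewrite filter_predT.
move=> i; apply: (secrecy (Some i) _ _ [seq j <- enum 'I_K | j != i]).
- by rewrite filter_uniq// enum_uniq.
- exact: agree_mi.
- by apply: eq_filter => j; rewrite eq_sym.
Qed.

End achievability.

Theorem theorem2 (R : realType) (K : nat) (P : R)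
  (h : 'I_K -> 'I_K -> R) (g : 'I_K -> R)
  (h_nz : forall j i, h j i != 0) (g_nz : forall j, g j != 0)
  (V : 'I_K -> finType) (pV : forall j, V j -> R)
  (pV_ge0 : forall j v, 0 <= pV j v) (pV_sum1 : forall j, \sum_(v : V j) pV j v = 1)
  (mu : forall j, V j -> probability R R)
  (power : forall j,
     (\sum_(v : V j) (pV j v)%:E * \int[mu j v]_x ((x ^+ 2)%R)%:E <= P%:E)%E)
  (Rt : 'I_K -> R)
  (Rt_ge0 : forall i, 0 <= Rt i)
  (Rt_lt : forall i,
     ((Rt i)%:E < MI_single h g pV mu i (Some i)
        - \big[maxe/-oo]_(o : option 'I_K | o != Some i) MI_cond h g pV mu i o)%E) :
  achievable P h g Rt.
Proof.
have pV0 j v : 0 <= pV j v by exact: pV_ge0.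
have pV1 j : \sum_(v : V j) pV j v = 1 by exact: pV_sum1.
have joint0 u : 0 <= pV_joint pV u by exact: (dweight_ge0 u pV0).
have joint1 : \sum_u pV_joint pV u = 1 by exact: (sum_dweight1 pV1).
have condE i o : MI_cond h g pV mu i o = (cond_info h g pV mu i o)%:E.
  rewrite fineK//; apply: minfo_fin => // u; [exact: out_density_measurable|
    exact: out_density_gt0|exact: out_density_int].
have singleE i : MI_single h g pV mu i (Some i) = (single_info h g pV mu i)%:E.
  rewrite fineK//; apply: minfo_fin => // u; [exact: out_density_measurable|
    exact: out_density_gt0|exact: out_density_int].
have cond0 i o : 0 <= cond_info h g pV mu i o.
  apply: fine_ge0; apply: minfo_ge0 => // u; [exact: out_density_measurable|
    exact: out_density_gt0|exact: out_density_int].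
have rate i o : o != Some i -> Rt i + cond_info h g pV mu i o < single_info h g pV mu i.
  move=> oi; rewrite -ltrBrDr -lte_fin EFinB -singleE -condE.
  apply: (lt_le_trans (Rt_lt i)); apply: leeB => //.
  exact: (le_bigmax_cond _ (fun o => MI_cond h g pV mu i o)).
(* The real maximum starts from 0 instead of [-oo], which is harmless since conditional informations
   are nonnegative. *)
pose beta i := \big[Num.max/0]_(o | o != Some i) cond_info h g pV mu i o.
have beta0 i : 0 <= beta i by exact: bigmax_ge_id.
have beta_le i o : o != Some i -> cond_info h g pV mu i o <= beta i.
  by move=> oi; exact: (le_bigmax_cond _ (fun o => cond_info h g pV mu i o)).
have gap0 i : 0 < single_info h g pV mu i - beta i - Rt i.
  suff : beta i < single_info h g pV mu i - Rt i by lra.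
  apply: bigmax_lt => [|o oi]; last by have := rate i o oi; lra.
  (* The starting value 0 is covered by the eavesdropper, an output that always takes part in the
     maximum. *)
  by have := rate i None isT; have := cond0 i None; lra.
have [d d0 hd] := exists_lower_bound (F := fun i => (single_info h g pV mu i - beta i - Rt i) / 6)
  (fun i => divr_gt0 (gap0 i) (ltr0Sn _ _)).
apply: (achievable_of_gap pV0 pV1 power Rt_ge0 beta0 beta_le d0) => i.
have := hd i; lra.
Qed.
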